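(* Suppose $d > 2$, $\Gamma$ is a word hyperbolic group, and $\rho : \Gamma \rightarrow \mathrm{PGL}_d(\mathbb{R})$ is a Zariski dense projective Anosov representation with boundary map $\xi : \partial \Gamma \rightarrow \mathbb{P}(\mathbb{R}^d)$. Then $\xi(\partial \Gamma)$ is not a $C^2$ submanifold of $\mathbb{P}(\mathbb{R}^d)$.
   Context: ''Zariski dense'' means that the image $\rho(\Gamma)$ is Zariski dense in $\mathrm{PGL}_d(\mathbb{R})$. For $g \in \mathrm{PGL}_d(\mathbb{R})$, $\lambda_1(g) \geq \dots \geq \lambda_d(g)$ denote the absolute values of the eigenvalues (with multiplicity) of any lift $\tilde g \in \mathrm{GL}_d(\mathbb{R})$ with $\det \tilde g = \pm 1$. For a word hyperbolic group $\Gamma$ with Gromov boundary $\partial\Gamma$, finite symmetric generating set $S$ and word metric $d_S$, put $\ell_S(\gamma) = \inf_{x \in \Gamma} d_S(\gamma x, x)$. A representation $\rho : \Gamma \rightarrow \mathrm{PGL}_d(\mathbb{R})$ is projective Anosov if there exist continuous maps (its boundary maps) $\xi : \partial \Gamma \rightarrow \mathbb{P}(\mathbb{R}^d)$, $\eta : \partial \Gamma \rightarrow \mathbb{P}(\mathbb{R}^{d*})$ and constants $C,c>0$ such that: $\xi,\eta$ are $\rho$-equivariant; they are dynamics-preserving (for every $\gamma$ of infinite order with attracting fixed point $x_\gamma^+ \in \partial\Gamma$, $\xi(x_\gamma^+)$ and $\eta(x_\gamma^+)$ are attracting fixed points of $\rho(\gamma)$ on $\mathbb{P}(\mathbb{R}^d)$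 and $\mathbb{P}(\mathbb{R}^{d*})$); they are transverse ($\xi(x) + \ker \eta(y) = \mathbb{R}^d$ for all distinct $x,y$); and $\log \frac{\lambda_1(\rho(\gamma))}{\lambda_2(\rho(\gamma))} \geq C\ell_S(\gamma) - c$ for all $\gamma \in \Gamma$. *)

(* Defs.v *)
From HB Require Import structures.
From mathcomp Require Import all_boot all_order all_algebra.
From mathcomp Require Import all_classical all_reals all_analysis.
From mathcomp Require complex mpoly.
Import (canonicals, coercions) complex mpoly.
Set Implicit Arguments.
Unset Strict Implicit.
Unset Printing Implicit Defensive.
Import Order.TTheory GRing.Theory Num.Theory.
Import numFieldNormedType.Exports.
Local Open Scope classical_set_scope.
Local Open Scope quotient_scope.
Local Open Scope ring_scope.

Definition word_of (G : groupType) (S : seq G) (w : seq G) (g : G) : Prop :=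
  {subset w <= S} /\ g = foldr *%g 1%g w.

Record generating_set (G : groupType) := GeneratingSet {
  gens :> seq G;
  gens_sym : forall s, s \in gens -> (s^-1)%g \in gens;
  gens_gen : forall g, exists w, word_of gens w g
}.

Section WordMetric.
Context {G : groupType} (S : generating_set G).
Implicit Types x y z g : G.

Lemma word_length_subproof g :
  exists n, `[< exists2 w, word_of S w g & size w = n >].
Proof. by have [w wg] := gens_gen S g; exists (size w); apply/asboolP; exists w. Qed.

Definition word_length g : nat := ex_minn (word_length_subproof g).

Definition word_dist x y : nat := word_length (x^-1 * y)%g.

Lemma translation_length_subproof g :
  exists n, `[< exists x, word_dist (g * x)%g x = n >].
Proof. by exists (word_dist (g * 1)%g 1%g); apply/asboolP; exists 1%g. Qed.

Definition translation_length g : nat := ex_minn (translation_length_subproof g).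

Definition gromov_product o x y : rat :=
  ((word_dist o x)%:R + (word_dist o y)%:R - (word_dist x y)%:R) / 2%:R.

Definition word_hyperbolic : Prop := exists delta : rat, forall o x y z,
  Num.min (gromov_product o x y) (gromov_product o y z) - delta
    <= gromov_product o x z.

Lemma word_length_le g w : word_of S w g -> (word_length g <= size w)%N.
Proof.
rewrite /word_length; case: ex_minnP => n _ nmin wg.
by apply: nmin; apply/asboolP; exists w.
Qed.

Lemma word_lengthP g : exists2 w, word_of S w g & size w = word_length g.
Proof. by rewrite /word_length; case: ex_minnP => n /asboolP. Qed.

Lemma word_length1 : word_length 1%g = 0%N.
Proof. by apply/eqP; rewrite -leqn0; exact: (@word_length_le _ [::]). Qed.

Lemma word_lengthM x y :
  (word_length (x * y)%g <= word_length x + word_length y)%N.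
Proof.
have [v [vS xE] <-] := word_lengthP x; have [w [wS yE] <-] := word_lengthP y.
rewrite -size_cat; apply: word_length_le; split.
  by move=> s; rewrite mem_cat => /orP[/vS|/wS].
rewrite foldr_cat -yE xE; elim: v {vS xE} => [|s v IH] /=.
  by rewrite mul1g.
by rewrite -IH mulgA.
Qed.

Lemma word_lengthV_le x : (word_length x^-1%g <= word_length x)%N.
Proof.
have [v [vS xE] <-] := word_lengthP x.
rewrite -(size_rev v) -(size_map (fun s : G => s^-1%g)).
apply: word_length_le; split.
  by move=> _ /mapP[s + ->]; rewrite mem_rev => /vS; exact: gens_sym.
rewrite xE map_rev => {vS xE}; elim: v => [|s v IH] /=; first by rewrite invg1.
rewrite invgM IH rev_cons -cats1 foldr_cat /= mulg1.
elim: (rev _) => [|t u IHu] /=; first by rewrite mul1g.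
by rewrite -IHu mulgA.
Qed.

Lemma word_distxx x : word_dist x x = 0%N.
Proof. by rewrite /word_dist mulVg word_length1. Qed.

Lemma word_distC x y : word_dist x y = word_dist y x.
Proof.
rewrite /word_dist; apply/eqP; rewrite eqn_leq.
rewrite -{1}(invgK y) -invgM (word_lengthV_le (y^-1 * x)%g) /=.
by rewrite -{1}(invgK x) -invgM word_lengthV_le.
Qed.

Lemma word_dist_triangle y x z :
  (word_dist x z <= word_dist x y + word_dist y z)%N.
Proof.
apply: leq_trans (word_lengthM _ _).
by rewrite -mulgA [(y * _)%g]mulgA mulgV mul1g.
Qed.

Lemma word_distMl g x y : word_dist (g * x)%g (g * y)%g = word_dist x y.
Proof. by rewrite /word_dist invgM -mulgA [(g^-1 * _)%g]mulgA mulVg mul1g. Qed.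

End WordMetric.

Section GromovBoundary.
Context {G : groupType} (S : generating_set G).

(* Rays may start at any vertex of the Cayley graph. *)
Definition geodesic_ray : set {ptws nat -> discrete_topology G} :=
  [set r | forall i j, (i <= j)%N -> word_dist S (r i) (r j) = (j - i)%N].

Definition asymptotic (r s : geodesic_ray) : bool :=
  `[< exists K : nat, forall n, (word_dist S (val r n) (val s n) <= K)%N >].

Lemma asymptotic_refl : reflexive asymptotic.
Proof. by move=> r; apply/asboolP; exists 0%N => n; rewrite word_distxx. Qed.

Lemma asymptotic_sym : symmetric asymptotic.
Proof.
by move=> r s; apply/asboolP/asboolP => -[K rs]; exists K => n;
  rewrite word_distC.
Qed.

Lemma asymptotic_trans : transitive asymptotic.
Proof.
move=> s r t /asboolP[K rs] /asboolP[L st]; apply/asboolP; exists (K + L)%N.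
by move=> n; apply: leq_trans (word_dist_triangle S (val s n) _ _) _;
  rewrite leq_add.
Qed.

Canonical asymptotic_equiv :=
  EquivRel asymptotic asymptotic_refl asymptotic_sym asymptotic_trans.

(* Rays carry the topology of pointwise convergence.  Each of the (open and
   closed) sets of rays with a given origin already surjects onto the boundary,
   and the usual topology is the quotient one from any of them. *)
Definition boundary : Type := quotient_topology {eq_quot asymptotic_equiv}.
HB.instance Definition _ := Topological.on boundary.
HB.instance Definition _ := Quotient.on boundary.

Lemma translate_ray_subproof (g : G) (r : geodesic_ray) :
  (fun n => (g * val r n)%g) \in geodesic_ray.
Proof.
rewrite inE => i j ij /=; rewrite word_distMl.
by have := set_valP r; exact.
Qed.

Definition translate_ray (g : G) (r : geodesic_ray) : geodesic_ray :=
  Sub (fun n => (g * val r n)%g) (translate_ray_subproof g r).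

Definition boundary_act (g : G) (x : boundary) : boundary :=
  \pi_boundary (translate_ray g (repr x)).

Definition cvg_boundary (u : nat -> G) (x : boundary) : Prop :=
  forall M : rat, exists N : nat, forall n m : nat, (N <= n)%N -> (N <= m)%N ->
    M <= gromov_product S 1%g (u n) (val (repr x) m).

(* x is the attracting fixed point of g: attraction is expressed in the
   compactification of G by its boundary, because on a boundary reduced to two
   points both fixed points are isolated. *)
Definition boundary_attracting (g : G) (x : boundary) : Prop :=
  boundary_act g x = x /\ cvg_boundary (fun n => (g ^+ n)%g) x.

End GromovBoundary.

Definition infinite_order (G : groupType) (g : G) : Prop :=
  forall n, (0 < n)%N -> (g ^+ n)%g <> 1%g.

Section Projective.
Context {R : realType} (V : normedModType R).

Definition nonzero : set V := [set v | v != 0].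

Definition collinear (v w : nonzero) : bool :=
  `[< exists2 c : R, c != 0 & val w = c *: val v >].

Lemma collinear_refl : reflexive collinear.
Proof.
by move=> v; apply/asboolP; exists 1; rewrite ?oner_neq0 ?scale1r.
Qed.

Lemma collinear_sym : symmetric collinear.
Proof.
by move=> v w; apply/asboolP/asboolP => -[c c0 ->]; exists c^-1;
  rewrite ?invr_neq0 // scalerA mulVf ?scale1r.
Qed.

Lemma collinear_trans : transitive collinear.
Proof.
move=> w v z /asboolP[c c0 wE] /asboolP[e e0 zE]; apply/asboolP.
by exists (e * c); rewrite ?mulf_neq0 // zE wE scalerA.
Qed.

Canonical collinear_equiv :=
  EquivRel collinear collinear_refl collinear_sym collinear_trans.

Definition projective : Type := quotient_topology {eq_quot collinear_equiv}.
HB.instance Definition _ := Topological.on projective.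
HB.instance Definition _ := Quotient.on projective.

Definition line_vec (x : projective) : V := val (repr x).

End Projective.

Section PGL.
Context (R : realType) (d : nat).

Definition GL : Type := {A : 'M[R]_d | A \in unitmx}.
HB.instance Definition _ := SubChoice.on GL.

Definition pgl_rel (A B : GL) : bool :=
  `[< exists2 c : R, c != 0 & val B = c *: val A >].

Lemma pgl_rel_refl : reflexive pgl_rel.
Proof.
by move=> v; apply/asboolP; exists 1; rewrite ?oner_neq0 ?scale1r.
Qed.

Lemma pgl_rel_sym : symmetric pgl_rel.
Proof.
by move=> v w; apply/asboolP/asboolP => -[c c0 ->]; exists c^-1;
  rewrite ?invr_neq0 // scalerA mulVf ?scale1r.
Qed.

Lemma pgl_rel_trans : transitive pgl_rel.
Proof.
move=> w v z /asboolP[c c0 wE] /asboolP[e e0 zE]; apply/asboolP.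
by exists (e * c); rewrite ?mulf_neq0 // zE wE scalerA.
Qed.

Canonical pgl_equiv := EquivRel pgl_rel pgl_rel_refl pgl_rel_sym pgl_rel_trans.

Definition PGL : Type := {eq_quot pgl_equiv}.
HB.instance Definition _ := Choice.on PGL.
HB.instance Definition _ := EqQuotient.on PGL.

Definition gl1 : GL := Sub 1%:M (unitmx1 R d).

Lemma glM_subproof (A B : GL) : val A *m val B \in unitmx.
Proof. by rewrite unitmx_mul (valP A) (valP B). Qed.
Definition glM (A B : GL) : GL := Sub (val A *m val B) (glM_subproof A B).

Lemma glV_subproof (A : GL) : invmx (val A) \in unitmx.
Proof. by rewrite unitmx_inv (valP A). Qed.
Definition glV (A : GL) : GL := Sub (invmx (val A)) (glV_subproof A).

Definition pgl1 : PGL := \pi_PGL gl1.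
Definition pglM (g h : PGL) : PGL := \pi_PGL (glM (repr g) (repr h)).
Definition pglV (g : PGL) : PGL := \pi_PGL (glV (repr g)).

Lemma pgl_eqP (A B : GL) :
  reflect (exists2 c : R, c != 0 & val B = c *: val A)
          (\pi_PGL A == \pi_PGL B).
Proof. by rewrite eqmodE; exact: asboolP. Qed.

Lemma repr_pgl (A : GL) :
  exists2 c : R, c != 0 & val (repr (\pi_PGL A)) = c *: val A.
Proof. by apply/pgl_eqP; rewrite reprK. Qed.

Lemma pi_pglM (A B : GL) :
  pglM (\pi_PGL A) (\pi_PGL B) = \pi_PGL (glM A B).
Proof.
have [a a0 aE] := repr_pgl A; have [b b0 bE] := repr_pgl B.
apply/esym/eqP/pgl_eqP; exists (a * b); first by rewrite mulf_neq0.
by rewrite /= aE bE -scalemxAl -scalemxAr scalerA.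
Qed.

Lemma pi_pglV (A : GL) : pglV (\pi_PGL A) = \pi_PGL (glV A).
Proof.
have [a a0 aE] := repr_pgl A.
apply/esym/eqP/pgl_eqP; exists a^-1; first by rewrite invr_neq0.
by rewrite /= aE invmxZ // -aE; exact: (valP (repr _)).
Qed.

Lemma pglMA : associative pglM.
Proof.
elim/quotW=> A; elim/quotW=> B; elim/quotW=> C.
rewrite (pi_pglM A B) (pi_pglM B C) !pi_pglM.
by apply: congr1; apply: val_inj => /=; rewrite mulmxA.
Qed.

Lemma pgl1M : left_id pgl1 pglM.
Proof.
elim/quotW=> A; rewrite pi_pglM.
by apply: congr1; apply: val_inj => /=; rewrite mul1mx.
Qed.

Lemma pglM1 : right_id pgl1 pglM.
Proof.
elim/quotW=> A; rewrite pi_pglM.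
by apply: congr1; apply: val_inj => /=; rewrite mulmx1.
Qed.

Lemma pglVM : left_inverse pgl1 pglV pglM.
Proof.
elim/quotW=> A; rewrite pi_pglV pi_pglM.
apply: congr1; apply: val_inj => /=; rewrite mulVmx //; exact: (valP A).
Qed.

Lemma pglMV : right_inverse pgl1 pglV pglM.
Proof.
elim/quotW=> A; rewrite pi_pglV pi_pglM.
apply: congr1; apply: val_inj => /=; rewrite mulmxV //; exact: (valP A).
Qed.

HB.instance Definition _ := isGroup.Build PGL pglMA pgl1M pglM1 pglVM pglMV.

Definition pgl_mx (g : PGL) : 'M[R]_d := val (repr g).

(* The coordinate ring of PGL_d is the degree 0 part of R[x_ij][1/det], so the
   closed sets are those cut out by homogeneous polynomials in the entries of a
   lift; whether such a polynomial vanishes does not depend on the lift. *)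
Definition pgl_root (p : mpoly.mpoly (d * d) R) (g : PGL) : Prop :=
  mpoly.meval (fun k => mxvec (pgl_mx g) 0 k) p = 0.

Definition zariski_closed (Z : set PGL) : Prop :=
  exists2 P : set (mpoly.mpoly (d * d) R),
    (forall p, P p -> p \is mpoly.ishomog mpoly.mdeg)
    & Z = [set g | forall p, P p -> pgl_root p g].

Definition zariski_dense (E : set PGL) : Prop :=
  forall Z, zariski_closed Z -> E `<=` Z -> Z = setT.

Definition eigenvalues (A : 'M[R]_d) : seq (complex.complex R) :=
  sval (closed_field_poly_normal
          (map_poly (complex.real_complex R) (char_poly A))).

Definition eigenmoduli (A : 'M[R]_d) : seq R :=
  sort >=%R [seq complex.ComplexField.Normc.normc z | z <- eigenvalues A].

Definition pgl_lift (g : PGL) : 'M[R]_d :=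
  (`|\det (pgl_mx g)| `^ (- d%:R^-1)) *: pgl_mx g.

Lemma det_pgl_lift (g : PGL) : (0 < d)%N -> `|\det (pgl_lift g)| = 1.
Proof.
move=> d0; rewrite /pgl_lift detZ normrM normrX ger0_norm ?powR_ge0 //.
have det_neq0 : `|\det (pgl_mx g)| != 0.
  by rewrite normr_eq0 -unitfE; have := valP (repr g); rewrite unitmxE.
rewrite -powR_mulrn ?powR_ge0 // -powRrM mulNr mulVf ?pnatr_eq0 -?lt0n //.
by rewrite powR_inv1 ?normr_ge0 // mulVf.
Qed.

(* numbered from 1 *)
Definition lambda (i : nat) (g : PGL) : R := (eigenmoduli (pgl_lift g))`_i.-1.

Local Notation PV := (projective 'cV[R]_d).
(* a row vector f stands for the linear form v |-> f *m v *)
Local Notation PVdual := (projective 'rV[R]_d).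

Lemma pgl_act_subproof (g : PGL) (x : PV) :
  pgl_mx g *m line_vec x \in @nonzero R 'cV[R]_d.
Proof.
rewrite inE /nonzero /=; apply/eqP => gx0.
have /negP[] : line_vec x != 0 by have := set_valP (repr x).
apply/eqP; rewrite -(mul1mx (line_vec x)) -(mulVmx (valP (repr g))).
by rewrite -mulmxA gx0 mulmx0.
Qed.

Definition pgl_act (g : PGL) (x : PV) : PV :=
  \pi_PV (Sub (pgl_mx g *m line_vec x) (pgl_act_subproof g x)).

Lemma pgl_dual_act_subproof (g : PGL) (y : PVdual) :
  line_vec y *m invmx (pgl_mx g) \in @nonzero R 'rV[R]_d.
Proof.
rewrite inE /nonzero /=; apply/eqP => yg0.
have /negP[] : line_vec y != 0 by have := set_valP (repr y).
apply/eqP; rewrite -(mulmx1 (line_vec y)) -(mulVmx (valP (repr g))).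
by rewrite mulmxA yg0 mul0mx.
Qed.

Definition pgl_dual_act (g : PGL) (y : PVdual) : PVdual :=
  \pi_PVdual (Sub (line_vec y *m invmx (pgl_mx g)) (pgl_dual_act_subproof g y)).

(* R^d = x + ker y *)
Definition transverse (x : PV) (y : PVdual) : Prop :=
  forall v : 'cV[R]_d, exists (a : R) (u : 'cV[R]_d),
    line_vec y *m u = 0 /\ v = a *: line_vec x + u.

End PGL.

Definition attracting_fixed_point (X : topologicalType) (f : X -> X) (x : X)
    : Prop :=
  f x = x /\ exists2 U, nbhs x U &
    forall W, nbhs x W -> \forall n \near \oo, iter n f @` U `<=` W.

Definition projective_anosov (R : realType) (d : nat) (G : groupType)
    (S : generating_set G) (rho : {multiplicative G -> PGL R d})
    (xi : boundary S -> projective 'cV[R]_d)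
    (eta : boundary S -> projective 'rV[R]_d) : Prop :=
  [/\ continuous xi /\ continuous eta,
      forall g x, xi (boundary_act g x) = pgl_act (rho g) (xi x) /\
                  eta (boundary_act g x) = pgl_dual_act (rho g) (eta x),
      forall g x, infinite_order g -> boundary_attracting g x ->
        attracting_fixed_point (pgl_act (rho g)) (xi x) /\
        attracting_fixed_point (pgl_dual_act (rho g)) (eta x),
      forall x y, x <> y -> transverse (xi x) (eta y)
    & exists C c : R, [/\ 0 < C, 0 < c & forall g,
        C * (translation_length S g)%:R - c
          <= ln (lambda 1 (rho g) / lambda 2 (rho g))]].

(* f is of class C^k on the open set U *)
Fixpoint class_C (R : realType) (V W : normedModType R) (k : nat) (U : set V)
    (f : V -> W) : Prop :=
  (forall x, U x -> {for x, continuous f}) /\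
  if k is k'.+1 then
    (forall x v, U x -> derivable f x v) /\
    (forall v, class_C k' U (fun x => 'D_v f x))
  else True.

(* k-dimensional embedded submanifold of R^n, by C^2 charts of R^n flattening N *)
Definition C2_submanifold (R : realType) (n k : nat) (N : set 'rV[R]_n)
    : Prop :=
  (k <= n)%N /\ forall p, N p ->
  exists (U V : set 'rV[R]_n) (phi psi : 'rV[R]_n -> 'rV[R]_n),
    [/\ open U, U p, open V & phi @` U = V /\ psi @` V = U] /\
    [/\ forall x, U x -> psi (phi x) = x,
        forall y, V y -> phi (psi y) = y,
        class_C 2 U phi, class_C 2 V psi
      & phi @` (N `&` U) =
        V `&` [set y | forall j : 'I_n, (k <= j)%N -> y 0 j = 0]].

Definition hcoord (R : realType) (d : nat) (x : projective 'cV[R]_d) (i : 'I_d)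
    : R := (line_vec x : 'cV[R]_d) i 0.

Definition affine_chart_dom (R : realType) (d : nat) (i : 'I_d)
    : set (projective 'cV[R]_d) := [set x | hcoord x i != 0].

(* [v_0 : ... : v_(d-1)] |-> (v_j / v_i) for j <> i *)
Definition affine_chart (R : realType) (d : nat) (i : 'I_d)
    (x : projective 'cV[R]_d) : 'rV[R]_d.-1 :=
  \row_j (hcoord x (lift i j) / hcoord x i).

Definition projective_C2_submanifold (R : realType) (d : nat)
    (M : set (projective 'cV[R]_d)) : Prop :=
  exists k : nat, forall i : 'I_d,
    C2_submanifold k (affine_chart i @` (M `&` affine_chart_dom i)).

(* Main.v *)
(* Let C be the cone over xi(boundary).  If it were C^2, every linear form l that
   vanishes to first order along C at v in C would agree on C, near v, with a
   quadratic form in w - v up to o(|w - v|^2).  Suppose that v is the attracting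
   line of a proximal lift A of some rho(g), with repelling hyperplane ker phi.
   Equivariance makes the quadratic part intertwine the action of A on these
   conormals l, which also embed in the forms that are o(|w - v|^2) on C by
   l |-> phi l, with its action on forms modulo those; so unless all the quadratic
   parts vanish ("C is flat at v"), A acts on bilinear forms with a multiple
   eigenvalue, an algebraic condition on A.  Elements of bounded translation length
   meet finitely many conjugacy classes, hence lie in a proper Zariski closed set;
   as rho is Anosov and Zariski dense, some proximal A escapes the algebraic
   condition, and C is flat at its v.  Minimality of the boundary then makes C flat
   everywhere, and a C^2 cone that is flat everywhere is locally contained in the
   kernel of its conormals.  Contracting by A, any conormal l at v satisfies
   l phi = 0 on C, against Zariski density.  There is no nonzero conormal only when
   C is open, in which case the dynamics of A makes it everything, against
   transversality as d > 2. *)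

Require Import Defs.
From HB Require Import structures.
From mathcomp Require Import all_boot all_order all_algebra.
From mathcomp Require Import all_classical all_reals all_analysis.
From mathcomp Require Import perm separable.
From mathcomp Require Import zify ring lra.
From mathcomp Require complex mpoly.
Import (canonicals, coercions) complex mpoly.
Set Implicit Arguments.
Unset Strict Implicit.
Unset Printing Implicit Defensive.
Import Order.TTheory GRing.Theory Num.Theory.
Import numFieldNormedType.Exports.
Local Open Scope classical_set_scope.
Local Open Scope ring_scope.

(** * Second order calculus *)

(** Contact along the cone is expressed by the inequalities [conormal 1] and [conormal 2] in [R^d]
    rather than by tangent spaces. Linear maps preserving the cone then carry conormals to conormals
    without any derivative; charts serve to show that quadratic parts exist, that flatness is a
    closed condition and that flat cones are locally linear. Why a multiple eigenvalue: the bilinear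
    forms negligible along the cone are a subspace Z stable under A. Some eigenvalue of A on the
    conormals occurs once inside Z, through l |-> phi l, and once more in the quotient by Z, through
    the quadratic parts. Both maps intertwine because A acts on conormals by l |-> lam l A, lam
    being its eigenvalue at v. Why A can be chosen: tr^d / det is constant on a conjugacy class of
    PGL_d, so finitely many classes lie in an explicit hypersurface. By Zariski density it suffices
    to exhibit one invertible matrix, unrelated to the group, which avoids this hypersurface and
    acts on bilinear forms with simple spectrum: a diagonal matrix with entries t^(2^i) and t
    large. *)

Section LineCalculus.
Context {R : realType} {V : normedModType R}.
Implicit Types (f : V -> R) (x v : V).

Lemma is_derive_line f x v (s : R) : derivable f (x + s *: v) v ->
  is_derive s 1 (fun s => f (x + s *: v)) ('D_v f (x + s *: v)).
Proof.
move=> fv.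
have E : (fun h : R => h^-1 *: (((fun s => f (x + s *: v)) \o shift s) (h *: 1)
                               - f (x + s *: v)))
       = (fun h => h^-1 *: ((f \o shift (x + s *: v)) (h *: v) - f (x + s *: v))).
  apply/funext => h /=; congr (_ *: (f _ - _)).
  by rewrite [h *: 1]mulr1 scalerDl addrCA.
by apply: DeriveDef; rewrite /derivable /derive /= E.
Qed.

Lemma mean_value_line f x v :
  (forall s : R, 0 <= s <= 1 -> derivable f (x + s *: v) v) ->
  exists2 c : R, 0 <= c <= 1 & f (x + v) - f x = 'D_v f (x + c *: v).
Proof.
move=> fv; have der (s : R) : 0 <= s <= 1 ->
    is_derive s 1 (fun s => f (x + s *: v)) ('D_v f (x + s *: v)).
  by move=> /fv; apply: is_derive_line.
have [||c /[!in_itv]/= /andP[c0 c1]] := @MVT R (fun s => f (x + s *: v))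
    (fun s => 'D_v f (x + s *: v)) 0 1 ltr01.
- by move=> s /[!in_itv]/= /andP[s0 s1]; apply: der; rewrite !ltW.
- apply: derivable_within_continuous => s /[!in_itv]/= s01.
  by have [] := der _ s01.
rewrite scale1r scale0r addr0 subr0 mulr1 => E.
by exists c; rewrite // !ltW.
Qed.

Lemma taylor2_line f x v :
  (forall s : R, 0 <= s <= 1 -> derivable f (x + s *: v) v) ->
  (forall s : R, 0 <= s <= 1 -> derivable ('D_v f) (x + s *: v) v) ->
  exists2 c : R, 0 <= c <= 1 &
    f (x + v) = f x + 'D_v f x + 2^-1 * 'D_v ('D_v f) (x + c *: v).
Proof.
move=> fv dfv; set K := f (x + v) - f x - 'D_v f x.
have der (s : R) : 0 <= s <= 1 ->
    is_derive s 1 (fun s => f (x + s *: v)) ('D_v f (x + s *: v)).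
  by move=> /fv; apply: is_derive_line.
have der2 (s : R) : 0 <= s <= 1 -> is_derive s 1 (fun s => 'D_v f (x + s *: v))
    ('D_v ('D_v f) (x + s *: v)).
  by move=> /dfv; apply: is_derive_line.
(* [K] is such that [g] has equal values at 0 and 1. Rolle gives a zero of its derivative, and the
   mean value theorem for ['D_v f] up to that zero then identifies [2 * K] with a second
   derivative. *)
pose g : R -> R := (fun s => f (x + s *: v)) - ('D_v f x *: id) - (K *: (@GRing.exp R)^~ 2).
have gder (s : R) : 0 <= s <= 1 ->
    is_derive s 1 g ('D_v f (x + s *: v) - 'D_v f x - K * (s *+ 2)).
  move=> s01; have := der _ s01 => ders.
  apply: is_derive_eq; rewrite /GRing.scale /= !mulr1 -mulr_natl.
  by congr (_ - _ * _); rewrite mulr_natl.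
have [|||c /[!in_itv]/= /andP[c0 c1]] := @Rolle R g 0 1 ltr01.
- move=> s /[!in_itv]/= /andP[s0 s1].
  by have := gder s; rewrite !ltW// => /(_ isT)[].
- apply: derivable_within_continuous => s /[!in_itv]/= s01.
  by have [] := gder _ s01.
- rewrite /g -![(_ - _ : _ -> _) _]/(_ - _) -![(_ *: _ : _ -> _) _]/(_ *: _).
  rewrite scale0r scale1r addr0 /GRing.scale /= /K; ring.
have gc : is_derive c 1 g ('D_v f (x + c *: v) - 'D_v f x - K * (c *+ 2)).
  by apply: gder; rewrite !ltW.
move=> /@derive_val; rewrite (@derive_val _ _ _ _ _ _ _ gc) => Kc.
have [||e /[!in_itv]/= /andP[e0 e1]] := @MVT R (fun s => 'D_v f (x + s *: v))
    (fun s => 'D_v ('D_v f) (x + s *: v)) 0 c c0.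
- move=> s /[!in_itv]/= /andP[s0 s1]; apply: der2.
  by rewrite ltW// ltW// (lt_trans s1).
- apply: derivable_within_continuous => s /[!in_itv]/= /andP[s0 s1].
  by have := der2 s; rewrite s0 (le_trans s1 (ltW c1)) => /(_ isT)[].
rewrite scale0r addr0 subr0 => E.
exists e; first by rewrite ltW//= ltW// (lt_trans e1).
have {}Kc : (2 * K - 'D_v ('D_v f) (x + e *: v)) * c = 0.
  rewrite mulrBl -E -[RHS]oppr0 -Kc -mulr_natl; ring.
move/eqP: Kc; rewrite mulf_eq0 (gt_eqF c0) orbF subr_eq0 => /eqP <-.
by rewrite mulrA mulVf ?pnatr_eq0// mul1r /K; ring.
Qed.

End LineCalculus.

Section MatrixNorm.
Context {R : realType}.

Lemma mx_norm_leP m n (M : 'M[R]_(m, n)) (e : R) : 0 <= e ->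
  reflect (forall i j, `|M i j| <= e) (`|M| <= e).
Proof.
move=> e0; rewrite /Num.Def.normr /= mx_normrE; apply: (iffP idP).
  by move=> /bigmax_leP[_ Me] i j; exact: (Me (i, j)).
by move=> Me; apply/bigmax_leP; split => // -[i j] _ /=; exact: Me.
Qed.

Lemma entry_le_norm m n (M : 'M[R]_(m, n)) i j : `|M i j| <= `|M|.
Proof. by have /mx_norm_leP := lexx `|M|; apply. Qed.

Lemma mulmx_norm_le m n p (A : 'M[R]_(m, n)) (B : 'M[R]_(n, p)) :
  `|A *m B| <= n%:R * `|A| * `|B|.
Proof.
apply/mx_norm_leP => [|i j]; first by rewrite !mulr_ge0.
rewrite mxE (le_trans (ler_norm_sum _ _ _))//.
rewrite (@le_trans _ _ (\sum_(k < n) `|A| * `|B|))//.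
  by apply: ler_sum => k _; rewrite normrM ler_pM// entry_le_norm.
by rewrite sumr_const card_ord -mulrA mulr_natl.
Qed.

End MatrixNorm.

Section EpsilonDelta.
Context {R : realType} {V W : normedModType R}.

Lemma near_normP (x : V) (P : set V) :
  (\forall y \near x, P y) <->
  exists2 d : R, 0 < d & forall y, `|y - x| < d -> P y.
Proof.
split.
  move=> /nbhs_normP[d /= d0 dP]; exists d => // y yx.
  by apply: dP; rewrite /= distrC.
move=> [d d0 dP]; apply/nbhs_normP; exists d => //= y /= yx.
by apply: dP; rewrite distrC.
Qed.

Lemma continuous_epsP (f : V -> W) (x : V) : {for x, continuous f} <->
  forall e : R, 0 < e ->
    exists2 d : R, 0 < d & forall y, `|y - x| < d -> `|f y - f x| < e.
Proof.
split=> [/cvgrPdist_lt fx e e0|fx].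
  have /near_normP[d d0 dP] := fx _ e0.
  by exists d => // y /dP; rewrite distrC.
apply/cvgrPdist_lt => e /fx[d d0 dP]; apply/near_normP; exists d => // y /dP.
by rewrite distrC.
Qed.

Lemma differentiable_eps (f : V -> W) (x : V) : differentiable f x ->
  forall e : R, 0 < e ->
    exists2 d : R, 0 < d & forall h, `|h| < d ->
      `|f (x + h) - f x - 'd f x h| <= e * `|h|.
Proof.
move=> /diff_locally /eqaddoP fx e e0.
have /near_normP[d d0 dP] := fx _ e0.
exists d => // h hd; have := dP h; rewrite subr0 => /(_ hd) /=.
by rewrite -![(_ - _ : _ -> _) _]/(_ - _) -![(_ + _ : _ -> _) _]/(_ + _) /=
  opprD addrA [h + x]addrC.
Qed.

Lemma eps_is_diff (f : V -> W) (x : V) (L : {linear V -> W}) : continuous L ->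
  (forall e : R, 0 < e ->
    exists2 d : R, 0 < d & forall h, `|h| < d ->
      `|f (x + h) - f x - L h| <= e * `|h|) ->
  is_diff x f L.
Proof.
move=> Lc fx.
have fE : f \o shift x = cst (f x) + L +o_ 0 id.
  apply/eqaddoP => e e0; have [d d0 dP] := fx _ e0.
  apply/near_normP; exists d => // h; rewrite subr0 => /dP /=.
  by rewrite -![(_ - _ : _ -> _) _]/(_ - _) -![(_ + _ : _ -> _) _]/(_ + _) /=
    opprD addrA [h + x]addrC.
have dE := diff_unique Lc fE.
by apply: DiffDef => //; apply/diff_locallyP; rewrite dE.
Qed.

End EpsilonDelta.

Section MatrixLinear.
Context {R : realType} {m n : nat} {W : normedModType R}.

Lemma mx_linear_bounded (L : {linear 'M[R]_(m, n) -> W}) :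
  exists2 K : R, 0 < K & forall h, `|L h| <= K * `|h|.
Proof.
exists (1 + \sum_i \sum_j `|L (delta_mx i j)|).
  by rewrite ltr_wpDr// sumr_ge0// => i _; rewrite sumr_ge0.
move=> h; rewrite [in L h](matrix_sum_delta h) linear_sum mulrDl mul1r.
rewrite ler_wpDl// mulr_suml (le_trans (ler_norm_sum _ _ _))//.
apply: ler_sum => i _; rewrite linear_sum mulr_suml.
rewrite (le_trans (ler_norm_sum _ _ _))//; apply: ler_sum => j _.
by rewrite linearZ normrZ mulrC ler_wpM2l// entry_le_norm.
Qed.

Lemma mx_linear_continuous (L : {linear 'M[R]_(m, n) -> W}) : continuous L.
Proof.
move=> x; have [K K0 LK] := mx_linear_bounded L.
apply/continuous_epsP => e e0; exists (e / K) => [|y yx]; first exact: divr_gt0.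
by rewrite -linearB (le_lt_trans (LK _))// mulrC -ltr_pdivlMr.
Qed.

End MatrixLinear.

Section DirectionScaling.
Context {R : realType} {V : normedModType R}.

Lemma is_derive_dirZ (f : V -> R) x v (c : R) : derivable f x v ->
  is_derive x (c *: v) f (c * 'D_v f x).
Proof.
move=> fv; have fv0 : derivable f (x + 0 *: v) v by rewrite scale0r addr0.
have d0 := is_derive_line fv0.
have d1 : is_derive (0 : R) 1 (fun h : R => c * h) c.
  by apply: is_derive_eq; rewrite /GRing.scale /= mulr1.
have d2 : is_derive (c * 0) (1 : R) (fun s : R => f (x + s *: v)) ('D_v f x).
  by move: d0; rewrite scale0r addr0 mulr0.
have d3 : is_derive (0 : R) 1 (fun h => f (x + (c * h) *: v)) ('D_v f x * c).
  exact: (@is_derive1_comp _ (fun s => f (x + s *: v)) (fun h => c * h)).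
have E : (fun h : R => f (h *: (c *: v) + x)) = (fun h => f (x + (c * h) *: v)).
  by apply/funext => h; rewrite addrC scalerA mulrC.
rewrite mulrC; split; first by apply/derivable1P; rewrite E; case: d3.
case: d3 => _ <-; rewrite /derive.
suff -> : (fun h : R => h^-1 *: ((f \o shift x) (h *: (c *: v)) - f x)) =
  (fun h : R => h^-1 *: (((fun h0 => f (x + (c * h0) *: v)) \o shift 0) (h *: 1)
     - f (x + (c * 0) *: v))) by [].
apply/funext => h /=; rewrite addr0 mulr0 scale0r addr0 [h *: 1]mulr1.
by rewrite scalerA [h * c]mulrC [_ + x]addrC.
Qed.

End DirectionScaling.

Section ContinuousPartials.
Context {R : realType} {n : nat}.
Local Notation E := 'rV[R]_n.
Local Notation "''e_' j" := (delta_mx 0 j : E) (at level 8, j at level 2).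
Implicit Types (f : E -> R) (x h : E).

(** Vertices of a path from 0 to [h] parallel to the axes, along which increments are governed by
    one partial derivative at a time. *)
Definition prefix_row (h : E) (j : nat) : E :=
  \row_i (if (i < j)%N then h 0 i else 0).

Lemma prefix_row_norm h j (b : 'I_n) (c : R) : 0 <= c <= 1 -> nat_of_ord b = j ->
  `|prefix_row h j + (c * h 0 b) *: 'e_b| <= `|h|.
Proof.
move=> /andP[c0 c1] bj; apply/mx_norm_leP => [|i k]; first exact: normr_ge0.
rewrite !mxE ord1 /=.
case: ifP => [kj|_].
  rewrite (_ : (k == b) = false) ?mulr0; last first.
    by rewrite -val_eqE /= bj ltn_eqF.
  by rewrite addr0 entry_le_norm.
rewrite add0r; have [_|_] := eqVneq k b; last by rewrite mulr0 normr0.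
rewrite mulr1 normrM ger0_norm// (le_trans _ (entry_le_norm h 0 b))//.
by rewrite ler_piMl.
Qed.

Lemma prefix_row0 h : prefix_row h 0 = 0.
Proof. by apply/rowP => i; rewrite !mxE. Qed.

Lemma prefix_row_full h : prefix_row h n = h.
Proof. by apply/rowP => i; rewrite !mxE ltn_ord. Qed.

Lemma prefix_rowS h (j : 'I_n) :
  prefix_row h j.+1 = prefix_row h j + h 0 j *: 'e_j.
Proof.
apply/rowP => i; rewrite !mxE /= ltnS leq_eqVlt val_eqE.
have [->|_] /= := eqVneq i j; first by rewrite ltnn add0r mulr1.
by rewrite mulr0 addr0.
Qed.

Definition partials f x (h : E) : R := \sum_j h 0 j * 'D_('e_j) f x.

Lemma partials_is_linear f x : linear (partials f x).
Proof.
move=> a u v; rewrite /partials /GRing.scale /= mulr_sumr -big_split /=.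
by apply: eq_bigr => j _; rewrite !mxE; ring.
Qed.

HB.instance Definition _ f x := GRing.isLinear.Build R E R *%R (partials f x)
  (partials_is_linear f x).

Lemma partials_continuous f x : continuous (partials f x).
Proof.
exact: mx_linear_continuous.
Qed.

(** The increment of [f] telescopes along the vertices [prefix_row h j], and the mean value theorem
    on each edge replaces it by a partial derivative near [x]. The tolerance is divided by [n.+1] so
    that [n = 0] is covered. *)
Lemma partials_is_diff f x :
  (\forall y \near x, forall v, derivable f y v) ->
  (forall v, {for x, continuous ('D_v f)}) ->
  is_diff x f (partials f x).
Proof.
move=> /near_normP[d0 d0_gt0 fder] fcont.
apply: eps_is_diff; first exact: partials_continuous.
move=> e e0; have e'0 : 0 < e / n.+1%:R by rewrite divr_gt0.
have /choice[d dP] : forall j : 'I_n, exists d : R, 0 < d /\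
    forall y, `|y - x| < d -> `|'D_('e_j) f y - 'D_('e_j) f x| < e / n.+1%:R.
  by move=> j; have /continuous_epsP/(_ _ e'0)[d ? ?] := fcont 'e_j; exists d.
exists (\big[Num.min/d0]_j d j); first by apply/bigmin_gtP; split => // j _; case: (dP j).
move=> h /bigmin_gtP[hd0 hd].
have tele : f (x + h) - f x =
    \sum_(j < n) (f (x + prefix_row h j.+1) - f (x + prefix_row h j)).
  rewrite -[in LHS](prefix_row_full h) -[X in _ - f X]addr0 -(prefix_row0 h).
  rewrite -(telescope_sumr (fun j => f (x + prefix_row h j)))//.
  by rewrite big_mkord.
rewrite tele -sumrB (le_trans (ler_norm_sum _ _ _))//.
rewrite (@le_trans _ _ (\sum_(j < n) e / n.+1%:R * `|h|))//; last first.
  rewrite sumr_const card_ord -[leLHS]mulr_natl mulrA ler_wpM2r//.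
  by rewrite mulrCA ler_piMr ?(ltW e0)// ler_pdivrMr// mul1r ler_nat.
apply: ler_sum => j _.
have seg (c : R) : 0 <= c <= 1 ->
    `|x + prefix_row h j + c *: (h 0 j *: 'e_j) - x| <= `|h|.
  move=> c01; rewrite addrAC [x + _]addrC addrK scalerA.
  exact: prefix_row_norm.
have [c c01] : exists2 c : R, 0 <= c <= 1 &
    f (x + prefix_row h j + h 0 j *: 'e_j) - f (x + prefix_row h j) =
    'D_(h 0 j *: 'e_j) f (x + prefix_row h j + c *: (h 0 j *: 'e_j)).
  apply: mean_value_line => s s01; apply: fder.
  exact: le_lt_trans (seg _ s01) _.
set y := x + _ + c *: _.
have yx : `|y - x| <= `|h| by apply: seg.
rewrite prefix_rowS addrA => ->.
have -> : 'D_(h 0 j *: 'e_j) f y = h 0 j * 'D_('e_j) f y.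
  have [_ ->//] := is_derive_dirZ (h 0 j) (fder y (le_lt_trans yx hd0) 'e_j).
rewrite -mulrBr normrM mulrC ler_pM ?entry_le_norm// ltW//.
by apply: (dP j).2; apply: le_lt_trans yx _; apply: hd.
Qed.

End ContinuousPartials.

Section ClassC.
Context {R : realType}.
Implicit Types V W : normedModType R.

Lemma near_eq_continuous V W (f g : V -> W) x :
  (\forall y \near x, f y = g y) -> {for x, continuous f} -> {for x, continuous g}.
Proof.
move=> fg fc; have fgx := nbhs_singleton fg.
have : g @ x --> f x by apply: cvg_trans fc; apply: near_eq_cvg.
by rewrite fgx.
Qed.

Lemma class_C_ext V W k (U : set V) (f g : V -> W) : open U ->
  (forall x, U x -> f x = g x) -> class_C k U f -> class_C k U g.
Proof.
move=> oU; elim: k f g => [|k IH] f g fg /=.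
  move=> [fc _]; split=> // x Ux.
  have nfg : \forall y \near x, f y = g y.
    by apply: filterS (open_nbhs_nbhs (conj oU Ux)).
  exact: near_eq_continuous nfg (fc x Ux).
move=> [fc [fd fD]].
have nfg x : U x -> \forall y \near x, f y = g y.
  by move=> Ux; apply: filterS (open_nbhs_nbhs (conj oU Ux)).
split; [move=> x Ux|split => [x v Ux|v]].
- by exact: near_eq_continuous (nfg x Ux) (fc x Ux).
- exact: near_eq_derivable (nfg x Ux) (fd x v Ux).
- by apply: IH (fD v) => x Ux; apply: near_eq_derive; exact: nfg.
Qed.

Lemma is_derive_linear V W W' (L : {linear W -> W'}) (f : V -> W) x v :
  continuous L -> derivable f x v ->
  is_derive x v (fun y => L (f y)) (L ('D_v f x)).
Proof.
move=> Lc fv.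
have E : (fun h : R => h^-1 *: (((fun y => L (f y)) \o shift x) (h *: v) - L (f x)))
       = (fun h => L (h^-1 *: ((f \o shift x) (h *: v) - f x))).
  by apply/funext => h /=; rewrite linearZ (linearB L).
have c : (fun h => h^-1 *: (((fun y => L (f y)) \o shift x) (h *: v) - L (f x)))
    @ 0^' --> L ('D_v f x).
  by rewrite E; apply: cvg_comp; [exact: fv|exact: Lc].
by apply: DeriveDef; [apply/cvg_ex; exists (L ('D_v f x))|exact: cvg_lim].
Qed.

Lemma class_C_linear V W W' (L : {linear W -> W'}) k (U : set V) (f : V -> W) :
  open U -> continuous L -> class_C k U f -> class_C k U (fun y => L (f y)).
Proof.
move=> oU Lc; elim: k f => [|k IH] f /=.
  by move=> [fc _]; split=> // x Ux; apply: continuous_comp; [exact: fc|exact: Lc].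
move=> [fc [fd fD]]; split; [|split].
- by move=> x Ux; apply: continuous_comp; [exact: fc|exact: Lc].
- by move=> x v Ux; case: (is_derive_linear Lc (fd x v Ux)).
- move=> v; apply: class_C_ext (IH _ (fD v)) => // x Ux.
  by case: (is_derive_linear Lc (fd x v Ux)).
Qed.

Lemma class_C_continuous V W k (U : set V) (f : V -> W) x :
  class_C k U f -> U x -> {for x, continuous f}.
Proof. by case: k => [|k] /= [fc _] Ux; exact: fc. Qed.

Lemma class_C_derivable V W k (U : set V) (f : V -> W) x v :
  class_C k.+1 U f -> U x -> derivable f x v.
Proof. by move=> /= [_ [fd _]] Ux; exact: fd. Qed.

Lemma class_C_derive V W k (U : set V) (f : V -> W) v :
  class_C k.+1 U f -> class_C k U ('D_v f).
Proof. by move=> /= [_ [_ fD]]. Qed.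

Lemma class_C_le V W k (U : set V) (f : V -> W) :
  class_C k.+1 U f -> class_C k U f.
Proof.
elim: k f => [|k IH] f [fc [fd fD]]; first by split.
by split=> //; split=> // v; exact: IH.
Qed.

Lemma differentiable_coords V m n (f : V -> 'M[R]_(m, n)) x :
  (forall i j, differentiable (fun y => f y i j) x) -> differentiable f x.
Proof.
move=> fij; have -> : f = \sum_(i < m) \sum_(j < n)
    (fun y => f y i j *: (delta_mx i j : 'M[R]_(m, n))).
  apply/funext => y; rewrite [LHS]matrix_sum_delta fct_sumE.
  by apply: eq_bigr => i _; rewrite fct_sumE.
apply: differentiable_sum => i; apply: differentiable_sum => j.
exact: differentiableZl.
Qed.

Definition entry m n (i : 'I_m) (j : 'I_n) (M : 'M[R]_(m, n)) : R := M i j.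

Lemma entry_is_linear m n i j : linear (@entry m n i j).
Proof. by move=> a M N; rewrite /entry !mxE. Qed.

HB.instance Definition _ m n i j := GRing.isLinear.Build R 'M[R]_(m, n) R *%R
  (@entry m n i j) (@entry_is_linear m n i j).

Section Rows.
Context {n p q : nat}.
Local Notation E := 'rV[R]_n.
Implicit Types (U : set E).

Lemma class_C_differentiable U k (f : E -> 'M[R]_(p, q)) x : open U ->
  class_C k.+1 U f -> U x -> differentiable f x.
Proof.
move=> oU fC Ux; apply: differentiable_coords => i j.
have gC : class_C k.+1 U (fun y => entry i j (f y)).
  by apply: class_C_linear fC => //; exact: mx_linear_continuous.
suff : is_diff x (fun y => entry i j (f y)) (partials (fun y => entry i j (f y)) x).
  by case.
apply: partials_is_diff => [|v].
  apply: filterS (open_nbhs_nbhs (conj oU Ux)) => y Uy v.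
  exact: class_C_derivable gC Uy.
exact: class_C_continuous (class_C_derive v gC) Ux.
Qed.

Lemma derive_sum_coords (f : E -> 'M[R]_(p, q)) x (v : E) : differentiable f x ->
  'D_v f x = \sum_j v 0 j *: 'D_(delta_mx 0 j) f x.
Proof.
move=> fx; rewrite deriveE// [in LHS](row_sum_delta v) linear_sum.
by apply: eq_bigr => j _; rewrite linearZ deriveE.
Qed.

(** Reduces a varying direction [v] to finitely many fixed mixed partials, whose continuity then
    gives estimates uniform in [v]. *)
Lemma derive2_sum_coords U (f : E -> 'M[R]_(p, q)) x (v : E) : open U ->
  class_C 2 U f -> U x ->
  'D_v ('D_v f) x =
  \sum_i \sum_j (v 0 i * v 0 j) *: 'D_(delta_mx 0 j) ('D_(delta_mx 0 i) f) x.
Proof.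
move=> oU fC Ux.
have dD w y : U y -> differentiable ('D_w f) y.
  by move=> Uy; exact: class_C_differentiable (class_C_derive w fC) Uy.
pose g : E -> 'M[R]_(p, q) := \sum_(j < n) (v 0 j \*: 'D_(delta_mx 0 j) f).
have -> : 'D_v ('D_v f) x = 'D_v g x.
  apply: near_eq_derive; apply: filterS (open_nbhs_nbhs (conj oU Ux)) => y Uy.
  rewrite derive_sum_coords; last exact: class_C_differentiable fC Uy.
  by rewrite /g fct_sumE.
rewrite derive_sum => [|j]; last first.
  by apply: derivableZ; apply: diff_derivable; exact: dD.
apply: eq_bigr => i _; rewrite deriveZ; last by apply: diff_derivable; exact: dD.
rewrite derive_sum_coords; last exact: dD.
by rewrite scaler_sumr; apply: eq_bigr => j _; rewrite scalerA.
Qed.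

End Rows.

End ClassC.

Section SecondOrder.
Context {R : realType} {n p q : nat}.
Local Notation E := 'rV[R]_n.
Local Notation "''e_' j" := (delta_mx 0 j : E) (at level 8, j at level 2).
Implicit Types (U : set E) (f : E -> 'M[R]_(p, q)).

Lemma finite_delta (I : finType) (P : I -> R -> Prop) :
  (forall i (d d' : R), 0 < d' -> d' <= d -> P i d -> P i d') ->
  (forall i, exists2 d : R, 0 < d & P i d) ->
  exists2 d : R, 0 < d & forall i, P i d.
Proof.
move=> Pmono Pex.
have /choice[d dP] : forall i, exists d : R, 0 < d /\ P i d.
  by move=> i; have [d ? ?] := Pex i; exists d.
have m0 : 0 < \big[Num.min/1]_i d i.
  by apply/bigmin_gtP; split => // i _; case: (dP i).
exists (\big[Num.min/1]_i d i) => // i.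
by apply: Pmono (dP i).2 => //; exact: bigmin_le.
Qed.

Lemma open_delta U x : open U -> U x ->
  exists2 d : R, 0 < d & forall y, `|y - x| < d -> U y.
Proof. by move=> oU Ux; apply/near_normP; apply: open_nbhs_nbhs. Qed.

Lemma derive_near U f x (e : R) : open U -> class_C 1 U f -> U x -> 0 < e ->
  exists2 d : R, 0 < d & forall y, `|y - x| < d ->
    forall t : E, `|'D_t f y - 'D_t f x| <= e * `|t|.
Proof.
move=> oU fC Ux e0; have [d0 d00 d0U] := open_delta oU Ux.
have e'0 : 0 < e / n.+1%:R by rewrite divr_gt0.
have [d1 d10 d1P] := @finite_delta 'I_n (fun j d => forall y, `|y - x| < d ->
   `|'D_('e_j) f y - 'D_('e_j) f x| < e / n.+1%:R)
   (fun j d d' _ dd' P y yx => P y (lt_le_trans yx dd'))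
   (fun j => (continuous_epsP _ _).1
      (class_C_continuous (class_C_derive 'e_j fC) Ux) _ e'0).
exists (Num.min d0 d1) => [|y]; rewrite lt_min ?d00// => /andP[yd0 yd1] t.
have fx := class_C_differentiable oU fC Ux.
have fy := class_C_differentiable oU fC (d0U _ yd0).
rewrite (derive_sum_coords _ fx) (derive_sum_coords _ fy).
rewrite -sumrB (le_trans (ler_norm_sum _ _ _))//.
rewrite (@le_trans _ _ (\sum_(j < n) e / n.+1%:R * `|t|))//; last first.
  rewrite sumr_const card_ord -[leLHS]mulr_natl mulrA ler_wpM2r//.
  by rewrite mulrCA ler_piMr ?(ltW e0)// ler_pdivrMr// mul1r ler_nat.
apply: ler_sum => j _; rewrite -scalerBr normrZ mulrC.
by rewrite ler_pM ?entry_le_norm// ltW// d1P.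
Qed.

Lemma derive2_near U f x (e : R) : open U -> class_C 2 U f -> U x -> 0 < e ->
  exists2 d : R, 0 < d & forall y, `|y - x| < d ->
    forall t : E, `|'D_t ('D_t f) y - 'D_t ('D_t f) x| <= e * `|t| ^+ 2.
Proof.
move=> oU fC Ux e0; have [d0 d00 d0U] := open_delta oU Ux.
have e'0 : 0 < e / n.+1%:R ^+ 2 by rewrite divr_gt0// exprn_gt0.
have [d1 d10 d1P] := @finite_delta ('I_n * 'I_n)%type
   (fun j d => forall y, `|y - x| < d ->
   `|'D_('e_(j.2)) ('D_('e_(j.1)) f) y - 'D_('e_(j.2)) ('D_('e_(j.1)) f) x| < e / n.+1%:R ^+ 2)
   (fun j d d' _ dd' P y yx => P y (lt_le_trans yx dd'))
   (fun j => (continuous_epsP _ _).1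
      (class_C_continuous (class_C_derive 'e_(j.2) (class_C_derive 'e_(j.1) fC)) Ux) _ e'0).
exists (Num.min d0 d1) => [|y]; rewrite lt_min ?d00// => /andP[yd0 yd1] t.
rewrite !(derive2_sum_coords _ oU fC)//; last exact: d0U.
rewrite -sumrB (le_trans (ler_norm_sum _ _ _))//.
rewrite (@le_trans _ _ (\sum_(i < n) \sum_(j < n) e / n.+1%:R ^+ 2 * `|t| ^+ 2))//; last first.
  rewrite !sumr_const card_ord -mulrnA -[leLHS]mulr_natl mulrA ler_wpM2r ?exprn_ge0//.
  rewrite mulrCA ler_piMr ?(ltW e0)// ler_pdivrMr ?exprn_gt0// mul1r.
  by rewrite -natrX ler_nat -mulnn leq_mul.
apply: ler_sum => i _; rewrite -sumrB (le_trans (ler_norm_sum _ _ _))//.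
apply: ler_sum => j _; rewrite -scalerBr normrZ mulrC normrM expr2.
rewrite ler_pM ?mulr_ge0//; first by rewrite ltW// (d1P (i, j)).
by rewrite ler_pM// entry_le_norm.
Qed.

Lemma derive_bounded U f x : open U -> class_C 1 U f -> U x ->
  exists2 K : R, 0 < K & forall t : E, `|'D_t f x| <= K * `|t|.
Proof.
move=> oU fC Ux; have fd := class_C_differentiable oU fC Ux.
have [K K0 KP] := mx_linear_bounded ('d f x).
by exists K => // t; rewrite deriveE.
Qed.

Lemma derive2_bounded U f x : open U -> class_C 2 U f -> U x ->
  exists2 K : R, 0 < K & forall t : E, `|'D_t ('D_t f) x| <= K * `|t| ^+ 2.
Proof.
move=> oU fC Ux.
exists (1 + \sum_i \sum_j `|'D_('e_j) ('D_('e_i) f) x|).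
  by rewrite ltr_wpDr// sumr_ge0// => i _; rewrite sumr_ge0.
move=> t; rewrite (derive2_sum_coords _ oU fC)// mulrDl mul1r.
rewrite ler_wpDl ?exprn_ge0// mulr_suml (le_trans (ler_norm_sum _ _ _))//.
apply: ler_sum => i _; rewrite mulr_suml (le_trans (ler_norm_sum _ _ _))//.
apply: ler_sum => j _; rewrite normrZ mulrC ler_wpM2l// normrM expr2.
by rewrite ler_pM ?entry_le_norm.
Qed.

Lemma class_C_entry k U f i j : open U -> class_C k U f ->
  class_C k U (fun y => f y i j : R).
Proof.
move=> oU; have := @class_C_linear R _ _ _ (entry i j) k U f oU
  (@mx_linear_continuous _ _ _ _ (entry i j)).
exact.
Qed.

Lemma derive_entry f y t i j : derivable f y t ->
  'D_t (fun z => f z i j : R) y = 'D_t f y i j.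
Proof. by move=> ft; rewrite [in RHS]derive_mx// mxE. Qed.

Lemma segment_norm (x t : E) (c : R) : 0 <= c <= 1 -> `|x + c *: t - x| <= `|t|.
Proof.
by move=> /andP[c0 c1]; rewrite addrAC subrr add0r normrZ ger0_norm// ler_piMl.
Qed.

Lemma taylor_remainderE (a b u v : R) :
  a + b + 2^-1 * u - a - b - 2^-1 * v = 2^-1 * (u - v).
Proof. ring. Qed.

(** Proved entry by entry, because the intermediate point of Lagrange's formula depends on the
    entry; continuity of the second derivatives then brings it back to [x]. *)
Lemma taylor2 U f x (e : R) : open U -> class_C 2 U f -> U x -> 0 < e ->
  exists2 d : R, 0 < d & forall t, `|t| < d ->
    `|f (x + t) - f x - 'D_t f x - 2^-1 *: 'D_t ('D_t f) x| <= e * `|t| ^+ 2.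
Proof.
move=> oU fC Ux e0; have [d0 d00 d0U] := open_delta oU Ux.
have [d1 d10 d1P] := derive2_near oU fC Ux e0.
exists (Num.min d0 d1) => [|t]; rewrite lt_min ?d00// => /andP[td0 td1].
have segU (s : R) : 0 <= s <= 1 -> U (x + s *: t).
  by move=> s01; apply: d0U; exact: le_lt_trans (segment_norm _ _ s01) _.
apply/mx_norm_leP => [|i j]; first by rewrite mulr_ge0 ?exprn_ge0// ltW.
pose g : E -> R := fun y => f y i j.
have gC : class_C 2 U g by exact: class_C_entry.
have D1 y : U y -> 'D_t g y = 'D_t f y i j.
  by move=> Uy; apply: derive_entry; exact: class_C_derivable fC Uy.
have D2 y : U y -> 'D_t ('D_t g) y = 'D_t ('D_t f) y i j.
  move=> Uy; rewrite (@near_eq_derive _ _ _ _ (fun y => 'D_t f y i j : R)).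
    by apply: derive_entry; exact: class_C_derivable (class_C_derive t fC) Uy.
  by apply: filterS (open_nbhs_nbhs (conj oU Uy)) => z Uz; exact: D1.
have [s /segU Us|s /segU Us|c c01] := @taylor2_line _ _ g x t.
- exact: class_C_derivable gC Us.
- exact: class_C_derivable (class_C_derive t gC) Us.
rewrite D1// D2; last exact: segU.
rewrite !mxE /g => ->.
rewrite taylor_remainderE.
have half_le1 : 2^-1 <= 1 :> R by lra.
rewrite normrM ger0_norm ?invr_ge0//; apply: le_trans (ler_piMl _ half_le1) _ => //.
have := entry_le_norm ('D_t ('D_t f) (x + c *: t) - 'D_t ('D_t f) x) i j.
rewrite !mxE => /le_trans; apply; apply: d1P.
exact: le_lt_trans (segment_norm _ _ c01) td1.
Qed.

End SecondOrder.

(** * Cones over submanifolds *)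

Section Conormal.
Context {R : realType} {n : nat}.
Implicit Types (C : set 'cV[R]_n) (l : 'rV[R]_n) (v w : 'cV[R]_n).

Definition pair l w : R := (l *m w) 0 0.

Lemma pairD l v w : pair l (v + w) = pair l v + pair l w.
Proof. by rewrite /pair mulmxDr mxE. Qed.

Lemma pairZ l a w : pair l (a *: w) = a * pair l w.
Proof. by rewrite /pair -scalemxAr mxE. Qed.

Lemma pairB l v w : pair l (v - w) = pair l v - pair l w.
Proof. by rewrite -scaleN1r pairD pairZ mulN1r. Qed.

Lemma pairDl l l' w : pair (l + l') w = pair l w + pair l' w.
Proof. by rewrite /pair mulmxDl mxE. Qed.

Lemma pairZl l a w : pair (a *: l) w = a * pair l w.
Proof. by rewrite /pair -scalemxAl mxE. Qed.

Lemma pair0 l : pair l 0 = 0.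
Proof. by rewrite /pair mulmx0 mxE. Qed.

Lemma pair_is_linear l : linear (pair l).
Proof. by move=> a u w; rewrite pairD pairZ. Qed.

HB.instance Definition _ l := GRing.isLinear.Build R 'cV[R]_n R *%R
  (pair l) (pair_is_linear l).

Lemma pair_bounded l : exists2 K : R, 0 < K & forall w, `|pair l w| <= K * `|w|.
Proof.
exists (1 + n%:R * `|l|) => [|w]; first by rewrite ltr_wpDr ?mulr_ge0.
rewrite (le_trans (entry_le_norm _ _ _))// (le_trans (mulmx_norm_le _ _))//.
by rewrite ler_wpM2r// lerDr.
Qed.

(* l vanishes to order greater than m at v along C. *)
Definition conormal m C v l : Prop := forall e : R, 0 < e ->
  exists2 d : R, 0 < d &
    forall w, C w -> `|w - v| < d -> `|pair l w| <= e * `|w - v| ^+ m.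

Definition flat_at C v : Prop :=
  forall l, conormal 1 C v l -> conormal 2 C v l.

Lemma norm_small0 (a K : R) : (forall e, 0 < e -> `|a| <= e * K) -> a = 0.
Proof.
move=> aK; apply/eqP/contraT => a0.
have K0 : 0 < K.
  by rewrite -[K]mul1r (lt_le_trans _ (aK 1 ltr01))// normr_gt0.
have := aK (`|a| / (2 * K)); rewrite !divr_gt0 ?mulr_gt0 ?normr_gt0// => /(_ isT).
rewrite invfM mulrA divfK ?gt_eqF// leNgt ltr_pdivrMr// mulr_natr mulr2n.
by rewrite ltrDl normr_gt0 a0.
Qed.

Lemma small_scalar (d M : R) : 0 < d -> exists2 s : R, 0 < s & s * M < d.
Proof.
move=> d0; have M0 : 0 < `|M| + 1 by rewrite ltr_pwDr.
exists (d / (`|M| + 1)); first by rewrite divr_gt0.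
rewrite mulrAC ltr_pdivrMr// ltr_pM2l// (le_lt_trans (ler_norm _))//.
by rewrite ltrDl.
Qed.

End Conormal.

Section ChartEmbedding.
Context {R : realType} {n : nat} (i : 'I_n.+1).
Implicit Types (u : 'rV[R]_n) (w : 'cV[R]_n.+1).

Definition chart_lin u : 'cV[R]_n.+1 :=
  \col_r (if unlift i r is Some j then u 0 j else 0).

Lemma chart_lin_is_linear : linear chart_lin.
Proof.
move=> a u v; apply/colP => r; rewrite !mxE.
by case: unliftP => [j _|_]; rewrite ?mxE// mulr0 addr0.
Qed.

HB.instance Definition _ := GRing.isLinear.Build R 'rV[R]_n 'cV[R]_n.+1 *:%R
  chart_lin chart_lin_is_linear.

Lemma chart_lin_lift u j : chart_lin u (lift i j) 0 = u 0 j.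
Proof. by rewrite mxE liftK. Qed.

Lemma chart_lin_i u : chart_lin u i 0 = 0.
Proof. by rewrite mxE unlift_none. Qed.

Lemma chart_lin_norm u : `|chart_lin u| <= `|u|.
Proof.
apply/mx_norm_leP => // r q; rewrite mxE.
by case: unliftP => [j _|_]; rewrite ?normr0// entry_le_norm.
Qed.

Definition chart_inv u : 'cV[R]_n.+1 := delta_mx i 0 + chart_lin u.

Definition chart_coord w : 'rV[R]_n := \row_j (w (lift i j) 0 / w i 0).

Lemma chart_inv_i u : chart_inv u i 0 = 1.
Proof. by rewrite mxE chart_lin_i addr0 mxE !eqxx. Qed.

Lemma chart_inv_lift u j : chart_inv u (lift i j) 0 = u 0 j.
Proof.
by rewrite mxE chart_lin_lift mxE -(inj_eq val_inj) /= eq_sym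
  (negPf (neq_bump _ _)) add0r.
Qed.

Lemma chart_invK c u : c != 0 -> chart_coord (c *: chart_inv u) = u.
Proof.
move=> c0; apply/rowP => j.
have E r : (c *: chart_inv u) r 0 = c * chart_inv u r 0 by rewrite mxE.
by rewrite mxE !E chart_inv_i chart_inv_lift mulr1 mulrAC mulfV ?mul1r.
Qed.

Lemma chart_coordK w : w i 0 != 0 -> w = w i 0 *: chart_inv (chart_coord w).
Proof.
move=> wi0; apply/colP => r; rewrite mxE.
case: (unliftP i r) => [j ->|->]; last by rewrite chart_inv_i mulr1.
by rewrite chart_inv_lift mxE mulrCA mulfV ?mulr1.
Qed.

Lemma chart_inv_sub u v : chart_inv u - chart_inv v = chart_lin (u - v).
Proof. by rewrite /chart_inv linearB opprD addrACA subrr add0r. Qed.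

Lemma chart_coord_differentiable w : w i 0 != 0 -> differentiable chart_coord w.
Proof.
move=> wi0; apply: differentiable_coords => a j.
have -> : (fun y => chart_coord y a j) =
    (fun y : 'cV[R]_n.+1 => y (lift i j) 0 : R) * (fun y => (y i 0 : R)^-1).
  by apply/funext => y; rewrite mxE.
apply: differentiableM; first exact: differentiable_coord.
by apply: differentiableV => //; exact: differentiable_coord.
Qed.

End ChartEmbedding.

Section ScaledBounds.
Context {R : realFieldType}.

(** Bookkeeping for little-o estimates under a change of parameter: [X] and [T] are powers of the
    two distances, compared by [K], and [c] accounts for the scalar in front of [param]. *)
Lemma scaled_bound_div (e c K X T p : R) : 0 < e -> 0 < c -> 0 < K ->
  X <= K * T -> c * p <= e * c / K * X -> p <= e * T.
Proof.
move=> e0 c0 K0 XT pX; rewrite -(ler_pM2l c0) (le_trans pX)//.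
have -> : c * (e * T) = e * c / K * (K * T).
  by field; rewrite gt_eqF.
by rewrite ler_wpM2l// ltW// divr_gt0// mulr_gt0.
Qed.

Lemma scaled_bound_mul (e c K X T p a : R) : 0 < e -> 0 < c -> 0 < K ->
  X <= K * T -> 0 <= p -> 0 <= a -> a <= c -> p <= e / c / K * X ->
  a * p <= e * T.
Proof.
move=> e0 c0 K0 XT p0 a0 ac pX; rewrite (le_trans (ler_pM a0 p0 ac pX))//.
have -> : e * T = c * (e / c / K * (K * T)).
  by field; rewrite !gt_eqF.
by rewrite !ler_wpM2l// ltW// !divr_gt0.
Qed.

End ScaledBounds.

Section FlattenedCone.
Context {R : realType} {n k : nat} (i : 'I_n.+1) (C : set 'cV[R]_n.+1).
Local Notation E := 'rV[R]_n.
Context (U V : set E) (phi psi : E -> E).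

Definition flat_row (y : E) : Prop := forall j : 'I_n, (k <= j)%N -> y 0 j = 0.

(* The cone C is, near the points of the chart U, the cone over a
   k-dimensional submanifold flattened by phi, with inverse psi. *)
Record flattened_cone : Prop := FlattenedCone {
  fc_openU : open U;
  fc_openV : open V;
  fc_phiU : forall x, U x -> V (phi x);
  fc_psiV : forall y, V y -> U (psi y);
  fc_psiK : forall y, V y -> phi (psi y) = y;
  fc_phiK : forall x, U x -> psi (phi x) = x;
  fc_phiC : class_C 2 U phi;
  fc_psiC : class_C 2 V psi;
  fc_cone : forall y c, V y -> flat_row y -> c != 0 -> C (c *: chart_inv i (psi y));
  fc_flat : forall w, C w -> w i 0 != 0 -> U (chart_coord i w) ->
    flat_row (phi (chart_coord i w)) }.

Context (fc : flattened_cone).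
Let oU := fc_openU fc.
Let oV := fc_openV fc.
Let phiC := fc_phiC fc.
Let psiC := fc_psiC fc.

Lemma flat_rowD y z : flat_row y -> flat_row z -> flat_row (y + z).
Proof. by move=> fy fz j kj; rewrite mxE fy// fz// addr0. Qed.

Lemma flat_rowZ a y : flat_row y -> flat_row (a *: y).
Proof. by move=> fy j kj; rewrite mxE fy// mulr0. Qed.

Lemma flat_rowB y z : flat_row y -> flat_row z -> flat_row (y - z).
Proof. by move=> fy fz; rewrite -scaleN1r; apply/flat_rowD/flat_rowZ. Qed.

Lemma flat_row_sum y : flat_row y ->
  y = \sum_(j < n | (j < k)%N) y 0 j *: delta_mx 0 j.
Proof.
move=> fy; rewrite [LHS]row_sum_delta (bigID (fun j : 'I_n => (j < k)%N))/=.
rewrite [X in _ + X]big1 ?addr0// => j; rewrite -leqNgt => /fy ->.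
by rewrite scale0r.
Qed.

Lemma flat_row_delta (j : 'I_n) : (j < k)%N -> flat_row (delta_mx 0 j).
Proof.
move=> jk m km; rewrite mxE; case: eqVneq => //= _.
by case: eqVneq => //= mj; move: jk; rewrite -mj ltnNge km.
Qed.

Definition param (y : E) : 'cV[R]_n.+1 := chart_inv i (psi y).

Definition straighten (w : 'cV[R]_n.+1) : E := phi (chart_coord i w).

Section AtPoint.
Context (y0 : E) (c0 : R).
Context (Vy0 : V y0) (Fy0 : flat_row y0) (c00 : c0 != 0).
Local Notation v := (c0 *: param y0).

Lemma param_i (c : R) y : (c *: param y) i 0 = c.
Proof. by rewrite mxE chart_inv_i mulr1. Qed.

Lemma straighten_param c y : V y -> c != 0 -> straighten (c *: param y) = y.
Proof. by move=> Vy c0'; rewrite /straighten chart_invK// (fc_psiK fc). Qed.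

Lemma straighten_differentiable : differentiable straighten v.
Proof.
apply: (@differentiable_comp _ _ _ _ (chart_coord i) phi).
  by apply: chart_coord_differentiable; rewrite param_i.
rewrite chart_invK//; apply: class_C_differentiable phiC _ => //.
exact: (fc_psiV fc).
Qed.

Lemma near_param (e : R) : 0 < e -> exists2 d : R, 0 < d &
  forall w, C w -> `|w - v| < d ->
    [/\ V (straighten w), flat_row (straighten w), `|straighten w - y0| < e,
        w i 0 != 0 & w = w i 0 *: param (straighten w)].
Proof.
move=> e0.
have vi : v i 0 != 0 by rewrite param_i.
have [d1 d10 d1P] : exists2 d : R, 0 < d &
    forall w, `|w - v| < d -> U (chart_coord i w).
  apply/near_normP.
  have cc := differentiable_continuous (chart_coord_differentiable vi).
  apply: cc; apply: open_nbhs_nbhs; split=> //.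
  by rewrite chart_invK//; exact: (fc_psiV fc).
have [d2 d20 d2P] := (continuous_epsP _ _).1
  (differentiable_continuous straighten_differentiable) _ e0.
have c0n : 0 < `|c0| by rewrite normr_gt0.
(* Since [v i 0 = c0], a point closer to [v] than [|c0|] keeps a nonzero coordinate of index [i]. *)
exists (Num.min `|c0| (Num.min d1 d2)); first by rewrite !lt_min c0n d10.
move=> w Cw; rewrite !lt_min => /and3P[wc wd1 wd2].
have wi : w i 0 != 0.
  apply: contraTneq wc => wi; rewrite -leNgt.
  have := entry_le_norm (w - v) i 0.
  by rewrite mxE [X in _ + X]mxE wi add0r normrN param_i.
have Uw := d1P _ wd1.
split=> //.
- exact: (fc_phiU fc).
- exact: (fc_flat fc).
- by have := d2P _ wd2; rewrite straighten_param.
- by rewrite /param /straighten (fc_phiK fc)// -chart_coordK.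
Qed.

Lemma straighten_lipschitz : exists2 K : R, 0 < K & exists2 d : R, 0 < d &
  forall w, `|w - v| < d -> `|straighten w - y0| <= K * `|w - v|.
Proof.
have [K K0 KP] := mx_linear_bounded ('d straighten v).
have [d d0 dP] := differentiable_eps straighten_differentiable ltr01.
exists (K + 1); first by rewrite addr_gt0.
exists d => // w /dP; rewrite (addrC v) subrK straighten_param// mul1r => wP.
rewrite -(subrK ('d straighten v (w - v)) (straighten w - y0)).
by rewrite (le_trans (ler_normD _ _))// mulrDl mul1r addrC lerD.
Qed.

Lemma param_lipschitz : exists2 K : R, 0 < K & exists2 d : R, 0 < d &
  forall t, `|t| < d -> `|c0 *: param (y0 + t) - v| <= K * `|t|.
Proof.
have pd := class_C_differentiable oV psiC Vy0.
have [K K0 KP] := mx_linear_bounded ('d psi y0).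
have [d d0 dP] := differentiable_eps pd ltr01.
exists (`|c0| * (K + 1)); first by rewrite mulr_gt0 ?normr_gt0// addr_gt0.
exists d => // t /dP; rewrite mul1r => tP.
rewrite -scalerBr chart_inv_sub normrZ -mulrA ler_wpM2l//.
rewrite (le_trans (chart_lin_norm _ _))// -(subrK ('d psi y0 t) (_ - psi y0)).
by rewrite (le_trans (ler_normD _ _))// mulrDl mul1r addrC lerD.
Qed.

(** [param] and [straighten] are both Lipschitz at the point, so orders of vanishing along the cone
    and along flat rows agree; near [v] the scalar [w i 0] is at most [2 * |c0|] in absolute
    value. *)
Lemma conormal_paramP m l : conormal m C v l <->
  forall e : R, 0 < e -> exists2 d : R, 0 < d &
    forall t, flat_row t -> `|t| < d -> `|pair l (param (y0 + t))| <= e * `|t| ^+ m.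
Proof.
have c0n : 0 < `|c0| by rewrite normr_gt0.
split=> lP e e0.
  have [K K0 [d1 d10 d1P]] := param_lipschitz.
  have Km : 0 < K ^+ m by rewrite exprn_gt0.
  have [d2 d20 d2P] : exists2 d : R, 0 < d & forall y, `|y - y0| < d -> V y.
    exact: open_delta.
  have [d3 d30 d3P] := lP (e * `|c0| / K ^+ m) (divr_gt0 (mulr_gt0 e0 c0n) Km).
  exists (Num.min d1 (Num.min d2 (d3 / K))) => [|t Ft].
    by rewrite !lt_min d10 d20 divr_gt0.
  rewrite !lt_min => /and3P[td1 td2]; rewrite ltr_pdivlMr// mulrC => td3.
  have tK := d1P _ td1.
  have Vt : V (y0 + t) by apply: d2P; rewrite addrAC subrr add0r.
  have := d3P _ (fc_cone fc Vt (flat_rowD Fy0 Ft) c00) (le_lt_trans tK td3).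
  rewrite pairZ normrM; apply: scaled_bound_div => //.
  by rewrite -exprMn lerXn2r ?nnegrE ?mulr_ge0 ?(ltW K0).
have [K K0 [d1 d10 d1P]] := straighten_lipschitz.
have Km : 0 < K ^+ m by rewrite exprn_gt0.
have c2 : 0 < 2 * `|c0| by rewrite mulr_gt0.
have [d2 d20 d2P] := lP (e / (2 * `|c0|) / K ^+ m) (divr_gt0 (divr_gt0 e0 c2) Km).
have [d3 d30 d3P] := near_param d20.
exists (Num.min `|c0| (Num.min d1 d3)); first by rewrite !lt_min c0n d10.
move=> w Cw; rewrite !lt_min => /and3P[wc wd1 wd3].
have [Vw Fw yd wi wE] := d3P _ Cw wd3.
have := d2P _ (flat_rowB Fw Fy0) yd; rewrite (addrC y0) subrK => lw.
have wic : `|w i 0| <= 2 * `|c0|.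
  have := entry_le_norm (w - v) i 0; rewrite mxE [X in _ + X]mxE param_i => wi0.
  rewrite -(subrK c0 (w i 0)) (le_trans (ler_normD _ _))// mulr_natl mulr2n.
  by rewrite lerD2r (le_trans wi0)// ltW.
rewrite [in X in X <= _]wE pairZ normrM.
apply: scaled_bound_mul (lw) => //.
by rewrite -exprMn lerXn2r ?nnegrE ?mulr_ge0 ?(ltW K0)// d1P.
Qed.

End AtPoint.
End FlattenedCone.

Section SecondOrderCone.
Context {R : realType} {n k : nat} (i : 'I_n.+1) (C : set 'cV[R]_n.+1).
Local Notation E := 'rV[R]_n.
Context (U V : set E) (phi psi : E -> E).
Context (fc : flattened_cone (k := k) i C U V phi psi).
Let oU := fc_openU fc.
Let oV := fc_openV fc.
Let phiC := fc_phiC fc.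
Let psiC := fc_psiC fc.
Local Notation flat_row := (flat_row (k := k)).
Local Notation param := (param i psi).
Local Notation "''e_' j" := (delta_mx 0 j : E) (at level 8, j at level 2).

(** Taylor coefficients of [t |-> pair l (param (y + t))], the second one without its factor
    [2^-1]. *)
Definition jet1 l t y : R := pair l (chart_lin i ('D_t psi y)).
Definition jet2 l t y : R := pair l (chart_lin i ('D_t ('D_t psi) y)).

Lemma jet1Z l a t y : V y -> jet1 l (a *: t) y = a * jet1 l t y.
Proof.
move=> Vy; have pd := class_C_differentiable oV psiC Vy.
by rewrite /jet1 !deriveE// linearZ linearZ pairZ.
Qed.

Lemma derive2Z a t y : V y ->
  'D_(a *: t) ('D_(a *: t) psi) y = a ^+ 2 *: 'D_t ('D_t psi) y.
Proof.
move=> Vy; rewrite !(derive2_sum_coords _ oV psiC)// scaler_sumr.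
apply: eq_bigr => j _; rewrite scaler_sumr; apply: eq_bigr => m _.
by rewrite scalerA !mxE mulrACA expr2.
Qed.

Lemma jet2Z l a t y : V y -> jet2 l (a *: t) y = a ^+ 2 * jet2 l t y.
Proof. by move=> Vy; rewrite /jet2 derive2Z// linearZ pairZ. Qed.

Lemma pair_taylor l y (e : R) : V y -> 0 < e -> exists2 d : R, 0 < d &
  forall t, `|t| < d -> `|pair l (param (y + t)) -
    (pair l (param y) + jet1 l t y + 2^-1 * jet2 l t y)| <= e * `|t| ^+ 2.
Proof.
move=> Vy e0; have [K K0 KP] := pair_bounded l.
have [d d0 dP] := taylor2 oV psiC Vy (divr_gt0 e0 K0).
exists d => // t /dP tP.
rewrite /jet1 /jet2 /param -addrA opprD addrA -pairB -pairZ -pairD -pairB.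
rewrite -linearZ chart_inv_sub.
rewrite -linearD -linearB (le_trans (KP _))// -ler_pdivlMl// mulrA [K^-1 * e]mulrC.
by rewrite (le_trans (chart_lin_norm _ _))// opprD addrA.
Qed.

Section AtPoint.
Context (y0 : E) (c0 : R).
Context (Vy0 : V y0) (Fy0 : flat_row y0) (c00 : c0 != 0).
Local Notation v := (c0 *: param y0).

Lemma conormal1P l : conormal 1 C v l <->
  pair l (param y0) = 0 /\ forall t, flat_row t -> jet1 l t y0 = 0.
Proof.
rewrite (conormal_paramP fc Vy0 Fy0 c00); split.
  move=> lP; have l0 : pair l (param y0) = 0.
    apply: (@norm_small0 R _ 0) => e e0; have [d d0 dP] := lP e e0.
    have := dP 0; rewrite addr0 normr0 expr1 mulr0; apply => // j _.
    by rewrite mxE.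
  split=> // t Ft; apply: (@norm_small0 R _ (`|t| + 1)) => e e0.
  have [d1 d10 d1P] := lP e e0.
  have [d2 d20 d2P] := pair_taylor l Vy0 e0.
  have m0 : 0 < Num.min d1 (Num.min d2 e) by rewrite !lt_min d10 d20.
  (* At [s *: t] the second order terms are then at most [s * e], so that dividing by [s] isolates
     [jet1]. *)
  have [s s0 sP] := small_scalar (`|t| + 2^-1 * `|jet2 l t y0| + e * `|t| ^+ 2) m0.
  move: sP; rewrite !mulrDr !lt_min => /and3P[sd1 sd2 sde].
  have q0 : 0 <= s * (2^-1 * `|jet2 l t y0|).
    by rewrite !mulr_ge0 ?invr_ge0// ltW.
  have r0 : 0 <= s * (e * `|t| ^+ 2) by rewrite !mulr_ge0 ?exprn_ge0// ltW.
  have st : `|s *: t| = s * `|t| by rewrite normrZ gtr0_norm.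
  have t0 : 0 <= s * `|t| by rewrite mulr_ge0// ltW.
  have := d1P (s *: t) (flat_rowZ s Ft); rewrite st expr1 => /(_ _)h1.
  have {}h1 : `|pair l (param (y0 + s *: t))| <= e * (s * `|t|) by apply: h1; lra.
  have := d2P (s *: t); rewrite st l0 add0r jet1Z// jet2Z// => /(_ _)h2.
  have {h2} : `|pair l (param (y0 + s *: t)) - (s * jet1 l t y0 + 2^-1 * (s ^+ 2 * jet2 l t y0))|
    <= e * (s * `|t|) ^+ 2 by apply: h2; lra.
  move: h1 q0 r0 sde.
  move: (pair l _) (jet1 _ _ _) (jet2 _ _ _) => h a b h1 q0 r0 sde h2.
  rewrite -(ler_pM2l s0).
  have -> : s * `|a| = `|s * a| by rewrite normrM gtr0_norm.
  have -> : s * a = h - (h - (s * a + 2^-1 * (s ^+ 2 * b))) - 2^-1 * (s ^+ 2 * b) by ring.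
  have nb : `|2^-1 * (s ^+ 2 * b)| = s * (s * (2^-1 * `|b|)).
    by rewrite !normrM [`|2^-1|]ger0_norm ?invr_ge0// (gtr0_norm s0); ring.
  rewrite (le_trans (ler_normB _ _))// nb (le_trans (lerD (ler_normB _ _) (lexx _)))//.
  rewrite (le_trans (lerD (lerD h1 h2) (lexx _)))//.
  have -> : e * (s * `|t|) + e * (s * `|t|) ^+ 2 + s * (s * (2^-1 * `|b|)) =
    s * (e * `|t| + (s * (e * `|t| ^+ 2) + s * (2^-1 * `|b|))) by ring.
  rewrite ler_pM2l// mulr1 lerD2l.
  move: t0 q0 r0 sde; lra.
move=> [l0 l1] e e0.
have [d d0 dP] := pair_taylor l Vy0 (e := 1) ltr01.
have [K K0 KP] := pair_bounded l.
have [K2 K20 K2P] := derive2_bounded oV psiC Vy0.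
have M0 : 0 < 1 + K * K2 by rewrite addr_gt0// mulr_gt0.
exists (Num.min d (e / (1 + K * K2))) => [|t Ft].
  by rewrite lt_min d0 divr_gt0.
rewrite lt_min => /andP[/dP]; rewrite l0 l1// !add0r mul1r => tP te.
have Q : `|2^-1 * jet2 l t y0| <= K * K2 * `|t| ^+ 2.
  have half_le1 : 2^-1 <= 1 :> R by lra.
  rewrite normrM ger0_norm ?invr_ge0//; apply: le_trans (ler_piMl _ half_le1) _ => //.
  rewrite -mulrA (le_trans (KP _))// ler_wpM2l ?(ltW K0)//.
  by rewrite (le_trans (chart_lin_norm _ _)).
rewrite expr1 -(subrK (2^-1 * jet2 l t y0) (pair l _)).
rewrite (le_trans (ler_normD _ _))// (le_trans (lerD tP Q))//.
rewrite -[X in X + _]mul1r -mulrDl expr2 mulrA ler_wpM2r//.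
by rewrite mulrC ltW// -ltr_pdivlMr.
Qed.

Lemma conormal2P l : conormal 1 C v l ->
  conormal 2 C v l <-> forall t, flat_row t -> jet2 l t y0 = 0.
Proof.
move=> /conormal1P[l0 l1]; rewrite (conormal_paramP fc Vy0 Fy0 c00); split.
  move=> lP t Ft; apply: (@norm_small0 R _ (4 * `|t| ^+ 2)) => e e0.
  have [d1 d10 d1P] := lP e e0.
  have [d2 d20 d2P] := pair_taylor l Vy0 e0.
  have m0 : 0 < Num.min d1 d2 by rewrite lt_min d10.
  have [s s0 sP] := small_scalar `|t| m0.
  move: sP; rewrite lt_min => /andP[sd1 sd2].
  have st : `|s *: t| = s * `|t| by rewrite normrZ gtr0_norm.
  have := d1P (s *: t) (flat_rowZ s Ft); rewrite st => /(_ sd1).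
  have := d2P (s *: t); rewrite st l0 l1; last exact: flat_rowZ.
  rewrite !add0r jet2Z// => /(_ sd2).
  move: (pair l _) (jet2 _ _ _) => h b h2 h1.
  have s20 : 0 < s ^+ 2 by rewrite exprn_gt0.
  rewrite -(ler_pM2l s20).
  have -> : s ^+ 2 * `|b| = 2 * `|2^-1 * (s ^+ 2 * b)|.
    by rewrite !normrM [`|2^-1|]ger0_norm ?invr_ge0// (gtr0_norm s0); field.
  have -> : 2^-1 * (s ^+ 2 * b) = h - (h - 2^-1 * (s ^+ 2 * b)) by ring.
  rewrite (le_trans (ler_wpM2l _ (ler_normB _ _)))//.
  move: h1 h2; rewrite exprMn => h1 h2.
  apply: (@le_trans _ _ (2 * (e * (s ^+ 2 * `|t| ^+ 2) + e * (s ^+ 2 * `|t| ^+ 2)))).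
    by rewrite ler_wpM2l// lerD.
  by move: (s ^+ 2) (`|t| ^+ 2) => S T; lra.
move=> l2 e e0.
have [d d0 dP] := pair_taylor l Vy0 e0.
exists d => // t Ft /dP; rewrite l0 l1// l2// mulr0 !addr0 subr0.
exact.
Qed.

End AtPoint.
End SecondOrderCone.

Section LinearAlgebraLemmas.
Context {R : realType}.

Definition quad n (b : 'M[R]_n) (u : 'cV[R]_n) : R := (u^T *m b *m u) 0 0.

Lemma linear_col_row m n (L : {linear 'cV[R]_m -> 'rV[R]_n}) :
  exists M : 'M[R]_(n, m), forall u, L u = (M *m u)^T.
Proof.
exists (\matrix_(a, b) L (delta_mx b 0) 0 a) => u; apply/rowP => a.
rewrite [in LHS](matrix_sum_delta u) linear_sum summxE !mxE.
apply: eq_bigr => b _; rewrite big_ord1 linearZ !mxE mulrC.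
by [].
Qed.

(** Double orthogonality in finite dimension. Rows of index at least [k] are replaced by 0 in order
    to keep a square matrix. *)
Lemma row_span_dual n k (a : 'I_n -> 'rV[R]_n) (u : 'rV[R]_n) :
  (forall z : 'cV[R]_n, (forall m : 'I_n, (m < k)%N -> a m *m z = 0) -> u *m z = 0) ->
  exists c : 'I_n -> R, u = \sum_(m < n | (m < k)%N) c m *: a m.
Proof.
move=> au.
pose A := \matrix_(m < n) (if (m < k)%N then a m else 0).
have /submxP[D ->] : (u <= A)%MS.
  rewrite submxE; move: (cokermx A) (mulmx_coker A) => K AK.
  apply/eqP/matrixP => r j; rewrite ord1 [RHS]mxE.
  have -> : (u *m K) 0 j = (u *m col j K) 0 0 by rewrite colE mulmxA -colE [RHS]mxE.
  rewrite au ?mxE// => m mk; have : row m A *m col j K = 0.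
    by rewrite colE mulmxA -row_mul AK row0 mul0mx.
  by rewrite rowK mk.
exists (fun m => D 0 m); rewrite mulmx_sum_row [LHS](bigID (fun m : 'I_n => (m < k)%N)) /=.
rewrite [X in _ + X]big1 ?addr0 => [|m /negPf mk]; last first.
  by rewrite rowK mk scaler0.
by apply: eq_bigr => m mk; rewrite rowK mk.
Qed.

Lemma dual_family_coef n k (a : 'I_n -> 'rV[R]_n) (J : 'M[R]_n) (cf : 'I_n -> R)
    (m : 'I_n) : (m < k)%N -> (forall j, a j *m J = delta_mx 0 j) ->
  ((\sum_(j < n | (j < k)%N) cf j *: a j) *m J) 0 m = cf m.
Proof.
move=> mk aJ; rewrite mulmx_suml summxE (bigD1 m)//= -scalemxAl aJ.
rewrite !mxE !eqxx mulr1 big1 ?addr0// => j /andP[_ /negPf jm].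
by rewrite -scalemxAl aJ !mxE eq_sym jm andbF mulr0.
Qed.

Lemma continuous_sum_at (V W : normedModType R) (I : finType) (P : pred I)
    (f : I -> V -> W) x : (forall j, P j -> {for x, continuous (f j)}) ->
  {for x, continuous (fun y => \sum_(j | P j) f j y)}.
Proof.
move=> fc; have -> : (fun y => \sum_(j | P j) f j y) = \sum_(j | P j) f j.
  by apply/funext => y; rewrite fct_sumE.
apply: (big_ind (fun f : V -> W => {for x, continuous f})) => //.
  exact: cvg_cst.
by move=> f1 f2 c1 c2; exact: continuousD.
Qed.

Lemma continuous_entry_at (V : normedModType R) m n (f : V -> 'M[R]_(m, n)) x i j :
  {for x, continuous f} -> {for x, continuous (fun y => f y i j : R)}.
Proof.
move=> /continuous_epsP fcont; apply/continuous_epsP => e /fcont[d d0 dP].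
exists d => // y /dP; apply: le_lt_trans.
by have := entry_le_norm (f y - f x) i j; rewrite !mxE.
Qed.

Lemma continuous_tangent_coef (V : normedModType R) n (u : V -> 'rV[R]_n)
    (g : 'I_n -> V -> 'rV[R]_n) x m : (forall j, {for x, continuous (g j)}) ->
  {for x, continuous u} ->
  {for x, continuous (fun y => \sum_j u y 0 j * g j y 0 m)}.
Proof.
move=> gc uc; apply: continuous_sum_at => j _.
have c1 := continuous_entry_at (i := 0) (j := j) uc.
have c2 := continuous_entry_at (i := 0) (j := m) (gc j).
by apply: cvgM; [exact: c1|exact: c2].
Qed.

End LinearAlgebraLemmas.

Section QuadraticExpansion.
Context {R : realType} {n k : nat} (i : 'I_n.+1) (C : set 'cV[R]_n.+1).
Local Notation E := 'rV[R]_n.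
Context (U V : set E) (phi psi : E -> E).
Context (fc : flattened_cone (k := k) i C U V phi psi).
Let oU := fc_openU fc.
Let oV := fc_openV fc.
Let phiC := fc_phiC fc.
Let psiC := fc_psiC fc.
Local Notation flat_row := (flat_row (k := k)).
Local Notation param := (param i psi).
Local Notation straighten := (straighten i phi).
Local Notation "''e_' j" := (delta_mx 0 j : E) (at level 8, j at level 2).
Context (y0 : E) (c0 : R).
Context (Vy0 : V y0) (Fy0 : flat_row y0) (c00 : c0 != 0).
Local Notation v := (c0 *: param y0).

Definition jet2_mx l : 'M[R]_n :=
  \matrix_(a, b) pair l (chart_lin i ('D_('e_b) ('D_('e_a) psi) y0)).

Lemma jet2E l t : jet2 i psi l t y0 = (t *m jet2_mx l *m t^T) 0 0.
Proof.
rewrite /jet2 (derive2_sum_coords _ oV psiC)// -mulmxA mxE.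
rewrite (linear_sum (chart_lin i)) (linear_sum (pair l)); apply: eq_bigr => a _.
rewrite (linear_sum (chart_lin i)) (linear_sum (pair l)) mxE mulr_sumr.
apply: eq_bigr => b _.
by rewrite /= linearZ pairZ !mxE -mulrA [t 0 b * _]mulrC.
Qed.

Lemma quad_difference (H : 'M[R]_n) : exists2 K : R, 0 < K & forall s t : E,
  `|(t *m H *m t^T) 0 0 - (s *m H *m s^T) 0 0| <= K * `|t - s| * (`|t| + `|s|).
Proof.
have bil (s t : E) : `|(s *m H *m t^T) 0 0| <= (1 + n%:R * n%:R * `|H|) * `|s| * `|t|.
  rewrite (le_trans (entry_le_norm _ _ _))// (le_trans (mulmx_norm_le _ _))//.
  have -> : `|t^T| = `|t|.
    apply/eqP; rewrite eq_le; apply/andP; split; apply/mx_norm_leP => // a b.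
      by rewrite mxE entry_le_norm.
    by have := entry_le_norm t^T b a; rewrite mxE.
  rewrite ler_wpM2r// (@le_trans _ _ (n%:R * (n%:R * `|s| * `|H|)))//.
    by rewrite ler_wpM2l// mulmx_norm_le.
  rewrite mulrDl mul1r; apply: ler_wpDl => //.
  by rewrite -!mulrA [`|s| * _]mulrC.
exists (1 + n%:R * n%:R * `|H|); first by rewrite ltr_wpDr// !mulr_ge0.
move=> s t.
have -> : (t *m H *m t^T) 0 0 - (s *m H *m s^T) 0 0 =
    ((t - s) *m H *m t^T) 0 0 + (s *m H *m (t - s)^T) 0 0.
  rewrite !mulmxBl [(t - s)^T]linearB mulmxBr.
  by rewrite [in X in _ = X + _]mxE [in X in _ = _ + X + _]mxE
    [in X in _ = _ + X]mxE [in X in _ = _ + (_ + X)]mxE subrKA.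
rewrite (le_trans (ler_normD _ _))// mulrDr lerD//.
by rewrite (le_trans (bil _ _))// -mulrA [`|s| * _]mulrC mulrA.
Qed.

(** With [t = straighten w - y0], the pairing is [w i 0] times half of [Q t] plus an o(|t|^2).
    Replacing [w i 0] by [c0] and [t] by the differential of [straighten] at [w - v] costs only o(|w
    - v|^2), so [b] is a pull-back of the second jet. *)
Lemma conormal_quadratic l : conormal 1 C v l ->
  exists b : 'M[R]_n.+1, forall e : R, 0 < e -> exists2 d : R, 0 < d &
    forall w, C w -> `|w - v| < d ->
      `|pair l w - quad b (w - v)| <= e * `|w - v| ^+ 2.
Proof.
move=> /(conormal1P fc Vy0 Fy0 c00)[l0 l1].
have sd := straighten_differentiable fc Vy0 c00.
have [M ME] := linear_col_row ('d straighten v).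
have [K1 K10 K1P] := mx_linear_bounded ('d straighten v).
have [K2 K20 [d2 d20 d2P]] := straighten_lipschitz fc Vy0 c00.
have [K3 K30 K3P] := quad_difference (jet2_mx l).
pose Q t := jet2 i psi l t y0.
have QD s t : `|Q t - Q s| <= K3 * `|t - s| * (`|t| + `|s|).
  by rewrite /Q !jet2E; exact: K3P.
have Q0 : Q 0 = 0 by rewrite /Q jet2E !mul0mx mxE.
exists ((2^-1 * c0) *: (M^T *m jet2_mx l *m M)) => e e0.
have qE u : quad ((2^-1 * c0) *: (M^T *m jet2_mx l *m M)) u =
    2^-1 * c0 * Q ('d straighten v u).
  rewrite /quad /Q jet2E ME -scalemxAr -scalemxAl mxE trmxK; congr (_ * _).
  by rewrite trmx_mul !mulmxA.
(* The three summands are the constants of the error bounds [T1], [T2] and [T3] below, each of which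
   is proportional to [e1]. *)
pose B := 2 * `|c0| * K2 ^+ 2 + K3 * K2 ^+ 2 + `|c0| * K3 * (K2 + K1).
have B0 : 0 < B.
  by rewrite !addr_gt0// !mulr_gt0 ?exprn_gt0 ?normr_gt0// addr_gt0.
pose e1 := e / B.
have e10 : 0 < e1 by rewrite divr_gt0.
have [d3 d30 d3P] := pair_taylor fc l Vy0 e10.
have [d4 d40 d4P] := near_param fc Vy0 c00 d30.
have [d5 d50 d5P] := differentiable_eps sd e10.
exists (Num.min e1 (Num.min `|c0| (Num.min d2 (Num.min d4 d5)))) => [|w Cw].
  by rewrite !lt_min e10 normr_gt0 c00 d20 d40.
rewrite !lt_min => /and5P[we wc wd2 wd4 wd5].
have [Vw Fw yd wi wE] := d4P _ Cw wd4.
have tK := d2P _ wd2.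
set t := straighten w - y0 in yd tK.
have := d5P _ wd5; rewrite (addrC v) subrK (straighten_param fc)// -/t => tL.
have := d3P _ yd; rewrite {1}/t (addrC y0) subrK l0 l1; last first.
  by rewrite /t; exact: flat_rowB.
rewrite !add0r -/(Q t) => hQ.
have wic : `|w i 0 - c0| <= `|w - v|.
  have := entry_le_norm (w - v) i 0.
  by rewrite mxE [X in _ + X]mxE param_i.
have LK := K1P (w - v).
have Qt : `|Q t| <= K3 * (K2 * `|w - v|) ^+ 2.
  have := QD 0 t; rewrite Q0 !subr0 normr0 addr0 -mulrA -expr2 => /le_trans; apply.
  by rewrite ler_wpM2l ?(ltW K30)// lerXn2r ?nnegrE// mulr_ge0// ltW.
have QtL : `|Q t - Q ('d straighten v (w - v))| <=
    K3 * (e1 * `|w - v|) * (K2 * `|w - v| + K1 * `|w - v|).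
  rewrite (le_trans (QD _ _))// ler_pM ?mulr_ge0 ?addr_ge0 ?(ltW K30)//.
    by rewrite ler_wpM2l// ltW.
  by rewrite lerD.
have ht2 : `|pair l (param (straighten w)) - 2^-1 * Q t| <= e1 * (K2 * `|w - v|) ^+ 2.
  rewrite (le_trans hQ)// ler_wpM2l ?(ltW e10)// lerXn2r ?nnegrE//.
  by rewrite mulr_ge0// ltW.
rewrite qE [X in pair l X]wE pairZ.
have eB : e = e1 * B by rewrite /e1 divfK// gt_eqF.
move: (normr_ge0 (w - v)) wic we wc Qt QtL ht2; rewrite eB /B.
move: (`|w - v|) (Q t) (Q ('d straighten v (w - v))) (pair l _) (w i 0) => r q q' h a.
move=> r0 ac re rc qb qq' hq.
have -> : a * h - 2^-1 * c0 * q' =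
  a * (h - 2^-1 * q) + 2^-1 * ((a - c0) * q) + 2^-1 * (c0 * (q - q')) by field.
have a2 : `|a| <= 2 * `|c0|.
  rewrite -(subrK c0 a) (le_trans (ler_normD _ _))// mulr_natl mulr2n.
  by rewrite lerD2r (le_trans ac)// ltW.
have half x : 0 <= x -> 2^-1 * x <= x :> R by lra.
have T1 : `|a * (h - 2^-1 * q)| <= 2 * `|c0| * (e1 * (K2 * r) ^+ 2).
  by rewrite normrM ler_pM.
have T2 : `|2^-1 * ((a - c0) * q)| <= e1 * (K3 * (K2 * r) ^+ 2).
  rewrite normrM [`|2^-1|]ger0_norm ?invr_ge0//.
  rewrite (le_trans (half _ _))// normrM ler_pM// (le_trans ac)// ltW//.
have T3 : `|2^-1 * (c0 * (q - q'))| <= `|c0| * (K3 * (e1 * r) * (K2 * r + K1 * r)).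
  rewrite normrM [`|2^-1|]ger0_norm ?invr_ge0//.
  by rewrite (le_trans (half _ _))// normrM ler_wpM2l.
rewrite (le_trans (ler_normD _ _))// (le_trans (lerD (ler_normD _ _) (lexx _)))//.
rewrite (le_trans (lerD (lerD T1 T2) T3))//.
rewrite le_eqVlt; apply/orP; left; apply/eqP; ring.
Qed.

End QuadraticExpansion.

Section FlatPoints.
Context {R : realType} {n k : nat} (i : 'I_n.+1) (C : set 'cV[R]_n.+1).
Local Notation E := 'rV[R]_n.
Context (U V : set E) (phi psi : E -> E).
Context (fc : flattened_cone (k := k) i C U V phi psi).
Let oU := fc_openU fc.
Let oV := fc_openV fc.
Let phiC := fc_phiC fc.
Let psiC := fc_psiC fc.
Local Notation flat_row := (flat_row (k := k)).
Local Notation param := (param i psi).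
Local Notation straighten := (straighten i phi).
Local Notation "''e_' j" := (delta_mx 0 j : E) (at level 8, j at level 2).

(* The coefficients of u on the tangent vectors 'D_(e_m) psi y, as soon as u is
   one of their combinations. *)
Definition tangent_coef (y u : E) (m : 'I_n) : R :=
  \sum_j u 0 j * (('D_('e_j) phi \o psi) y) 0 m.

(** Flatness read in the chart: second derivatives along flat rows are tangent. The coefficients are
    explicit continuous functions of [y], instead of being quantified, so that the condition is
    visibly closed. *)
Definition flat_chart (y : E) : Prop := forall t, flat_row t ->
  'D_t ('D_t psi) y = \sum_(m < n | (m < k)%N)
     tangent_coef y ('D_t ('D_t psi) y) m *: 'D_('e_m) psi y.

Lemma tangent_coefE y u m : V y -> tangent_coef y u m = ('D_u phi (psi y)) 0 m.
Proof.
move=> Vy; rewrite derive_sum_coords; last first.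
  by apply: class_C_differentiable phiC _ => //; exact: (fc_psiV fc).
by rewrite summxE; apply: eq_bigr => j _; rewrite mxE.
Qed.

Lemma derive_phi_psi y t : V y -> 'D_('D_t psi y) phi (psi y) = t.
Proof.
move=> Vy.
have pd := class_C_differentiable oV psiC Vy.
have fd := class_C_differentiable oU phiC (fc_psiV fc Vy).
rewrite (deriveE _ fd) (deriveE _ pd).
rewrite -[LHS]/(('d phi (psi y) \o 'd psi y) t) -diff_comp// -deriveE; last first.
  exact: differentiable_comp.
rewrite -[RHS](derive_id y t); apply: near_eq_derive.
by apply: filterS (open_nbhs_nbhs (conj oV Vy)) => z Vz; exact: (fc_psiK fc).
Qed.

(** By [derive_phi_psi] the differential of [phi] sends the tangent vectors back to the standard
    basis, hence reads off coefficients. *)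
Lemma tangent_coef_sum y (cf : 'I_n -> R) (m : 'I_n) : V y -> (m < k)%N ->
  tangent_coef y (\sum_(j < n | (j < k)%N) cf j *: 'D_('e_j) psi y) m = cf m.
Proof.
move=> Vy mk; pose J : 'M[R]_n := \matrix_(j, p) 'D_('e_j) phi (psi y) 0 p.
have JE u p : tangent_coef y u p = (u *m J) 0 p.
  by rewrite mxE; apply: eq_bigr => j _; rewrite mxE.
have Jpsi j p : ('D_('e_j) psi y *m J) 0 p = ('e_j : E) 0 p.
  by rewrite -JE tangent_coefE// derive_phi_psi.
rewrite JE; apply: dual_family_coef mk _ => j; apply/rowP => p.
exact: Jpsi.
Qed.

(** The homogeneous version of the affine function [u |-> (u - q) *m z] of the chart. *)
Definition shift_functional (q : E) (z : 'cV[R]_n) : 'rV[R]_n.+1 :=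
  z^T *m (\matrix_(j, r) (r == lift i j)%:R) - (q *m z) 0 0 *: delta_mx 0 i.

Lemma pair_delta (w : 'cV[R]_n.+1) : pair (delta_mx 0 i) w = w i 0.
Proof. by rewrite /pair -rowE mxE. Qed.

Lemma pick_liftE (w : 'cV[R]_n.+1) :
  (\matrix_(j, r) (r == lift i j)%:R) *m w = \col_j w (lift i j) 0.
Proof.
apply/colP => j; rewrite !mxE (bigD1 (lift i j))//= mxE eqxx mul1r.
by rewrite big1 ?addr0// => r /negPf rj; rewrite mxE rj mul0r.
Qed.

Lemma shift_functionalE q z w : pair (shift_functional q z) w =
  \sum_j z j 0 * w (lift i j) 0 - (q *m z) 0 0 * w i 0.
Proof.
rewrite /shift_functional -scaleN1r pairDl pairZl mulN1r pairZl pair_delta.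
congr (_ - _); rewrite /pair -mulmxA pick_liftE mxE.
by apply: eq_bigr => j _; rewrite !mxE.
Qed.

Lemma shift_functional_lin q z u :
  pair (shift_functional q z) (chart_lin i u) = (u *m z) 0 0.
Proof.
rewrite shift_functionalE chart_lin_i mulr0 subr0 mxE.
by apply: eq_bigr => j _; rewrite chart_lin_lift mulrC.
Qed.

Lemma shift_functional_inv q z : pair (shift_functional q z) (chart_inv i q) = 0.
Proof.
rewrite shift_functionalE chart_inv_i mulr1 mxE; apply/eqP; rewrite subr_eq0.
by apply/eqP; apply: eq_bigr => j _; rewrite chart_inv_lift mulrC.
Qed.

Lemma jet1_flat l y t : V y ->
  (forall m : 'I_n, (m < k)%N -> jet1 i psi l 'e_m y = 0) -> flat_row t ->
  jet1 i psi l t y = 0.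
Proof.
move=> Vy le Ft; have pd := class_C_differentiable oV psiC Vy.
rewrite /jet1 deriveE// [t](flat_row_sum Ft) linear_sum.
rewrite (linear_sum (chart_lin i)) (linear_sum (pair l)) big1// => m mk /=.
by rewrite linearZ linearZ pairZ -deriveE// [pair _ _]le// mulr0.
Qed.

(** A form [z] killing the tangent vectors extends to a conormal, [shift_functional]; flatness makes
    it kill the second derivative, which is therefore tangent by duality. Conversely, conormals kill
    tangent vectors. *)
Lemma flat_atP y c : V y -> flat_row y -> c != 0 ->
  flat_at C (c *: param y) <-> flat_chart y.
Proof.
move=> Vy Fy c0; split=> [fl t Ft|fl l].
  have [cf uE] : exists cf : 'I_n -> R, 'D_t ('D_t psi) y =
      \sum_(m < n | (m < k)%N) cf m *: 'D_('e_m) psi y.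
    apply: row_span_dual => z zP.
    pose l := shift_functional (psi y) z.
    have l1 : conormal 1 C (c *: param y) l.
      apply/(conormal1P fc Vy Fy c0); split; first exact: shift_functional_inv.
      move=> s Fs; apply: jet1_flat => // m mk.
      by rewrite /jet1 shift_functional_lin zP// mxE.
    have /(conormal2P fc Vy Fy c0 l1)/(_ t Ft) := fl _ l1.
    rewrite /jet2 shift_functional_lin => u0; apply/matrixP => a b.
    by rewrite !ord1 u0 mxE.
  rewrite {1}uE; apply: eq_bigr => m mk; congr (_ *: _).
  by rewrite uE tangent_coef_sum.
move=> l1; have [_ l1t] := (conormal1P fc Vy Fy c0 l).1 l1.
apply/(conormal2P fc Vy Fy c0 l1) => t Ft.
rewrite /jet2 (fl t Ft) (linear_sum (chart_lin i)) (linear_sum (pair l)).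
rewrite big1// => m mk /=; rewrite linearZ pairZ.
by rewrite [pair _ _](l1t 'e_m (flat_row_delta mk)) mulr0.
Qed.

Lemma flat_chart_all y : (forall w, C w -> flat_at C w) ->
  V y -> flat_row y -> flat_chart y.
Proof.
move=> fl Vy Fy; apply/(flat_atP Vy Fy (oner_neq0 R)); apply: fl.
exact: (fc_cone fc) (oner_neq0 _).
Qed.

Definition flat_defect (t y : E) : E := 'D_t ('D_t psi) y -
  \sum_(m < n | (m < k)%N) tangent_coef y ('D_t ('D_t psi) y) m *: 'D_('e_m) psi y.

Lemma continuous_flat_defect y0 t : V y0 -> {for y0, continuous (flat_defect t)}.
Proof.
move=> Vy0.
have c2 : {for y0, continuous ('D_t ('D_t psi))}.
  exact: class_C_continuous (class_C_derive t (class_C_derive t psiC)) Vy0.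
have cpsi : {for y0, continuous psi} by exact: class_C_continuous psiC Vy0.
apply: continuousB => //; apply: continuous_sum_at => m mk.
apply: continuousZ; last exact: class_C_continuous (class_C_derive _ psiC) Vy0.
apply: continuous_tangent_coef c2 => j.
exact: (continuous_comp cpsi
  (class_C_continuous (class_C_derive 'e_j phiC) (fc_psiV fc Vy0))).
Qed.

(** [flat_defect] is continuous, because second derivatives are, and vanishes at the chart points of
    flat vectors. *)
Lemma flat_at_closed y0 c0 : V y0 -> flat_row y0 -> c0 != 0 ->
  (forall d : R, 0 < d -> exists w,
     [/\ C w, `|w - c0 *: param y0| < d & flat_at C w]) ->
  flat_at C (c0 *: param y0).
Proof.
move=> Vy0 Fy0 c00 near; apply/(flat_atP Vy0 Fy0 c00) => t Ft.
apply/eqP; rewrite -subr_eq0 -normr_eq0; apply/eqP.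
rewrite -/(flat_defect t y0).
apply: (@norm_small0 R _ 1) => e e0; rewrite mulr1 normr_id.
have [d d0 dP] := (continuous_epsP _ _).1 (continuous_flat_defect (t := t) Vy0) _ e0.
have [d' d'0 d'P] := near_param fc Vy0 c00 d0.
have [w [Cw wd wfl]] := near _ d'0.
have [Vw Fw yd wi wE] := d'P _ Cw wd.
rewrite wE in wfl; have uE := (flat_atP Vw Fw wi).1 wfl t Ft.
have z0 : flat_defect t (straighten w) = 0 by apply/eqP; rewrite subr_eq0; apply/eqP.
by have := dP _ yd; rewrite z0 sub0r normrN => /ltW.
Qed.

Lemma exists_conormal y c : (k < n)%N -> V y -> flat_row y -> c != 0 ->
  exists2 l, l != 0 & conormal 1 C (c *: param y) l.
Proof.
move=> kn Vy Fy c0.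
(* Columns: the point itself and its [k] tangent vectors. They are fewer than the [n.+1]
   coordinates, so some nonzero form kills them all. *)
pose G : 'M[R]_(n.+1, k.+1) := \matrix_(r, m)
  (if unlift ord0 m is Some j then chart_lin i ('D_('e_(widen_ord (ltnW kn) j)) psi y) r 0
   else param y r 0).
have /rowV0Pn[l /sub_kermxP lG l0] : kermx G != 0.
  rewrite kermx_eq0 /row_free neq_ltn (leq_ltn_trans (rank_leq_col G))//.
exists l => //.
have lGm m : \sum_r l 0 r * G r m = 0.
  by have /matrixP/(_ 0 m) := lG; rewrite !mxE.
apply/(conormal1P fc Vy Fy c0); split.
  rewrite /pair mxE -[RHS](lGm ord0); apply: eq_bigr => r _.
  by rewrite [G r ord0]mxE unlift_none.
move=> t Ft; apply: jet1_flat => // m mk.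
rewrite /jet1 /pair mxE -[RHS](lGm (lift ord0 (Ordinal mk))).
apply: eq_bigr => r _; rewrite [G r _]mxE liftK.
by congr (_ * chart_lin i ('D_('e_ _) psi y) r 0); exact: val_inj.
Qed.

Lemma cone_open y c : k = n -> V y -> c != 0 ->
  exists2 d : R, 0 < d & forall w, `|w - c *: param y| < d -> C w.
Proof.
move=> kn Vy c0.
have vi : (c *: param y) i 0 != 0 by rewrite param_i.
have cc := differentiable_continuous (chart_coord_differentiable vi).
apply/near_normP.
have Uv : \forall w \near c *: param y, U (chart_coord i w).
  apply: cc; apply: open_nbhs_nbhs; split=> //.
  by rewrite chart_invK//; exact: (fc_psiV fc).
have wi : \forall w \near c *: param y, (w : 'cV[R]_n.+1) i 0 != 0.
  apply/near_normP; exists `|c|; rewrite ?normr_gt0// => w wc.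
  apply: contraTneq wc => wi; rewrite -leNgt.
  have := entry_le_norm (w - c *: param y) i 0.
  by rewrite mxE [X in _ + X]mxE wi add0r normrN param_i.
near=> w.
have Uw : U (chart_coord i w) by near: w.
have wi0 : w i 0 != 0 by near: w.
rewrite (chart_coordK wi0) -(fc_phiK fc Uw); apply: (fc_cone fc) => //.
  exact: (fc_phiU fc).
by move=> j; rewrite kn leqNgt ltn_ord.
Unshelve. all: by end_near. Qed.

End FlatPoints.

Section FlatCone.
Context {R : realType} {n k : nat} (i : 'I_n.+1) (C : set 'cV[R]_n.+1).
Local Notation E := 'rV[R]_n.
Context (U V : set E) (phi psi : E -> E).
Context (fc : flattened_cone (k := k) i C U V phi psi).
Let oU := fc_openU fc.
Let oV := fc_openV fc.
Let phiC := fc_phiC fc.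
Let psiC := fc_psiC fc.
Local Notation flat_row := (flat_row (k := k)).
Local Notation param := (param i psi).
Local Notation straighten := (straighten i phi).
Local Notation jet1 := (jet1 i psi).
Local Notation jet2 := (jet2 i psi).
Local Notation "''e_' j" := (delta_mx 0 j : E) (at level 8, j at level 2).

Lemma local_bounds y0 : V y0 -> exists2 K : R, 0 < K & exists2 r : R, 0 < r &
  forall y, `|y - y0| < r -> [/\ V y, forall t, `|'D_t psi y| <= K * `|t|,
    forall t, `|'D_t ('D_t psi) y| <= K * `|t| ^+ 2 &
    forall u m, `|tangent_coef phi psi y u m| <= K * `|u|].
Proof.
move=> Vy0; have Up := fc_psiV fc Vy0.
have [K1 K10 K1P] := derive_bounded oV (class_C_le psiC) Vy0.
have [K2 K20 K2P] := derive2_bounded oV psiC Vy0.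
have [K3 K30 K3P] := derive_bounded oU (class_C_le phiC) Up.
have [d0 d00 d0P] := open_delta oV Vy0.
have [d1 d10 d1P] := derive_near oV (class_C_le psiC) Vy0 ltr01.
have [d2 d20 d2P] := derive2_near oV psiC Vy0 ltr01.
have [d3 d30 d3P] := derive_near oU (class_C_le phiC) Up ltr01.
have [d4 d40 d4P] := (continuous_epsP _ _).1 (class_C_continuous psiC Vy0) _ d30.
exists (K1 + K2 + K3 + 1); first by rewrite !addr_gt0.
exists (Num.min (Num.min d0 d1) (Num.min d2 d4)).
  by rewrite !lt_min d00 d10 d20.
move=> y; rewrite !lt_min => /andP[/andP[yd0 yd1] /andP[yd2 yd4]].
have tri m n' (a b : 'M[R]_(m, n')) (x p q K : R) : `|a - b| <= 1 * x -> `|b| <= p * x ->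
    0 <= q -> 0 <= x -> K = p + q + 1 -> `|a| <= K * x.
  move=> ab bp q0 x0 ->; rewrite -(subrK b a) (le_trans (ler_normD _ _))//.
  rewrite (le_trans (lerD ab bp))// -mulrDl ler_wpM2r//; lra.
split; first exact: d0P.
- move=> t; apply: (tri _ _ _ ('D_t psi y0) _ K1 (K2 + K3));
    [exact: d1P|exact: K1P|by rewrite addr_ge0// ltW|exact: normr_ge0|by ring].
- move=> t; apply: (tri _ _ _ ('D_t ('D_t psi) y0) _ K2 (K1 + K3));
    [exact: d2P|exact: K2P|by rewrite addr_ge0// ltW|exact: exprn_ge0|by ring].
- move=> u m; rewrite (tangent_coefE fc)//; last exact: d0P.
  apply: le_trans (entry_le_norm _ _ _) _.
  apply: (tri _ _ _ ('D_u phi (psi y0)) _ K3 (K1 + K2));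
    [by apply: d3P; exact: d4P|exact: K3P|by rewrite addr_ge0// ltW
    |exact: normr_ge0|by ring].
Qed.

Lemma jet2_flat l t y : V y -> flat_row t -> flat_chart (k := k) phi psi y ->
  jet2 l t y = \sum_(m < n | (m < k)%N)
    tangent_coef phi psi y ('D_t ('D_t psi) y) m * jet1 l 'e_m y.
Proof.
move=> Vy Ft fl.
have uE : 'D_t ('D_t psi) y = \sum_(m < n | (m < k)%N)
  tangent_coef phi psi y ('D_t ('D_t psi) y) m *: 'D_('e_m) psi y by exact: fl.
rewrite /jet2 {1}uE (linear_sum (chart_lin i)) (linear_sum (pair l)).
by apply: eq_bigr => m _; rewrite /= linearZ pairZ.
Qed.

(** For a single linear form the remainder is an exact value of [jet2] on the segment, from any base
    point [y]; [pair_taylor] only gives an estimate near a fixed one. *)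
Lemma pair_taylor_lagrange l y t :
  (forall s : R, 0 <= s <= 1 -> V (y + s *: t)) ->
  exists2 c : R, 0 <= c <= 1 &
    pair l (param (y + t)) = pair l (param y) + jet1 l t y + 2^-1 * jet2 l t (y + c *: t).
Proof.
move=> segV.
pose L : E -> R := pair l \o chart_lin i.
have Llin : linear L by move=> a u w; rewrite /L /= linearP pairD pairZ.
pose LM := GRing.isLinear.Build R E R *%R L Llin.
pose LL : {linear E -> R} := HB.pack L LM.
have Lc : continuous LL := @mx_linear_continuous _ _ _ _ LL.
have gC : class_C 2 V (fun y => LL (psi y)) := class_C_linear oV Lc psiC.
have D1 z : V z -> 'D_t (fun y => LL (psi y)) z = jet1 l t z.
  by move=> Vz; have [_ ->//] := is_derive_linear Lc
    (class_C_derivable (v := t) psiC Vz).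
have D2 z : V z -> 'D_t ('D_t (fun y => LL (psi y))) z = jet2 l t z.
  move=> Vz; rewrite (@near_eq_derive _ _ _ _ (fun y => LL ('D_t psi y))).
    by have [_ ->//] := is_derive_linear Lc
      (class_C_derivable (v := t) (class_C_derive t psiC) Vz).
  by apply: filterS (open_nbhs_nbhs (conj oV Vz)) => x Vx; exact: D1.
have Vy : V y by have := segV 0; rewrite scale0r addr0 lexx ler01; apply.
have [s /segV Vs|s /segV Vs|c c01 E1] := @taylor2_line _ _ (fun y => LL (psi y)) y t.
- exact: (class_C_derivable (v := t) gC Vs).
- exact: (class_C_derivable (v := t) (class_C_derive t gC) Vs).
exists c => //; move: E1; rewrite D1// D2; last exact: segV.
rewrite /param /chart_inv !pairD => E1.
by rewrite -![pair l (chart_lin i _)]/(LL _) E1 !addrA.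
Qed.

Section Contraction.
Context (y0 : E) (l : 'rV[R]_n.+1) (K rho : R).
Context (rho0 : 0 < rho) (K0 : 0 <= K) (Krho : 3 * K * rho <= 1).
Context (Fy0 : flat_row y0) (l0 : pair l (param y0) = 0).
Context (l1 : forall t, flat_row t -> jet1 l t y0 = 0).
Definition box (y : E) : Prop := flat_row y /\ `|y - y0| <= rho.
Context (boxV : forall y, box y -> V y).
Context (jet2_bound : forall g : R, 0 <= g -> forall y, box y ->
  (forall m : 'I_n, (m < k)%N -> `|jet1 l 'e_m y| <= g) ->
  forall t, flat_row t -> `|jet2 l t y| <= K * `|t| ^+ 2 * g).

Lemma box_value_bound g : 0 <= g ->
  (forall y, box y -> forall m : 'I_n, (m < k)%N -> `|jet1 l 'e_m y| <= g) ->
  forall y, box y -> `|pair l (param y)| <= 2^-1 * (K * rho ^+ 2 * g).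
Proof.
move=> g0 jg y [Fy yr]; have Ft := flat_rowB Fy Fy0.
have seg (s : R) : 0 <= s <= 1 -> box (y0 + s *: (y - y0)).
  move=> s01; split; first exact/flat_rowD/flat_rowZ.
  exact: le_trans (segment_norm _ _ s01) _.
have [s /seg/boxV//|c c01] := @pair_taylor_lagrange l y0 (y - y0).
rewrite addrC subrK l0 l1// !add0r => ->.
rewrite normrM [`|2^-1|]ger0_norm ?invr_ge0// ler_wpM2l ?invr_ge0//.
rewrite (le_trans (jet2_bound g0 (seg _ c01) (jg _ (seg _ c01)) Ft))//.
by rewrite ler_wpM2r// ler_wpM2l// lerXn2r ?nnegrE// ltW.
Qed.

(** Stepping away from the side where [d] lies, a full step of length [rho] remains in the interval;
    the full length is what [half_step_bound] requires. *)
Lemma opposite_step (d : R) : `|d| <= rho ->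
  exists2 s : R, `|s| = rho & forall c : R, 0 <= c <= 1 -> `|d + c * s| <= rho.
Proof.
move=> dr; have [d0|d0] := leP 0 d.
  exists (- rho); first by rewrite normrN gtr0_norm.
  move: dr; rewrite ger0_norm// => dr c /andP[c0 c1].
  by rewrite ler_norml; apply/andP; split; nra.
exists rho; first by rewrite gtr0_norm.
move: dr; rewrite ltr0_norm// => dr c /andP[c0 c1].
by rewrite ler_norml; apply/andP; split; nra.
Qed.

(** The values at both ends and the remainder contribute at most half of [K * rho ^+ 2 * g] each. As
    [3 * K * rho <= 1], the sum is at most [rho * (g / 2)], for a step of length [rho]. *)
Lemma half_step_bound (a h h' q g : R) (s : R) : 0 <= g -> `|s| = rho ->
  `|h| <= 2^-1 * (K * rho ^+ 2 * g) -> `|h'| <= 2^-1 * (K * rho ^+ 2 * g) ->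
  `|q| <= K * rho ^+ 2 * g -> h' = h + s * a + 2^-1 * q -> `|a| <= g / 2.
Proof.
move=> g0 sr hb hb' qb E1.
have sa : s * a = h' - h - 2^-1 * q by rewrite E1; ring.
rewrite -(ler_pM2l rho0) -[X in X * `|a|]sr -normrM sa.
rewrite (le_trans (ler_normB _ _))// (le_trans (lerD (ler_normB _ _) (lexx _)))//.
rewrite normrM [`|2^-1|]ger0_norm ?invr_ge0//.
have half0 : 0 <= 2^-1 :> R by rewrite invr_ge0.
rewrite (le_trans (lerD (lerD hb' hb) (ler_wpM2l half0 qb)))//.
have -> : 2^-1 * (K * rho ^+ 2 * g) + 2^-1 * (K * rho ^+ 2 * g) +
  2^-1 * (K * rho ^+ 2 * g) = (3 * K * rho) * (rho * (g / 2)) by field.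
by rewrite ler_piMl// mulr_ge0 ?divr_ge0// ltW.
Qed.

Lemma box_contraction g : 0 <= g ->
  (forall y, box y -> forall m : 'I_n, (m < k)%N -> `|jet1 l 'e_m y| <= g) ->
  forall y, box y -> forall m : 'I_n, (m < k)%N -> `|jet1 l 'e_m y| <= g / 2.
Proof.
move=> g0 jg y By m mk; have [Fy yr] := By.
have [s sr sP] := opposite_step (le_trans (entry_le_norm (y - y0) 0 m) yr).
have Fs : flat_row (s *: 'e_m) by apply/flat_rowZ/flat_row_delta.
have seg (c : R) : 0 <= c <= 1 -> box (y + c *: (s *: 'e_m)).
  move=> c01; split; first exact/flat_rowD/flat_rowZ.
  apply/mx_norm_leP => [|a b]; first exact: ltW.
  have := sP _ c01; rewrite ord1 !mxE eqxx /=.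
  have [->|bm] := eqVneq b m; first by rewrite mulr1 addrAC.
  move=> _; rewrite !mulr0 addr0.
  by have := le_trans (entry_le_norm (y - y0) 0 b) yr; rewrite !mxE.
have [c' /seg/boxV//|c c01] := @pair_taylor_lagrange l y (s *: 'e_m).
rewrite (jet1Z fc) => [E1|]; last exact: boxV.
have B1 : box (y + s *: 'e_m).
  by have := seg 1; rewrite scale1r ler01 lexx; apply.
apply: (half_step_bound g0 sr (box_value_bound g0 jg By) (box_value_bound g0 jg B1) _ E1).
rewrite (le_trans (jet2_bound g0 (seg _ c01) (jg _ (seg _ c01)) Fs))//.
rewrite ler_wpM2r// ler_wpM2l// lerXn2r ?nnegrE ?(ltW rho0)//.
rewrite normrZ sr ler_piMr ?(ltW rho0)//.
by apply/mx_norm_leP => // a b; rewrite mxE; case: (_ && _); rewrite ?normr1 ?normr0.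
Qed.

Lemma box_vanish (g : R) : 0 <= g ->
  (forall y, box y -> forall m : 'I_n, (m < k)%N -> `|jet1 l 'e_m y| <= g) ->
  forall y, box y -> pair l (param y) = 0.
Proof.
move=> g0 jg.
have jgN (N : nat) : forall y, box y -> forall m : 'I_n, (m < k)%N ->
    `|jet1 l 'e_m y| <= g / 2 ^+ N.
  elim: N => [|N IH]; first by rewrite expr0 divr1.
  have gN : 0 <= g / 2 ^+ N by rewrite divr_ge0// exprn_ge0.
  by have := box_contraction gN IH; rewrite exprSr invfM mulrA.
have j0 y : box y -> forall m : 'I_n, (m < k)%N -> `|jet1 l 'e_m y| <= 0.
  move=> By m mk; rewrite leNgt; apply/negP => a0.
  have gj : 0 < g / `|jet1 l 'e_m y|.
    have := jgN 0%N y By m mk; rewrite expr0 divr1 => ag.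
    by rewrite divr_gt0// (lt_le_trans a0).
  pose N := (Num.truncn (g / `|jet1 l 'e_m y|)).+1.
  have NP : g / `|jet1 l 'e_m y| < 2 ^+ N.
    have : g / `|jet1 l 'e_m y| < N%:R by rewrite truncnS_gt.
    by move=> /lt_le_trans; apply; rewrite -natrX ler_nat ltnW// ltn_expl.
  have := jgN N y By m mk; rewrite leNgt => /negP; apply.
  by rewrite ltr_pdivrMr ?exprn_gt0// mulrC -ltr_pdivrMr.
move=> y By; apply/eqP; rewrite -normr_le0.
by have := box_value_bound (lexx 0) j0 By; rewrite !mulr0.
Qed.

End Contraction.

(* A contraction argument on a small box: at flat points the second derivatives
   of l along C are controlled by its first ones, and conversely Taylor's
   formula bounds the latter on the box by a fraction of their supremum. *)
Lemma flat_locally_linear y0 c0 : V y0 -> flat_row y0 -> c0 != 0 ->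
  (forall w, C w -> flat_at C w) ->
  exists2 d : R, 0 < d & forall l, conormal 1 C (c0 *: param y0) l ->
    forall w, C w -> `|w - c0 *: param y0| < d -> pair l w = 0.
Proof.
move=> Vy0 Fy0 c00 fl; have [K K0 [r r0 rP]] := local_bounds Vy0.
(* At a flat point [jet2] is a sum of at most [n] terms, each with a tangent coefficient bounded by
   [K] times a second derivative, itself at most [K * |t| ^+ 2]. *)
pose K' := n%:R * (K * K).
have K'0 : 0 <= K' by rewrite !mulr_ge0// ltW.
pose rho := Num.min (r / 2) (3 * K' + 1)^-1.
have K'1 : 0 < 3 * K' + 1 by rewrite ltr_wpDl// mulr_ge0.
have rho0 : 0 < rho by rewrite lt_min divr_gt0//= invr_gt0.
have rhor : rho < r.
  have : rho <= r / 2 by rewrite ge_min lexx.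
  by move=> /le_lt_trans; apply; lra.
have Krho : 3 * K' * rho <= 1.
  have : rho <= (3 * K' + 1)^-1 by rewrite ge_min lexx orbT.
  rewrite -(ler_pM2l K'1) mulfV ?gt_eqF//; lra.
(* [d] is fixed before [l], which enters the contraction only through the initial bound [Kl * K].
   [conormal_vanishes] relies on this uniformity: it uses the same [d] for all the conormals
   [l *m invmx B ^+ k]. *)
have [d d0 dP] := near_param fc Vy0 c00 rho0.
exists d => // l /(conormal1P fc Vy0 Fy0 c00)[l0 l1] w Cw wd.
have [Vw Fw yd wi wE] := dP _ Cw wd.
rewrite wE pairZ; apply/eqP; rewrite mulf_eq0; apply/orP; right; apply/eqP.
have boxr y : box y0 rho y -> `|y - y0| < r by move=> [_ /le_lt_trans]; apply.
have [Kl Kl0 KlP] := pair_bounded l.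
apply: (@box_vanish y0 l K' rho rho0 K'0 Krho Fy0 l0 l1 _ _ (Kl * K)).
- by move=> y /boxr /rP[].
- move=> g g0 y By jg t Ft; have [Vy _ D2 T] := rP _ (boxr _ By).
  rewrite jet2_flat//; last by apply: (flat_chart_all fc) => //; case: By.
  rewrite (le_trans (ler_norm_sum _ _ _))//.
  apply: (@le_trans _ _ (\sum_(m < n) K * K * `|t| ^+ 2 * g)); last first.
    by rewrite sumr_const card_ord -[leLHS]mulr_natl /K' !mulrA.
  rewrite [leRHS](bigID (fun m : 'I_n => (m < k)%N))/= ler_wpDr//.
    by apply: sumr_ge0 => m _; rewrite !mulr_ge0 ?exprn_ge0// ltW.
  apply: ler_sum => m mk; rewrite normrM ler_pM ?jg//.
  by rewrite (le_trans (T _ _))// -mulrA ler_wpM2l// ltW.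
- by rewrite mulr_ge0// ltW.
- move=> y By m mk; have [Vy D1 _ _] := rP _ (boxr _ By).
  rewrite (le_trans (KlP _))// ler_wpM2l ?(ltW Kl0)//.
  rewrite (le_trans (chart_lin_norm _ _))// (le_trans (D1 _))// ler_piMr ?(ltW K0)//.
  by apply/mx_norm_leP => // a b; rewrite mxE; case: (_ && _); rewrite ?normr1 ?normr0.
- by split=> //; exact: ltW.
Qed.

End FlatCone.

(** * Zariski density and the action on bilinear forms *)

Section PolynomialFunctions.
Context {R : realType} {d : nat}.
Implicit Types (f g : 'M[R]_d -> R) (F G : 'M[R]_d -> {poly R}).

Definition polyfun f : Prop := exists p : mpoly.mpoly (d * d) R,
  forall A, f A = mpoly.meval (fun k => mxvec A 0 k) p.

Lemma polyfun_ext f g : f =1 g -> polyfun f -> polyfun g.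
Proof. by move=> fg [p pP]; exists p => A; rewrite -fg. Qed.

Lemma polyfun_cst (c : R) : polyfun (fun=> c).
Proof. by exists (mpoly.mpolyC _ c) => A; rewrite mpoly.mevalC. Qed.

Lemma polyfun_entry i j : polyfun (fun A => A i j).
Proof.
exists (mpoly.mpolyX R (mpoly.mnm1 (mxvec_index i j))) => A.
by rewrite mpoly.mevalXU mxvecE.
Qed.

Lemma polyfunD f g : polyfun f -> polyfun g -> polyfun (fun A => f A + g A).
Proof. by move=> [p pP] [q qP]; exists (p + q) => A; rewrite mpoly.mevalD pP qP. Qed.

Lemma polyfunM f g : polyfun f -> polyfun g -> polyfun (fun A => f A * g A).
Proof. by move=> [p pP] [q qP]; exists (p * q) => A; rewrite mpoly.mevalM pP qP. Qed.

Lemma polyfunN f : polyfun f -> polyfun (fun A => - f A).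
Proof.
move=> pf; apply: (polyfun_ext _ (polyfunM (polyfun_cst (-1)) pf)) => A.
by rewrite mulN1r.
Qed.

Lemma polyfunB f g : polyfun f -> polyfun g -> polyfun (fun A => f A - g A).
Proof. by move=> pf pg; exact: polyfunD pf (polyfunN pg). Qed.

Lemma polyfun_sum (I : Type) (r : seq I) (P : pred I) (f : I -> 'M[R]_d -> R) :
  (forall i, polyfun (f i)) -> polyfun (fun A => \sum_(i <- r | P i) f i A).
Proof.
move=> pf; elim: r => [|i r IH].
  by apply: polyfun_ext (polyfun_cst 0) => A; rewrite big_nil.
case Pi: (P i).
  by apply: polyfun_ext (polyfunD (pf i) IH) => A; rewrite big_cons Pi.
by apply: polyfun_ext IH => A; rewrite big_cons Pi.
Qed.

Lemma polyfun_prod (I : Type) (r : seq I) (P : pred I) (f : I -> 'M[R]_d -> R) :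
  (forall i, polyfun (f i)) -> polyfun (fun A => \prod_(i <- r | P i) f i A).
Proof.
move=> pf; elim: r => [|i r IH].
  by apply: polyfun_ext (polyfun_cst 1) => A; rewrite big_nil.
case Pi: (P i).
  by apply: polyfun_ext (polyfunM (pf i) IH) => A; rewrite big_cons Pi.
by apply: polyfun_ext IH => A; rewrite big_cons Pi.
Qed.

Lemma polyfunX f k : polyfun f -> polyfun (fun A => f A ^+ k).
Proof.
move=> pf; elim: k => [|k IH].
  by apply: polyfun_ext (polyfun_cst 1) => A; rewrite expr0.
by apply: polyfun_ext (polyfunM pf IH) => A; rewrite exprS.
Qed.

Definition mxpolyfun m n (M : 'M[R]_d -> 'M[R]_(m, n)) : Prop :=
  forall i j, polyfun (fun A => M A i j).

Lemma mxpolyfun_cst m n (M : 'M[R]_(m, n)) : mxpolyfun (fun=> M).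
Proof. by move=> i j; exact: polyfun_cst. Qed.

Lemma mxpolyfun_id : mxpolyfun id.
Proof. by move=> i j; exact: polyfun_entry. Qed.

Lemma mxpolyfunM m n p (M : 'M[R]_d -> 'M[R]_(m, n)) (N : 'M[R]_d -> 'M[R]_(n, p)) :
  mxpolyfun M -> mxpolyfun N -> mxpolyfun (fun A => M A *m N A).
Proof.
move=> pM pN i j; apply: (@polyfun_ext (fun A => \sum_k M A i k * N A k j)).
  by move=> A; rewrite mxE.
by apply: polyfun_sum => k; exact: polyfunM.
Qed.

Lemma mxpolyfunZ m n f (M : 'M[R]_d -> 'M[R]_(m, n)) :
  polyfun f -> mxpolyfun M -> mxpolyfun (fun A => f A *: M A).
Proof.
move=> pf pM i j; apply: (polyfun_ext _ (polyfunM pf (pM i j))) => A.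
by rewrite mxE.
Qed.

Lemma mxpolyfun_sum m n (I : Type) (r : seq I) (M : I -> 'M[R]_d -> 'M[R]_(m, n)) :
  (forall i, mxpolyfun (M i)) -> mxpolyfun (fun A => \sum_(i <- r) M i A).
Proof.
move=> pM i j; apply: (@polyfun_ext (fun A => \sum_(k <- r) M k A i j)).
  by move=> A; rewrite summxE.
by apply: polyfun_sum => k; exact: pM.
Qed.

Lemma mxpolyfun_tr m n (M : 'M[R]_d -> 'M[R]_(m, n)) :
  mxpolyfun M -> mxpolyfun (fun A => (M A)^T).
Proof. by move=> pM i j; apply: polyfun_ext (pM j i) => A; rewrite mxE. Qed.

Lemma polyfun_det n (M : 'M[R]_d -> 'M[R]_n) :
  mxpolyfun M -> polyfun (fun A => \det (M A)).
Proof.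
move=> pM; apply: polyfun_sum => s; apply: polyfunM (polyfun_cst _) _.
by apply: polyfun_prod => i; exact: pM.
Qed.

Lemma polyfun_tr n (M : 'M[R]_d -> 'M[R]_n) :
  mxpolyfun M -> polyfun (fun A => \tr (M A)).
Proof. by move=> pM; apply: polyfun_sum => i; exact: pM. Qed.

Definition coefpolyfun F : Prop := forall k, polyfun (fun A => (F A)`_k).

Lemma coefpolyfun_det n (M : 'M[R]_d -> 'M[{poly R}]_n) :
  (forall i j, coefpolyfun (fun A => M A i j)) -> coefpolyfun (fun A => \det (M A)).
Proof.
have cext F G : F =1 G -> coefpolyfun F -> coefpolyfun G.
  by move=> FG cF k; apply: polyfun_ext (cF k) => A; rewrite FG.
have ccst (p : {poly R}) : coefpolyfun (fun=> p) by move=> k; exact: polyfun_cst.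
have cM F G : coefpolyfun F -> coefpolyfun G -> coefpolyfun (fun A => F A * G A).
  move=> cF cG k.
  apply: (@polyfun_ext (fun A => \sum_(j < k.+1) (F A)`_j * (G A)`_(k - j))).
    by move=> A; rewrite coefM.
  by apply: polyfun_sum => j; apply: polyfunM.
move=> cMij; rewrite /determinant => k.
apply: (@polyfun_ext (fun A => \sum_(s : 'S_n) ((-1) ^+ s * \prod_i M A i (s i))`_k)).
  by move=> A; rewrite coef_sum.
apply: polyfun_sum => s; apply: (cM (fun=> (-1) ^+ s)) => // {k}.
elim: (index_enum _) => [|i r IH].
  by apply: cext (ccst 1) => A; rewrite big_nil.
by apply: cext (cM _ _ (cMij i (s i)) IH) => A; rewrite big_cons.
Qed.

Lemma coefpolyfun_char_poly n (M : 'M[R]_d -> 'M[R]_n) :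
  mxpolyfun M -> coefpolyfun (fun A => char_poly (M A)).
Proof.
move=> pM; apply: coefpolyfun_det => i j k.
apply: (@polyfun_ext (fun A => ('X *+ (i == j))`_k - (if k == 0%N then M A i j else 0))).
  by move=> A; rewrite !mxE coefB coefC.
apply: polyfunB; first exact: polyfun_cst.
by case: eqP => _; [exact: pM|exact: polyfun_cst].
Qed.

End PolynomialFunctions.

Section ZariskiDensity.
Context {R : realType} {d : nat}.

Lemma meval_homogZ n k (p : mpoly.mpoly n R) (v : 'I_n -> R) (c : R) :
  p \is mpoly.ishomog1 k mpoly.mdeg ->
  mpoly.meval (fun i => c * v i) p = c ^+ k * mpoly.meval v p.
Proof.
move=> /mpoly.dhomogP hp; rewrite !mpoly.mevalE mulr_sumr.
rewrite !big_seq; apply: eq_bigr => m /hp mk.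
rewrite mulrCA; congr (_ * _).
rewrite -[in RHS]mk /= mpoly.mdegE expr_sum -big_split /=.
by apply: eq_bigr => i _; rewrite exprMn.
Qed.

Lemma poly_eq0_of_zeros (p : {poly R}) : (forall c : R, c != 0 -> p.[c] = 0) -> p = 0.
Proof.
move=> pc; apply/eqP/contraT => p0.
pose rs : seq R := [seq (j.+1)%:R | j <- iota 0 (size p)].
have := @max_poly_roots _ p rs p0; rewrite size_map size_iota ltnn => -> //.
  by apply/allP => _ /mapP[j _ ->]; rewrite /root pc ?pnatr_eq0.
rewrite map_inj_uniq ?iota_uniq// => a b /eqP.
by rewrite eqr_nat => /eqP[].
Qed.

Lemma pgl_mx_pi (A : 'M[R]_d) : A \in unitmx ->
  exists (g : PGL R d) (c : R), c != 0 /\ pgl_mx g = c *: A.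
Proof.
move=> uA; have [c c0 cE] := repr_pgl (Sub A uA : GL R d).
by exists (\pi_(PGL R d) (Sub A uA))%qT, c.
Qed.

(** Closed sets are cut out by homogeneous polynomials, while [f] need not be homogeneous. But along
    the lifts [c *: pgl_mx g] it is a polynomial in [c] with infinitely many zeros, so each
    homogeneous component vanishes at [g]. *)
Lemma zariski_dense_polyfun (E : set (PGL R d)) (f : 'M[R]_d -> R) :
  zariski_dense E -> polyfun f ->
  (forall g c, E g -> c != 0 -> f (c *: pgl_mx g) = 0) ->
  forall A, A \in unitmx -> f A = 0.
Proof.
move=> dE [p pP] fE A uA.
pose ph k := mpoly.pihomog mpoly.mdeg k p.
pose N := mpoly.mmeasure mpoly.mdeg p.
have fsum (B : 'M[R]_d) (c : R) :
    f (c *: B) = \sum_(k < N) c ^+ k * mpoly.meval (fun j => mxvec B 0 j) (ph k).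
  rewrite pP {1}(mpoly.pihomog_partitionE (leqnn N)) raddf_sum.
  apply: eq_bigr => k _ /=; rewrite -(meval_homogZ _ _ (mpoly.pihomogP _ _ _)).
  by apply: mpoly.meval_eq => j; rewrite linearZ mxE.
pose Z : set (PGL R d) := [set g | forall q, (exists k, q = ph k) -> pgl_root q g].
have clZ : zariski_closed Z.
  exists [set q | exists k, q = ph k] => // q [k ->].
  by apply/mpoly.homogP; exists k; exact: mpoly.pihomogP.
have EZ : E `<=` Z.
  move=> g Eg _ [k ->]; rewrite /pgl_root.
  pose q := \poly_(j < N) mpoly.meval (fun i => mxvec (pgl_mx g) 0 i) (ph j).
  have q0 : q = 0.
    apply: poly_eq0_of_zeros => c c0; rewrite horner_poly -[RHS](fE g c Eg c0) fsum.
    by apply: eq_bigr => j _; rewrite mulrC.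
  (* [N] exceeds all the degrees occurring in [p], so components of degree at least [N] are zero. *)
  have [kN|Nk] := ltnP k N.
    by have := congr1 (fun r : {poly R} => r`_k) q0; rewrite coef0 coef_poly kN.
  suff -> : ph k = 0 by rewrite mpoly.meval0.
  rewrite /ph mpoly.pihomogE big_seq_cond big_pred0// => m.
  apply/negP => /andP[ms /eqP mk]; have := mpoly.mmeasure_mnm_lt mpoly.mdeg ms.
  by rewrite -/N /= mk ltnNge Nk.
have [g [c [c0 gE]]] := pgl_mx_pi uA.
have /(_ _ _)gZ : Z g by rewrite (dE Z clZ EZ).
have -> : A = c^-1 *: pgl_mx g by rewrite gE scalerA mulVf ?scale1r.
rewrite fsum big1// => k _; rewrite [mpoly.meval _ _](gZ (ph k)) ?mulr0//.
by exists k.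
Qed.

End ZariskiDensity.

(** * Detecting multiple eigenvalues *)

Section SimpleRoots.
Context {F : fieldType}.

(** The entries of the adjugate are, up to sign, minors of order [n - 1], larger than the rank. *)
Lemma adj_eq0 n (N : 'M[F]_n) : ((\rank N).+1 < n)%N -> \adj N = 0.
Proof.
move=> rN; apply/matrixP => i j; rewrite !mxE /cofactor.
suff -> : \det (row' j (col' i N)) = 0 by rewrite mulr0.
apply/eqP/contraT => dN.
have : row' j (col' i N) \in unitmx by rewrite unitmxE unitfE.
move=> /mxrank_unit rk.
have : (\rank (row' j (col' i N)) <= \rank N)%N.
  apply: (@leq_trans (\rank (col' i N))).
    by rewrite row'Esub; apply: mxrankS; exact: rowsub_sub.
  by rewrite -mxrank_tr tr_col' row'Esub -[leqRHS]mxrank_tr; apply: mxrankS; exact: rowsub_sub.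
have arith r m : (r.+1 < m)%N -> (m.-1 <= r)%N -> false.
  by case: m => // m; rewrite ltnS => rm /(leq_trans rm); rewrite ltnn.
by rewrite rk => /(arith _ _ rN).
Qed.

Lemma deriv_mulmx m n p (M : 'M[{poly F}]_(m, n)) (N : 'M[{poly F}]_(n, p)) :
  map_mx (@deriv F) (M *m N) = map_mx (@deriv F) M *m N + M *m map_mx (@deriv F) N.
Proof.
apply/matrixP => i j; rewrite !mxE raddf_sum -big_split /=.
by apply: eq_bigr => k _; rewrite derivM !mxE.
Qed.

Lemma eval_char_poly_mx n (B : 'M[F]_n) mu :
  map_mx (horner_eval mu) (char_poly_mx B) = mu%:M - B.
Proof.
apply/matrixP => i j; rewrite !mxE /horner_eval hornerD hornerN hornerC.
by rewrite hornerMn hornerX.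
Qed.

Lemma deriv_char_poly_mx n (B : 'M[F]_n) :
  map_mx (@deriv F) (char_poly_mx B) = 1%:M.
Proof.
by apply/matrixP => i j; rewrite !mxE derivB derivMn derivX derivC subr0.
Qed.

(* Differentiate (X - B) adj(X - B) = char_poly B at mu: a left eigenvector w
   satisfies w adj(mu - B) = p'(mu) w, while adj(mu - B) is either 0 or has
   columns proportional to c. *)
Lemma orthogonal_eigenvectors_root n (B : 'M[F]_n) mu (w : 'rV[F]_n) (c : 'cV[F]_n) :
  w != 0 -> c != 0 -> w *m B = mu *: w -> B *m c = mu *: c -> w *m c = 0 ->
  (char_poly B)^`().[mu] = 0.
Proof.
move=> w0 c0 wB Bc wc; set p := char_poly B.
pose N := mu%:M - B; pose Ad := \adj (char_poly_mx B).
pose Am := map_mx (horner_eval mu) Ad.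
have wN : w *m N = 0 by rewrite mulmxBr mul_mx_scalar wB subrr.
have Nc : N *m c = 0 by rewrite mulmxBl mul_scalar_mx Bc subrr.
have AdN : N *m Am = p.[mu]%:M.
  rewrite /N /Am -eval_char_poly_mx -map_mxM mul_mx_adj.
  by apply/matrixP => i j; rewrite !mxE rmorphMn /=.
have wAm : w *m Am = p^`().[mu] *: w.
  have := congr1 (map_mx (@deriv F)) (mul_mx_adj (char_poly_mx B)).
  rewrite deriv_mulmx deriv_char_poly_mx mul1mx => /(congr1 (map_mx (horner_eval mu))).
  rewrite map_mxD map_mxM eval_char_poly_mx -/N -/Ad -/Am => E.
  have := congr1 (mulmx w) E; rewrite mulmxDr mulmxA wN mul0mx addr0 => ->.
  have -> : map_mx (horner_eval mu) (map_mx (@deriv F) ((\det (char_poly_mx B))%:M : 'M[{poly F}]_n))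
      = (p^`().[mu])%:M.
    by apply/matrixP => i j; rewrite !mxE derivMn rmorphMn /=.
  by rewrite mul_mx_scalar.
have pmu : p.[mu] = 0.
  have := congr1 (mulmx w) AdN; rewrite mulmxA wN mul0mx mul_mx_scalar => /esym/eqP.
  by rewrite scaler_eq0 (negPf w0) orbF => /eqP.
have NAm : N *m Am = 0.
  by rewrite AdN pmu; apply/matrixP => i j; rewrite !mxE mul0rn.
suff wAm0 : w *m Am = 0.
  by move/eqP: wAm; rewrite wAm0 eq_sym scaler_eq0 (negPf w0) orbF => /eqP.
have AmE : Am = \adj N by rewrite /Am /Ad map_mx_adj eval_char_poly_mx.
have [rN|rN] := ltnP (\rank N).+1 n; first by rewrite AmE adj_eq0// mulmx0.
have rker : (\rank (kermx N^T) <= 1)%N.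
  by rewrite mxrank_ker mxrank_tr leq_subLR addn1.
have cker : (c^T <= kermx N^T)%MS by apply/sub_kermxP; rewrite -trmx_mul Nc trmx0.
have kerc : (kermx N^T <= c^T)%MS.
  rewrite -(mxrank_leqif_sup cker); apply/eqP; apply/anti_leq/andP; split.
    exact: mxrankS.
  by rewrite (leq_trans rker)// rank_rV -trmx0 (inj_eq trmx_inj) c0.
have /submxP[D DE] : (Am^T <= c^T)%MS.
  by apply: submx_trans kerc; apply/sub_kermxP; rewrite -trmx_mul NAm trmx0.
by rewrite -[Am]trmxK DE trmx_mul trmxK mulmxA wc mul0mx.
Qed.

End SimpleRoots.

Section DiscriminantMatrix.
Context {F : fieldType}.

Fixpoint mxpow n (B : 'M[F]_n) k : 'M[F]_n :=
  if k is k'.+1 then B *m mxpow B k' else 1%:M.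

(* The value at B of the derivative of its characteristic polynomial: singular
   iff B has a multiple eigenvalue. *)
Definition disc_mx n (B : 'M[F]_n) : 'M[F]_n :=
  \sum_(k < n) (char_poly B)^`()`_k *: mxpow B k.

Lemma mxpow_eigen n (B : 'M[F]_n) mu (w : 'rV[F]_n) k :
  w *m B = mu *: w -> w *m mxpow B k = mu ^+ k *: w.
Proof.
move=> wB; elim: k => [|k IH] /=; first by rewrite mulmx1 expr0 scale1r.
by rewrite mulmxA wB -scalemxAl IH scalerA exprS.
Qed.

Lemma size_deriv_char_poly n (B : 'M[F]_n) : (size (char_poly B)^`() <= n)%N.
Proof.
case: (eqVneq (char_poly B) 0) => [->|p0]; first by rewrite deriv0 size_poly0.
by have := lt_size_deriv p0; rewrite size_char_poly.
Qed.

Lemma disc_mx_eigen n (B : 'M[F]_n) mu (w : 'rV[F]_n) :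
  w *m B = mu *: w -> w *m disc_mx B = (char_poly B)^`().[mu] *: w.
Proof.
move=> wB; rewrite (horner_coef_wide mu (size_deriv_char_poly B)) mulmx_sumr.
rewrite scaler_suml; apply: eq_bigr => k _.
by rewrite -scalemxAr (mxpow_eigen _ wB) scalerA.
Qed.

Lemma disc_mx_singular n (B : 'M[F]_n) mu (w : 'rV[F]_n) :
  w != 0 -> w *m B = mu *: w -> (char_poly B)^`().[mu] = 0 -> \det (disc_mx B) = 0.
Proof.
move=> w0 wB p0; apply/eqP/contraT => dB.
have uB : disc_mx B \in unitmx by rewrite unitmxE unitfE.
have := disc_mx_eigen wB; rewrite p0 scale0r => /(congr1 (mulmx^~ (invmx (disc_mx B)))).
by rewrite mulmxK// mul0mx => wz; rewrite wz eqxx in w0.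
Qed.

Lemma mxpowE n (B : 'M[F]_n.+1) k : mxpow B k = B ^+ k.
Proof. by elim: k => [|k IH] //=; rewrite IH exprS. Qed.

(** Evaluate a Bezout relation [u p + v p' = 1] at [B]: by Cayley-Hamilton it reads
    [v(B) p'(B) = 1]. *)
Lemma disc_mx_unit n (B : 'M[F]_n) :
  separable_poly (char_poly B) -> \det (disc_mx B) != 0.
Proof.
case: n B => [|n] B sB; first by rewrite det_mx00 oner_neq0.
set p := char_poly B in sB *.
have dE : disc_mx B = horner_mx B p^`().
  have -> : p^`() = \sum_(k < n.+1) p^`()`_k *: 'X^k.
    rewrite -poly_def; apply/polyP => k; rewrite coef_poly; case: ltnP => // nk.
    by rewrite nth_default// (leq_trans (size_deriv_char_poly B)).
  rewrite linear_sum; apply: eq_bigr => k _.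
  rewrite linearZ /= rmorphXn /= horner_mx_X mxpowE; congr (_ *: _).
have /Bezout_eq1_coprimepP[[u v] /= uv] : coprimep p p^`().
  by move: sB; rewrite separable.separable_poly.unlock.
have := congr1 (horner_mx B) uv; rewrite rmorphD !rmorphM rmorph1 /=.
rewrite Cayley_Hamilton mulr0 add0r => hv.
have : \det (horner_mx B v) * \det (disc_mx B) = 1.
  by rewrite dE -det_mulmx [_ *m _]hv det1.
by move=> h; apply: contraTneq (oner_neq0 F) => d0; rewrite -h d0 mulr0 eqxx.
Qed.

End DiscriminantMatrix.

Section QuotientIntertwiner.
Context {F : fieldType}.

(** Apply the factors [AN - a] of the characteristic polynomial one after the other to a vector
    whose image by [X] is outside [Z]. By Cayley-Hamilton the end result is 0, so at some factor the
    image enters [Z]. *)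
Lemma eigenclass_exists r m (AN : 'M[F]_r) (X : 'M[F]_(r, m)) (Z : 'M[F]_m)
    (s : seq F) : char_poly AN = \prod_(a <- s) ('X - a%:P) -> ~~ (X <= Z)%MS ->
  exists a (u : 'rV[F]_r), [/\ root (char_poly AN) a, ~~ (u *m X <= Z)%MS &
    ((u *m AN - a *: u) *m X <= Z)%MS].
Proof.
case: r AN X => [|r] AN X; first by rewrite (flatmx0 X) sub0mx.
move=> pE /row_subPn[i]; rewrite rowE; set u0 := delta_mx 0 i => u0X.
pose step (u : 'rV[F]_r.+1) a := u *m AN - a *: u.
have foldE t u : foldl step u t = u *m horner_mx AN (\prod_(a <- t) ('X - a%:P)).
  elim: t u => [|a t IH] u /=; first by rewrite big_nil rmorph1 mulmx1.
  rewrite IH big_cons rmorphM /= -mulmxE mulmxA rmorphB /= horner_mx_X horner_mx_C.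
  by rewrite mulmxBr mul_mx_scalar.
have : foldl step u0 s = 0 by rewrite foldE -pE Cayley_Hamilton mulmx0.
have : {subset s <= root (char_poly AN)}.
  by move=> a sa; rewrite -[_ \in _]/(root _ a) pE root_prod_XsubC.
elim: s u0 u0X {pE} => [|a s IH] u uX /= sub.
  by move=> uz; move: uX; rewrite uz mul0mx sub0mx.
have [h _|h fs] := boolP (step u a *m X <= Z)%MS.
  by exists a, u; split=> //; apply: sub; rewrite mem_head.
by apply: IH h _ fs => b bs; apply: sub; rewrite inE bs orbT.
Qed.

Lemma root_char_poly_eigenvalue r (A : 'M[F]_r) a :
  root (char_poly A) a -> eigenvalue A a.
Proof.
case: r A => [|r] A; last by rewrite eigenvalue_root_char.
by rewrite /char_poly det_mx00 (negPf (root1 _)).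
Qed.

(** [N] acts on the quotient by [Z], and the class of [y] is a nonzero element of the kernel. The
    transposed action then has a kernel too, and [c] is an element of it seen as a form vanishing on
    [Z]. *)
Lemma quotient_left_kernel m (N Z : 'M[F]_m) (y : 'rV[F]_m) :
  (Z *m N <= Z)%MS -> ~~ (y <= Z)%MS -> (y *m N <= Z)%MS ->
  exists2 c : 'cV[F]_m, c != 0 & N *m c = 0 /\ Z *m c = 0.
Proof.
move=> ZN yZ yN; pose K := cokermx Z.
have ZK : Z *m K = 0 by exact: mulmx_coker.
have kerK (M : 'M[F]_m) : (Z + y <= kermx (N *m K))%MS.
  rewrite addsmx_sub; apply/andP; split; apply/sub_kermxP; rewrite mulmxA.
    by have /submxP[D ->] := ZN; rewrite -mulmxA ZK mulmx0.
  by have /submxP[D ->] := yN; rewrite -mulmxA ZK mulmx0.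
have rZy : (\rank Z < \rank (Z + y)%MS)%N.
  have ZsZy : (Z <= Z + y)%MS by exact: addsmxSl.
  rewrite ltn_neqAle mxrankS// andbT; apply: contra yZ => /eqP rE.
  have /eqmxP/eqmx_sym e : (Z == Z + y)%MS.
    by rewrite -(mxrank_leqif_eq ZsZy) rE.
  by rewrite -e addsmxSr.
have rNK : (\rank (N *m K) < \rank K)%N.
  have := leq_trans rZy (mxrankS (kerK 0)); rewrite mxrank_ker mxrank_coker.
  by move: (rank_leq_row (N *m K)) (rank_leq_row Z); lia.
have /row_subPn[i] : ~~ (kermx (N *m K)^T <= kermx K^T)%MS.
  apply/negP => /mxrankS; rewrite !mxrank_ker !mxrank_tr.
  by move: (rank_leq_row K) rNK; lia.
set e := row i _ => eK; have eN : e *m (N *m K)^T = 0.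
  by rewrite /e -row_mul mulmx_ker row0.
exists (K *m e^T).
  by apply: contra eK => /eqP Ke; apply/sub_kermxP; rewrite -[e]trmxK -trmx_mul Ke trmx0.
split; last by rewrite mulmxA ZK mul0mx.
by rewrite mulmxA -[LHS]trmxK trmx_mul trmxK eN trmx0.
Qed.

(* AN is the matrix of B on the row space V' of W, a stable subspace of Z, and X
   that of a nonzero map V' -> V / Z intertwining the actions of B: they share an
   eigenvalue. *)
Lemma quotient_intertwiner_disc r m (B Z : 'M[F]_m) (W X : 'M[F]_(r, m))
    (AN : 'M[F]_r) (s : seq F) :
  char_poly AN = \prod_(a <- s) ('X - a%:P) ->
  (Z *m B <= Z)%MS -> (W <= Z)%MS -> row_free W -> AN *m W = W *m B ->
  (AN *m X - X *m B <= Z)%MS -> ~~ (X <= Z)%MS -> \det (disc_mx B) = 0.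
Proof.
move=> pE ZB WZ fW AW AX XZ.
have [a [u [ra uX ua]]] := eigenclass_exists pE XZ.
have /eigenvalueP[v vA v0] := root_char_poly_eigenvalue ra.
pose w := v *m W.
have w0 : w != 0 by rewrite mulmx_free_eq0.
have wB : w *m B = a *: w by rewrite /w -mulmxA -AW mulmxA vA scalemxAl.
have wZ : (w <= Z)%MS by apply: submx_trans WZ; exact: submxMl.
have yN : (u *m X *m (B - a%:M) <= Z)%MS.
  rewrite mulmxBr mul_mx_scalar.
  have -> : u *m X *m B - a *: (u *m X) =
      (u *m AN - a *: u) *m X - u *m (AN *m X - X *m B).
    rewrite mulmxBr mulmxBl -scalemxAl !mulmxA opprB.
    by rewrite [RHS]addrC subrKA.
  by rewrite addmx_sub// eqmx_opp mulmx_sub.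
have ZN : (Z *m (B - a%:M) <= Z)%MS.
  by rewrite mulmxBr mul_mx_scalar addmx_sub// eqmx_opp scalemx_sub.
have [c c0 [Nc Zc]] := quotient_left_kernel ZN uX yN.
have Bc : B *m c = a *: c.
  by apply/eqP; rewrite -subr_eq0 -mul_scalar_mx -mulmxBl Nc.
(* [w] lies in [Z] and [c] vanishes on [Z]: a left and a right eigenvector for [a] are orthogonal,
   which makes [a] a multiple root. *)
have wc : w *m c = 0 by have /submxP[D ->] := wZ; rewrite -mulmxA Zc mulmx0.
exact: disc_mx_singular w0 wB (orthogonal_eigenvectors_root w0 c0 wB Bc wc).
Qed.

End QuotientIntertwiner.

Section SubspacePredicate.
Context {F : fieldType}.

(** Gives access to rank arguments for subspaces defined by estimates: [N] is a matrix of maximal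
    rank among those with rows in [S]. *)
Lemma subspace_mx n (S : 'rV[F]_n -> Prop) : S 0 ->
  (forall a u v, S u -> S v -> S (a *: u + v)) ->
  exists N : 'M[F]_n, forall u, S u <-> (u <= N)%MS.
Proof.
move=> S0 SL.
pose P (r : nat) := `[< exists N : 'M[F]_n, \rank N = r /\ forall i, S (row i N) >].
have exP : exists r, P r.
  by exists 0%N; apply/asboolP; exists 0; split=> [|i]; rewrite ?mxrank0 ?row0.
have bP r : P r -> (r <= n)%N.
  by move=> /asboolP[N [<- _]]; exact: rank_leq_row.
have [r /asboolP[N [rN SN]] rmax] := ex_maxnP exP bP.
have Ssub u : (u <= N)%MS -> S u.
  move=> /submxP[D ->]; rewrite mulmx_sum_row.
  elim/big_ind: _ => //[x y Sx Sy|i _].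
    by rewrite -[x]scale1r; exact: SL.
  by rewrite -[_ *: _]addr0; exact: SL.
exists N => u; split; last exact: Ssub.
move=> Su; apply/negPn/negP => uN.
have NsNu : (N <= N + u)%MS by exact: addsmxSl.
have : P (\rank (N + u)%MS).
  apply/asboolP; exists (N + u)%MS; split=> // i.
  have /sub_addsmxP[[D1 D2] /= ->] : (row i (N + u)%MS <= N + u)%MS by exact: row_sub.
  rewrite -[D1 *m N]scale1r; apply: (SL); first by apply: (Ssub); exact: submxMl.
  by rewrite [D2]mx11_scalar mul_scalar_mx -[_ *: _]addr0; exact: SL.
move=> /rmax; rewrite -rN => rle.
have /eqmxP/eqmx_sym e : (N == N + u)%MS.
  by rewrite -(mxrank_leqif_eq NsNu) eqn_leq rle mxrankS.
by move: uN; rewrite -e addsmxSr.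
Qed.

End SubspacePredicate.

Section MapDisc.
Context {F K : fieldType} (f : {rmorphism F -> K}).

Lemma map_mxpow n (B : 'M[F]_n) k : map_mx f (mxpow B k) = mxpow (map_mx f B) k.
Proof. by elim: k => [|k IH] /=; rewrite ?map_mx1// map_mxM IH. Qed.

Lemma map_disc_mx n (B : 'M[F]_n) : map_mx f (disc_mx B) = disc_mx (map_mx f B).
Proof.
rewrite /disc_mx raddf_sum; apply: eq_bigr => k _ /=.
by rewrite map_mxZ map_mxpow -map_char_poly deriv_map coef_map.
Qed.

End MapDisc.

Section FormAction.
Context {R : realType} {d : nat}.

Definition form_act (A b : 'M[R]_d) : 'M[R]_d := A^T *m b^T *m A.

Lemma form_act_is_linear A : linear (form_act A).
Proof.
move=> a b c; rewrite /form_act linearP mulmxDr mulmxDl.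
by rewrite -scalemxAr -scalemxAl.
Qed.

HB.instance Definition _ A := GRing.isLinear.Build R 'M[R]_d 'M[R]_d *:%R
  (form_act A) (form_act_is_linear A).

(* The transposition in form_act makes the generic spectrum simple: for A with
   eigenvalues a_i it consists of the a_i ^+ 2 and of the +/- a_i a_j, i < j. *)
Definition form_disc (A : 'M[R]_d) : R := \det (disc_mx (lin_mx (form_act A))).

Lemma form_disc_polyfun : polyfun form_disc.
Proof.
have pL : mxpolyfun (fun A => lin_mx (form_act A)).
  move=> k l; case/mxvec_indexP: l => a b.
  pose M := vec_mx (delta_mx 0 k) : 'M[R]_d.
  apply: (@polyfun_ext _ _ (fun A => (A^T *m M^T *m A) a b)).
    by move=> A; rewrite [RHS]mxE /= mxvecE.
  apply: mxpolyfunM (mxpolyfun_id) _ _ => //.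
  apply: mxpolyfunM (mxpolyfun_tr mxpolyfun_id) (mxpolyfun_cst _).
apply: polyfun_det; apply: mxpolyfun_sum => k; apply: mxpolyfunZ.
  apply: (@polyfun_ext _ _ (fun A => \sum_(j < k.+1)
    (char_poly (lin_mx (form_act A)))`_k.+1)).
    by move=> A; rewrite coef_deriv sumr_const card_ord.
  by apply: polyfun_sum => j; exact: coefpolyfun_char_poly.
elim: {k}(nat_of_ord k) => [|k IH] /=; first exact: mxpolyfun_cst.
exact: mxpolyfunM.
Qed.

End FormAction.

Section EigenvectorExpansion.
Context {R : realType} {d : nat} (C : set 'cV[R]_d) (v : 'cV[R]_d).
Implicit Types (l : 'rV[R]_d) (b : 'M[R]_d).

(** [expands 0 b] says that [b] is negligible along the cone; the quadratic part of [l] is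
    determined only modulo such forms. *)
Definition expands l b : Prop := forall e : R, 0 < e -> exists2 dl : R, 0 < dl &
  forall w, C w -> `|w - v| < dl -> `|pair l w - quad b (w - v)| <= e * `|w - v| ^+ 2.

Lemma quadD b b' u : quad (b + b') u = quad b u + quad b' u.
Proof. by rewrite /quad mulmxDr mulmxDl mxE. Qed.

Lemma quadZ a b (u : 'cV[R]_d) : quad (a *: b) u = a * quad b u.
Proof. by rewrite /quad -scalemxAr -scalemxAl mxE. Qed.

Lemma quad0 (u : 'cV[R]_d) : quad 0 u = 0.
Proof. by rewrite /quad mulmx0 mul0mx mxE. Qed.

Lemma quad_scale b a (u : 'cV[R]_d) : quad b (a *: u) = a ^+ 2 * quad b u.
Proof.
rewrite /quad [(a *: u)^T]linearZ /= -scalemxAr -!scalemxAl scalerA mxE expr2.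
by [].
Qed.

Lemma quad_tr b (u : 'cV[R]_d) : quad b^T u = quad b u.
Proof.
have -> : quad b u = (u^T *m b *m u)^T 0 0 by rewrite [RHS]mxE.
by rewrite /quad !trmx_mul trmxK mulmxA.
Qed.

Lemma quad_form_act A b (u : 'cV[R]_d) : quad (form_act A b) u = quad b (A *m u).
Proof. by rewrite -(quad_tr b) /quad /form_act trmx_mul !mulmxA. Qed.

Lemma expands_lin a l l' b b' : expands l b -> expands l' b' ->
  expands (a *: l + l') (a *: b + b').
Proof.
move=> lb lb' e e0.
have e1 : 0 < e / 2 / (`|a| + 1) by rewrite !divr_gt0// ltr_pwDr.
have e2 : 0 < e / 2 by rewrite divr_gt0.
have [d1 d10 d1P] := lb _ e1; have [d2 d20 d2P] := lb' _ e2.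
exists (Num.min d1 d2) => [|w Cw]; first by rewrite lt_min d10.
rewrite lt_min => /andP[/(d1P _ Cw) h1 /(d2P _ Cw) h2].
rewrite pairDl pairZl quadD quadZ.
have -> : a * pair l w + pair l' w - (a * quad b (w - v) + quad b' (w - v)) =
  a * (pair l w - quad b (w - v)) + (pair l' w - quad b' (w - v)) by ring.
rewrite (le_trans (ler_normD _ _))// [e]splitr mulrDl lerD// normrM.
have a1 : 0 < `|a| + 1 by rewrite ltr_pwDr.
apply: (@le_trans _ _ ((`|a| + 1) * (e / 2 / (`|a| + 1) * `|w - v| ^+ 2))).
  by rewrite ler_pM// lerDl.
by rewrite mulrA [(`|a| + 1) * _]mulrC divfK ?gt_eqF.
Qed.

Lemma expands0 : expands 0 0.
Proof.
move=> e e0; exists 1 => // w _ _.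
by rewrite /pair /quad mul0mx mulmx0 mul0mx !mxE subrr normr0 mulr_ge0 ?exprn_ge0// ltW.
Qed.

Lemma expands_conormal2 l : expands l 0 <-> conormal 2 C v l.
Proof.
by split=> h e /h[dl dl0 dlP]; exists dl => // w Cw wd;
  have := dlP _ Cw wd; rewrite quad0 subr0.
Qed.

Lemma null_conormal2 l b : expands 0 b -> expands l b -> conormal 2 C v l.
Proof.
move=> b0 lb; apply/expands_conormal2; have := expands_lin (-1) b0 lb.
by rewrite scaler0 add0r scaleN1r addNr.
Qed.

Lemma conormal_lin a l l' : conormal 1 C v l -> conormal 1 C v l' ->
  conormal 1 C v (a *: l + l').
Proof.
move=> lb lb' e e0.
have e1 : 0 < e / 2 / (`|a| + 1) by rewrite !divr_gt0// ltr_pwDr.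
have e2 : 0 < e / 2 by rewrite divr_gt0.
have [d1 d10 d1P] := lb _ e1; have [d2 d20 d2P] := lb' _ e2.
exists (Num.min d1 d2) => [|w Cw]; first by rewrite lt_min d10.
rewrite lt_min => /andP[/(d1P _ Cw) h1 /(d2P _ Cw) h2].
rewrite pairDl pairZl (le_trans (ler_normD _ _))// [e]splitr mulrDl lerD// normrM.
have a1 : 0 < `|a| + 1 by rewrite ltr_pwDr.
apply: (@le_trans _ _ ((`|a| + 1) * (e / 2 / (`|a| + 1) * `|w - v| ^+ 1))).
  by rewrite ler_pM// lerDl.
by rewrite mulrA [(`|a| + 1) * _]mulrC divfK ?gt_eqF.
Qed.

Lemma conormal_0 m : conormal m C v 0.
Proof.
move=> e e0; exists 1 => // w _ _.
by rewrite /pair mul0mx mxE normr0 mulr_ge0 ?exprn_ge0// ltW.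
Qed.

Lemma conormal_at m l : C v -> conormal m.+1 C v l -> pair l v = 0.
Proof.
move=> Cv lc; apply: (@norm_small0 R _ 0) => e e0; have [dl dl0 dlP] := lc e e0.
by have := dlP v Cv; rewrite subrr normr0 expr0n mulr0; apply.
Qed.

Context (A : 'M[R]_d) (lam : R) (phi : 'rV[R]_d).
Context (Cv : C v) (lam0 : lam != 0) (Av : A *m v = lam *: v).
Context (CA : forall w, C w -> C (lam^-1 *: (A *m w))).
Context (phiA : phi *m A = lam *: phi) (phi0 : phi != 0).
Local Notation act w := (lam^-1 *: (A *m w)).

Lemma act_sub w : act w - v = lam^-1 *: (A *m (w - v)).
Proof. by rewrite mulmxBr Av scalerBr scalerA mulVf// scale1r. Qed.

Lemma act_bound : exists2 K : R, 0 < K & forall w, `|act w - v| <= K * `|w - v|.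
Proof.
exists (1 + `|lam^-1| * (d%:R * `|A|)) => [|w]; first by rewrite ltr_wpDr ?mulr_ge0.
rewrite act_sub normrZ (le_trans (ler_wpM2l _ (mulmx_norm_le _ _)))//.
by rewrite mulrDl mul1r ler_wpDl// -!mulrA.
Qed.

(** Origin of the factor [lam] in the action on conormals: the resulting [lam ^+ 2] compensates the
    [lam^-1] inside a quadratic part, so that [expands_act] involves [form_act A] itself. *)
Lemma pair_act l w : pair (lam *: (l *m A)) w = lam ^+ 2 * pair l (act w).
Proof.
rewrite pairZl pairZ mulrA expr2 mulfK// /pair mulmxA.
by [].
Qed.

Lemma conormal_act l : conormal 1 C v l -> conormal 1 C v (lam *: (l *m A)).
Proof.
move=> lc e e0; have [K K0 KP] := act_bound.
have l2 : 0 < lam ^+ 2 * K by rewrite mulr_gt0// exprn_even_gt0.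
have [dl dl0 dlP] := lc _ (divr_gt0 e0 l2).
exists (dl / K) => [|w Cw]; first exact: divr_gt0.
rewrite ltr_pdivlMr// mulrC => wd.
have := dlP _ (CA Cw) (le_lt_trans (KP w) wd); rewrite !expr1 => h.
rewrite pair_act normrM normrX real_normK ?num_real//.
rewrite (le_trans (ler_wpM2l _ h)) ?sqr_ge0//.
rewrite (le_trans (ler_wpM2l _ (ler_wpM2l _ (KP w)))) ?sqr_ge0 ?divr_ge0 ?(ltW e0) ?(ltW l2)//.
rewrite le_eqVlt; apply/orP; left; apply/eqP.
move: (`|w - v|) => r; field.
by rewrite lam0 gt_eqF.
Qed.

Lemma expands_act l b : expands l b -> expands (lam *: (l *m A)) (form_act A b).
Proof.
move=> lc e e0; have [K K0 KP] := act_bound.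
have l2 : 0 < lam ^+ 2 * K ^+ 2.
  by rewrite -exprMn exprn_even_gt0//= mulf_neq0// gt_eqF.
have [dl dl0 dlP] := lc _ (divr_gt0 e0 l2).
exists (dl / K) => [|w Cw]; first exact: divr_gt0.
rewrite ltr_pdivlMr// mulrC => wd.
have := dlP _ (CA Cw) (le_lt_trans (KP w) wd) => h.
have qE : quad (form_act A b) (w - v) = lam ^+ 2 * quad b (act w - v).
  by rewrite quad_form_act act_sub quad_scale mulrA -exprMn mulfV// expr1n mul1r.
rewrite pair_act qE -mulrBr normrM normrX real_normK ?num_real//.
rewrite (le_trans (ler_wpM2l _ h)) ?sqr_ge0//.
have h2 : `|act w - v| ^+ 2 <= (K * `|w - v|) ^+ 2.
  by rewrite lerXn2r ?nnegrE// mulr_ge0// ltW.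
rewrite (le_trans (ler_wpM2l _ (ler_wpM2l _ h2))) ?sqr_ge0 ?divr_ge0 ?(ltW e0) ?(ltW l2)//.
rewrite le_eqVlt; apply/orP; left; apply/eqP.
move: (`|w - v|) => r; field.
by rewrite lam0 gt_eqF.
Qed.

Definition sym_form l : 'M[R]_d := phi^T *m l + l^T *m phi.

Lemma sym_form_is_linear : linear sym_form.
Proof.
move=> a l l'; rewrite /sym_form [(a *: l + l')^T]linearP /= mulmxDl mulmxDr.
rewrite -scalemxAr -scalemxAl.
by rewrite scalerDr addrACA.
Qed.

HB.instance Definition _ := GRing.isLinear.Build R 'rV[R]_d 'M[R]_d *:%R
  sym_form sym_form_is_linear.

Lemma quad_sym_form l u : quad (sym_form l) u = 2 * (pair phi u * pair l u).
Proof.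
rewrite /sym_form quadD.
have q1 l1 l2 : quad (l1^T *m l2) u = pair l1 u * pair l2 u.
  rewrite /quad mulmxA -trmx_mul -mulmxA mxE big_ord1 mxE.
  by [].
by rewrite !q1 [pair l u * _]mulrC mulr_natl mulr2n.
Qed.

(** Of the two factors of the product at [w - v], one is O(|w - v|) and the other, equal to
    [pair l w] as [l] kills [v], is o(|w - v|). *)
Lemma sym_form_null l : conormal 1 C v l -> expands 0 (sym_form l).
Proof.
move=> lc e e0; have [K K0 KP] := pair_bounded phi.
have K20 : 0 < 2 * K by rewrite mulr_gt0.
have [dl dl0 dlP] := lc _ (divr_gt0 e0 K20).
exists dl => // w Cw wd; have := dlP w Cw wd; rewrite expr1 => h.
have -> : pair 0 w = 0 by rewrite /pair mul0mx mxE.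
rewrite sub0r normrN quad_sym_form [pair l (w - v)]pairB (conormal_at Cv lc).
rewrite subr0 !normrM ger0_norm//.
apply: (@le_trans _ _ (2 * ((K * `|w - v|) * (e / (2 * K) * `|w - v|)))).
  by rewrite ler_wpM2l// ler_pM.
rewrite le_eqVlt; apply/orP; left; apply/eqP.
move: (`|w - v|) => r; field.
by rewrite gt_eqF.
Qed.

(** [A] acts on both factors and [phi] contributes [lam]; the transposition in [form_act] only
    exchanges the two terms of the symmetric form. *)
Lemma sym_form_act l : form_act A (sym_form l) = sym_form (lam *: (l *m A)).
Proof.
have E (x y : 'rV[R]_d) : A^T *m (x^T *m y) *m A = (x *m A)^T *m (y *m A).
  by rewrite trmx_mul !mulmxA.
have Z c (x : 'rV[R]_d) : (c *: x)^T = c *: x^T by rewrite linearZ.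
rewrite /form_act /sym_form [(_ + _)^T]linearD /= !trmx_mul !trmxK mulmxDr mulmxDl.
by rewrite !E phiA !Z -!scalemxAr -!scalemxAl addrC.
Qed.

Lemma sym_form_inj l : sym_form l = 0 -> l = 0.
Proof.
move=> sl; have E (a b : 'I_d) : phi 0 a * l 0 b + l 0 a * phi 0 b = 0.
  by have /matrixP/(_ a b) := sl; rewrite !mxE !big_ord1 !mxE.
have /rV0Pn[a pa] := phi0.
have la : l 0 a = 0.
  have /eqP := E a a; rewrite mulrC -mulrDl -mulr2n mulf_eq0 (negPf pa) orbF.
  by rewrite mulrn_eq0 /= => /eqP.
apply/rowP => b; rewrite mxE; have /eqP := E a b.
by rewrite la mul0r addr0 mulf_eq0 (negPf pa) /= => /eqP.
Qed.

Lemma eigenvector_flat : (forall l, conormal 1 C v l -> exists b, expands l b) ->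
  form_disc A != 0 -> flat_at C v.
Proof.
move=> hE dA l0 l01; apply: contrapT => l02.
have [N NP] := subspace_mx (conormal_0 1) conormal_lin.
have [Z ZP] : exists Z : 'M[R]_(d * d), forall x, expands 0 (vec_mx x) <-> (x <= Z)%MS.
  apply: subspace_mx; first by rewrite linear0; exact: expands0.
  move=> a x y ex ey; rewrite linearP; have := expands_lin a ex ey.
  by rewrite scaler0 addr0.
(* A basis of the conormals: one quadratic part chosen per row defines [X] by linearity, and
   freeness makes the map l |-> phi l, in the form of [W], injective. *)
have [r [N1 [N1f NE]]] : exists r (N1 : 'M[R]_(r, d)), row_free N1 /\ (N1 :=: N)%MS.
  by exists (\rank N), (row_base N); split; [exact: row_base_free|exact: eq_row_base].
have N1c i : conormal 1 C v (row i N1) by apply/NP; rewrite -NE row_sub.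
have /choice[b bP] : forall i, exists b, expands (row i N1) b by move=> i; apply: hE.
pose B := lin_mx (form_act A).
have BE x : x *m B = mxvec (form_act A (vec_mx x)) by rewrite -mul_vec_lin vec_mxK.
have N1A : (lam *: (N1 *m A) <= N1)%MS.
  apply/row_subP => i; rewrite NE; apply/NP.
  have -> : row i (lam *: (N1 *m A)) = lam *: (row i N1 *m A).
    by rewrite linearZ /= row_mul.
  exact: conormal_act.
pose AN := lam *: (N1 *m A) *m pinvmx N1.
have ANE : AN *m N1 = lam *: (N1 *m A) by rewrite /AN mulmxKpV.
pose sm l := mxvec (sym_form l).
have sml : linear sm by move=> a x y; rewrite /sm !linearP.
pose smM := GRing.isLinear.Build R _ _ *:%R sm sml.
pose smL : {linear 'rV[R]_d -> 'rV[R]_(d * d)} := HB.pack sm smM.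
pose Sm := lin1_mx smL.
have SmE l : l *m Sm = mxvec (sym_form l) by rewrite mul_rV_lin1.
pose W := N1 *m Sm.
pose X := \matrix_i mxvec (b i).
have fW : row_free W.
  rewrite -kermx_eq0; apply/rowV0P => u /sub_kermxP; rewrite mulmxA SmE => /eqP.
  rewrite mxvec_eq0 => /eqP /sym_form_inj /eqP.
  by rewrite mulmx_free_eq0// => /eqP.
have WZ : (W <= Z)%MS.
  apply/row_subP => i; rewrite row_mul SmE; apply/ZP; rewrite mxvecK.
  exact: sym_form_null.
have ZB : (Z *m B <= Z)%MS.
  apply/row_subP => i; rewrite row_mul BE; apply/ZP; rewrite mxvecK.
  have /ZP/expands_act : (row i Z <= Z)%MS by exact: row_sub.
  by rewrite mul0mx scaler0.
have AW : AN *m W = W *m B.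
  have -> : AN *m W = (lam *: (N1 *m A)) *m Sm by rewrite mulmxA ANE.
  apply/row_matrixP => i; rewrite [LHS]row_mul [RHS]row_mul BE row_mul !SmE mxvecK.
  by rewrite sym_form_act linearZ /= row_mul.
have sumP (D : 'rV[R]_r) : expands (D *m N1) (vec_mx (D *m X)).
  rewrite !mulmx_sum_row linear_sum /=.
  elim/big_rec2: _ => [|i bb l _ ih]; first exact: expands0.
  by rewrite linearZ /= rowK mxvecK; exact: expands_lin.
(* The same conormal is expanded twice, by transport under [A] and as a combination of the basis;
   the two quadratic parts differ by a negligible form. *)
have AX : (AN *m X - X *m B <= Z)%MS.
  apply/row_subP => i; apply/ZP.
  have e1 := expands_act (bP i).
  have e2 : expands (lam *: (row i N1 *m A)) (vec_mx (row i AN *m X)).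
    have -> : lam *: (row i N1 *m A) = row i AN *m N1.
      by rewrite -[RHS]row_mul ANE [RHS]linearZ /= row_mul.
    exact: sumP.
  have := expands_lin (-1) e1 e2; rewrite scaleN1r addNr => h.
  have -> : vec_mx (row i (AN *m X - X *m B)) =
      -1 *: form_act A (b i) + vec_mx (row i AN *m X).
    rewrite linearB linearB /= !row_mul BE mxvecK rowK mxvecK scaleN1r addrC.
    by [].
  exact: h.
have XZ : ~~ (X <= Z)%MS.
  apply/negP => XZ; apply: l02.
  have /NP : conormal 1 C v l0 := l01.
  rewrite -NE => /submxP[D DE].
  apply: (@null_conormal2 _ (vec_mx (D *m X))); last by rewrite DE; exact: sumP.
  by apply/ZP; exact: mulmx_sub.
(* Over the complex numbers the characteristic polynomial of [AN] splits, while inclusions and ranks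
   are unchanged. *)
pose f := complex.real_complex R.
have [s sE] := closed_field_poly_normal (char_poly (map_mx f AN)).
have mE : char_poly (map_mx f AN) = \prod_(z <- s) ('X - z%:P).
  by rewrite [LHS]sE (monicP (char_poly_monic _)) scale1r.
have : \det (disc_mx (map_mx f B)) = 0.
  apply: (@quotient_intertwiner_disc _ _ _ (map_mx f B) (map_mx f Z) (map_mx f W)
    (map_mx f X) (map_mx f AN) s) => //.
  - by rewrite -map_mxM map_submx.
  - by rewrite map_submx.
  - by rewrite row_free_map.
  - by rewrite -!map_mxM AW.
  - by rewrite -!map_mxM -map_mxB map_submx.
  - by rewrite map_submx.
rewrite -map_disc_mx det_map_mx => /eqP; rewrite fmorph_eq0.
by rewrite -[\det _]/(form_disc A) (negPf dA).
Qed.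

End EigenvectorExpansion.

(** * A diagonal matrix avoiding the algebraic conditions *)

Section GenericDiagonal.
Context {R : realType}.

(** The largest exponent is determined first: if [a <= b < e], then [2^a + 2^b <= 2^e], which is
    less than any [2^c + 2^e]. *)
Lemma pow2_sum_inj i j k l : (i <= j)%N -> (k <= l)%N ->
  (2 ^ i + 2 ^ j = 2 ^ k + 2 ^ l)%N -> i = k /\ j = l.
Proof.
have lt a b c e : (a <= b)%N -> (b < e)%N -> (2 ^ a + 2 ^ b <> 2 ^ c + 2 ^ e)%N.
  move=> ab be E.
  have h1 : (2 ^ a <= 2 ^ b)%N by rewrite leq_exp2l.
  have h2 : (2 ^ b.+1 <= 2 ^ e)%N by rewrite leq_exp2l.
  have h3 : (0 < 2 ^ c)%N by rewrite expn_gt0.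
  by move: E h1 h2 h3; rewrite expnS; lia.
move=> ij kl E; have jl : j = l.
  by case: (ltngtP j l) => // h; [case: (lt _ _ _ _ ij h E)|case: (lt _ _ _ _ kl h (esym E))].
split=> //; move: E; rewrite jl => /addIn /eqP.
by rewrite eqn_exp2l// => /eqP.
Qed.

Lemma eigenvector_root (F : fieldType) n (B : 'M[F]_n) mu (w : 'rV[F]_n) :
  w != 0 -> w *m B = mu *: w -> root (char_poly B) mu.
Proof.
case: n B w => [|n] B w w0 wB; first by rewrite (thinmx0 w) eqxx in w0.
by rewrite -eigenvalue_root_char; apply/eigenvalueP; exists w.
Qed.

Context (d : nat) (t : R) (t1 : 1 < t).
Let t0 : 0 < t := lt_trans ltr01 t1.

Definition pow2_diag : 'M[R]_d := diag_mx (\row_i t ^+ (2 ^ i)).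

(** Ordered pairs index the eigenvalues of [form_act]: those with [i <= j] the symmetric
    combinations of elementary matrices, the others the antisymmetric ones. *)
Definition pow2_sign (x : 'I_d * 'I_d) : R := if (x.1 <= x.2)%N then 1 else -1.

Definition pow2_root (x : 'I_d * 'I_d) : R := pow2_sign x * t ^+ (2 ^ x.1 + 2 ^ x.2).

Lemma pow2_root_inj : injective pow2_root.
Proof.
have norm x : `|pow2_root x| = t ^+ (2 ^ x.1 + 2 ^ x.2).
  rewrite normrM normrX (gtr0_norm t0) /pow2_sign.
  by case: ifP; rewrite ?normrN normr1 mul1r.
move=> [i j] [k l] E.
have /(ieexprIn t0) /= E2 : t ^+ (2 ^ i + 2 ^ j) = t ^+ (2 ^ k + 2 ^ l).
  by have := congr1 Num.norm E; rewrite !norm.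
have {}E2 : (2 ^ i + 2 ^ j = 2 ^ k + 2 ^ l)%N by apply: E2; rewrite gt_eqF.
move: E; rewrite /pow2_root /pow2_sign /= E2.
have tk : t ^+ (2 ^ k + 2 ^ l) != 0 by rewrite expf_neq0// gt_eqF.
move=> /(mulIf tk); have m1 : (1 : R) != -1 by rewrite -subr_eq0 opprK -mulr2n pnatr_eq0.
case: (leqP i j) => ij; case: (leqP k l) => kl.
- by have [/val_inj -> /val_inj ->] := pow2_sum_inj ij kl E2.
- by move=> /eqP; rewrite (negPf m1).
- by move=> /esym/eqP; rewrite (negPf m1).
- rewrite addnC [RHS]addnC in E2.
  by have [/val_inj -> /val_inj ->] := pow2_sum_inj (ltnW ij) (ltnW kl) E2.
Qed.

Lemma form_act_delta i j : form_act pow2_diag (delta_mx i j) =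
  t ^+ (2 ^ i + 2 ^ j) *: delta_mx j i.
Proof.
apply/matrixP => a b; rewrite /form_act /pow2_diag tr_diag_mx trmx_delta.
rewrite mul_mx_diag mul_diag_mx !mxE exprD.
case: eqVneq => [->|_] /=; last by rewrite !(mulr0, mul0r).
case: eqVneq => [->|_] /=; last by rewrite !(mulr0, mul0r).
by rewrite !mulr1 mulrC.
Qed.

Lemma pow2_root_char_poly x : root (char_poly (lin_mx (form_act pow2_diag))) (pow2_root x).
Proof.
case: x => i j; pose s := pow2_sign (i, j).
have s2 : s * s = 1 by rewrite /s /pow2_sign; case: ifP; rewrite ?mulrNN mulr1.
pose b : 'M[R]_d := delta_mx i j + s *: delta_mx j i.
apply: (@eigenvector_root _ _ _ _ (mxvec b)).
  rewrite mxvec_eq0; apply/eqP => /matrixP/(_ i j); rewrite !mxE !eqxx /=.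
  have [ij|ij] := eqVneq i j; last by rewrite /= mulr0 addr0 => /eqP; rewrite oner_eq0.
  rewrite /s /pow2_sign /= ij leqnn mulr1 => /eqP.
  by rewrite -mulr2n pnatr_eq0.
rewrite mul_vec_lin /= linearD linearZ /= !form_act_delta.
rewrite -[RHS]linearZ; congr (mxvec _); rewrite /b scalerDr !scalerA /pow2_root -/s.
rewrite [(2 ^ j + 2 ^ i)%N]addnC /= [s * _ * s]mulrAC s2 mul1r addrC.
by [].
Qed.

Lemma form_disc_diag : form_disc pow2_diag != 0.
Proof.
apply: disc_mx_unit; set p := char_poly _.
pose rs := [seq pow2_root x | x <- enum [set: 'I_d * 'I_d]%SET].
have urs : uniq rs by rewrite map_inj_uniq ?enum_uniq//; exact: pow2_root_inj.
have srs : size p = (size rs).+1.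
  by rewrite size_char_poly size_map -cardE cardsT card_prod card_ord.
rewrite (all_roots_prod_XsubC srs _ _).
- by rewrite (monicP (char_poly_monic _)) scale1r separable_prod_XsubC.
- by apply/allP => _ /mapP[x _ ->]; exact: pow2_root_char_poly.
- by rewrite uniq_rootsE.
Qed.

(** The determinant is [t ^ (2^d - 1)], while the trace is at least [t ^ (2^(d-1))], whose power [d]
    is at least [t ^ (2^d)] as [d >= 2]. *)
Lemma trace_det_diag (c : R) : (1 < d)%N -> c < t ->
  c * \det pow2_diag < \tr pow2_diag ^+ d.
Proof.
move=> d1 ct; have d0 : (0 < d)%N by exact: ltn_trans d1.
have dE : \det pow2_diag = t ^+ (\sum_(i < d) 2 ^ i).
  by rewrite det_diag expr_sum; apply: eq_bigr => i _; rewrite mxE.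
have tp k : 0 < t ^+ k by rewrite exprn_gt0.
have trE : t ^+ (2 ^ d.-1) <= \tr pow2_diag.
  have dd : (d.-1 < d)%N by rewrite prednK.
  rewrite mxtrace_diag (bigD1 (Ordinal dd))//= mxE lerDl sumr_ge0// => i _.
  by rewrite mxE ltW.
have sE : (\sum_(i < d) 2 ^ i).+1 = (2 ^ d)%N.
  elim: {d1 ct d0 dE trE}(d) => [|k IH]; first by rewrite big_ord0.
  rewrite big_ord_recr /= expnS; move: IH.
  by move: (\sum_(i < k) 2 ^ i)%N (2 ^ k)%N => S T; lia.
apply: (@lt_le_trans _ _ (t ^+ (\sum_(i < d) 2 ^ i).+1)).
  by rewrite dE exprS ltr_pM2r.
apply: le_trans (_ : (t ^+ (2 ^ d.-1)) ^+ d <= _); last first.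
  by rewrite lerXn2r// nnegrE ltW// (lt_le_trans _ trE).
rewrite sE -exprM ler_eXn2l// -[X in (2 ^ X)%N](prednK d0) expnS mulnC.
by rewrite leq_mul2l d1 orbT.
Qed.

Lemma pow2_diag_unit : pow2_diag \in unitmx.
Proof.
rewrite unitmxE unitfE det_diag; apply/prodf_neq0 => i _.
by rewrite mxE expf_neq0// gt_eqF.
Qed.

End GenericDiagonal.

(** In [long_element], [s] lists the values of tr^d / det on the finitely many conjugacy classes to
    be avoided. *)
Lemma generic_matrix (R : realType) d (s : seq R) : (1 < d)%N ->
  exists A : 'M[R]_d, [/\ A \in unitmx, form_disc A != 0 &
    forall c, c \in s -> \tr A ^+ d != c * \det A].
Proof.
move=> d1; pose t : R := 2 + \sum_(c <- s) `|c|.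
have t1 : 1 < t by rewrite ltr_wpDr ?sumr_ge0// ltr1n.
exists (pow2_diag d t); split.
- exact: pow2_diag_unit.
- exact: form_disc_diag.
- move=> c cs; rewrite gt_eqF// trace_det_diag//.
  rewrite (le_lt_trans (ler_norm c))// /t (big_rem c)//=.
  have : 0 <= \sum_(y <- rem c s) `|y| by rewrite sumr_ge0.
  by lra.
Qed.

(** * Proximal matrices *)

Section LinearRecurrence.
Context {R : realType}.

Definition vanishes (x : nat -> R) : Prop :=
  forall e : R, 0 < e -> exists N : nat, forall k, (N <= k)%N -> x k <= e.

(** Once [y] stays below [(1 - rho) * (e / 2)], the excess of [x] over [e / 2] is multiplied by at
    most [rho] at each step. *)
Lemma vanishes_contraction (x y : nat -> R) (rho : R) :
  0 <= rho -> rho < 1 -> (forall k, 0 <= x k) ->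
  (forall k, x k.+1 <= rho * x k + y k) -> vanishes y -> vanishes x.
Proof.
move=> r0 r1 x0 xy vy e e0.
have s0 : 0 < (1 - rho) * (e / 2) by rewrite mulr_gt0 ?divr_gt0// subr_gt0.
have [N NP] := vy _ s0.
have step j : x (N + j)%N <= rho ^+ j * x N + e / 2.
  elim: j => [|j IH]; first by rewrite addn0 expr0 mul1r lerDl divr_ge0// ltW.
  rewrite addnS (le_trans (xy _))// (le_trans (lerD (ler_wpM2l r0 IH) (NP _ (leq_addr _ _))))//.
  by rewrite exprS; lra.
have [M MP] : exists M : nat, forall j, (M <= j)%N -> rho ^+ j * x N <= e / 2.
  have xN : 0 < x N + 1 by rewrite ltr_wpDl.
  have cv : (fun j => rho ^+ j) @ \oo --> (0 : R).
    by apply: cvg_expr; rewrite ger0_norm.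
  have /cvgrPdist_le/(_ _ (divr_gt0 (divr_gt0 e0 (ltr0n _ 2)) xN)) [M _ MP] := cv.
  exists M => j /MP /=; rewrite sub0r normrN ger0_norm ?exprn_ge0// => h.
  rewrite (le_trans (ler_wpM2r (x0 N) h))// mulrAC ler_pdivrMr//.
  by rewrite ler_wpM2l ?divr_ge0 ?(ltW e0)// lerDl.
exists (N + M)%N => k Nk; have -> : k = (N + (k - N))%N.
  by rewrite subnKC// (leq_trans _ Nk)// leq_addr.
rewrite (le_trans (step _))// [leRHS]splitr lerD2r MP//.
by rewrite leq_subRL// (leq_trans _ Nk)// leq_addr.
Qed.

End LinearRecurrence.

Section ComplexPowers.
Context {R : realType} {n : nat}.
Local Notation C := (complex.complex R).
Local Notation normc := (@complex.ComplexField.Normc.normc R).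
Implicit Types (G Y : 'M[C]_n.+1) (z : C).

Lemma normc_ge0 z : 0 <= normc z.
Proof. by case: z => a b; exact: sqrtr_ge0. Qed.

Lemma normc_real (x : R) : normc (complex.real_complex R x) = `|x|.
Proof. by rewrite /= expr0n /= addr0 sqrtr_sqr. Qed.

Lemma normc_conj z : normc (complex.conjc z) = normc z.
Proof. by case: z => a b /=; rewrite sqrrN. Qed.

(* The roots of the annihilating product are peeled off one at a time. *)
Lemma scaled_powers_vanish (lam : C) (s : seq C) G Y : lam != 0 ->
  (forall z, z \in s -> normc z < normc lam) ->
  horner_mx G (\prod_(z <- s) ('X - z%:P)) *m Y = 0 ->
  forall i j, vanishes (fun k => normc ((lam^-1 ^+ k *: (G ^+ k *m Y)) i j)).
Proof.
move=> lam0; elim: s Y => [|z s IH] Y zs.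
  rewrite big_nil rmorph1 mul1mx => -> i j e e0; exists 0%N => k _.
  by rewrite mulmx0 scaler0 mxE complex.ComplexField.Normc.normc0 ltW.
rewrite big_cons mulrC rmorphM /= -mulmxE -mulmxA rmorphB /= horner_mx_X horner_mx_C => GY i j.
have zs' z' : z' \in s -> normc z' < normc lam by move=> z's; apply: zs; rewrite inE z's orbT.
have {}IH := IH ((G - z%:M) *m Y) zs' GY i j.
have nl : 0 < normc lam by rewrite (le_lt_trans (normc_ge0 z))// zs ?mem_head.
pose a k := (lam^-1 ^+ k *: (G ^+ k *m Y)) i j.
pose b k := (lam^-1 ^+ k *: (G ^+ k *m ((G - z%:M) *m Y))) i j.
have ab k : a k.+1 = lam^-1 * z * a k + lam^-1 * b k.
  rewrite /a /b mulmxBl mulmxBr mul_scalar_mx -scalemxAr mulmxA.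
  rewrite -[G ^+ k *m G]/(G ^+ k * G) -exprSr !mxE exprS; ring.
apply: (@vanishes_contraction _ _ (fun k => normc (b k) / normc lam) (normc z / normc lam)).
- by rewrite divr_ge0 ?normc_ge0// ltW.
- by rewrite ltr_pdivrMr// mul1r zs ?mem_head.
- by move=> k; exact: normc_ge0.
- move=> k; rewrite -/(a k.+1) ab (le_trans (complex.le_normcD _ _))//.
  rewrite !complex.ComplexField.Normc.normcM complex.ComplexField.Normc.normcV.
  by rewrite [X in _ + X]mulrC [(normc lam)^-1 * _]mulrC.
move=> e e0; have [N NP] := IH _ (mulr_gt0 e0 nl).
by exists N => k /NP; rewrite ler_pdivrMr.
Qed.

End ComplexPowers.

Lemma char_poly_tr (F : fieldType) n (A : 'M[F]_n) : char_poly A^T = char_poly A.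
Proof.
rewrite /char_poly -det_tr; congr (\det _); apply/matrixP => i j.
by rewrite !mxE eq_sym.
Qed.

Lemma horner_mx_eigen (F : fieldType) n (A : 'M[F]_n.+1) lam (w : 'rV[F]_n.+1) p :
  w *m A = lam *: w -> w *m horner_mx A p = p.[lam] *: w.
Proof.
move=> wA; elim/poly_ind: p => [|p c IH].
  by rewrite rmorph0 mulmx0 horner0 scale0r.
rewrite rmorphD rmorphM /= horner_mx_X horner_mx_C mulmxDr -mulmxE mulmxA IH.
by rewrite -scalemxAl wA mul_mx_scalar scalerA -scalerDl hornerMXaddC.
Qed.

Section Proximal.
Context {R : realType} {n : nat} (A : 'M[R]_n.+1).
Local Notation C := (complex.complex R).
Local Notation normc := (@complex.ComplexField.Normc.normc R).
Local Notation toC := (complex.real_complex R).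

Lemma eigenvaluesE :
  map_poly toC (char_poly A) = \prod_(z <- eigenvalues A) ('X - z%:P).
Proof.
rewrite /eigenvalues; case: closed_field_poly_normal => s /= {1}->.
by rewrite lead_coef_map (monicP (char_poly_monic A)) rmorph1 scale1r.
Qed.

Lemma root_conj (p : {poly R}) z : root (map_poly toC p) z ->
  root (map_poly toC p) (complex.conjc z).
Proof.
have E : map_poly toC p = map_poly (@complex.conjc R) (map_poly toC p).
  apply/polyP => i; rewrite [RHS]coef_map [in RHS]coef_map [LHS]coef_map /=.
  by rewrite oppr0.
by move=> rz; rewrite E fmorph_root.
Qed.

(** The conjugate of the dominant root is a root of the same modulus, hence that root itself, which
    is therefore real. *)
Lemma dominant_eigenvalue : nth 0 (eigenmoduli A) 1 < nth 0 (eigenmoduli A) 0 ->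
  exists (lam : R) (q : {poly R}) (s : seq C),
    [/\ lam != 0, char_poly A = ('X - lam%:P) * q,
        map_poly toC q = \prod_(z <- s) ('X - z%:P) &
        forall z, z \in s -> normc z < `|lam|].
Proof.
rewrite /eigenmoduli.
have Ls : sorted >=%R (sort >=%R [seq normc z | z <- eigenvalues A]).
  by apply: sort_sorted; exact: ge_total.
have Lp := permEl (perm_sort >=%R [seq normc z | z <- eigenvalues A]).
case: (sort _ _) Ls Lp => [|x t] /=; first by rewrite ltxx.
move=> Ls Lp tx.
have /mapP[z1 z1e xE] : x \in [seq normc z | z <- eigenvalues A].
  by rewrite -(perm_mem Lp) mem_head.
have ep := perm_to_rem z1e; set s := rem z1 _ in ep.
have tp : perm_eq t [seq normc z | z <- s].
  rewrite -(perm_cons x); apply: perm_trans Lp _.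
  by rewrite {1}xE; have := perm_map normc ep.
have ty w : w \in t -> w <= nth 0 t 0.
  move: Ls; case: (t) => [//|y t'] /= /andP[_ yt'].
  rewrite inE => /orP[/eqP -> //|wt'].
  by have /allP/(_ _ wt') := order_path_min ge_trans yt'.
have sx z : z \in s -> normc z < x.
  move=> zs; apply: le_lt_trans tx; apply: ty.
  by rewrite (perm_mem tp); apply/mapP; exists z.
have pE : map_poly toC (char_poly A) = ('X - z1%:P) * \prod_(z <- s) ('X - z%:P).
  by rewrite eigenvaluesE (perm_big _ ep) big_cons.
have z1r : complex.conjc z1 = z1.
  have : root (map_poly toC (char_poly A)) (complex.conjc z1).
    by apply: root_conj; rewrite pE rootM root_XsubC eqxx.
  rewrite pE rootM root_XsubC root_prod_XsubC => /orP[/eqP //|/sx].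
  by rewrite normc_conj -xE ltxx.
pose lam : R := complex.Re z1.
have z1E : z1 = toC lam.
  rewrite /lam; move: z1r; case: (z1) => a b /= [] /eqP.
  by rewrite eq_sym -subr_eq0 opprK -mulr2n mulrn_eq0 /= => /eqP ->.
have xlam : x = `|lam| by rewrite xE z1E normc_real.
(* The second modulus is nonnegative, being the default value 0 of [nth] when there is only one
   eigenvalue. *)
have x0 : 0 < x.
  apply: le_lt_trans tx; case: (t) tp => [//|y t'] /= tp.
  have /mapP[z _ ->] : y \in [seq normc z | z <- s] by rewrite -(perm_mem tp) mem_head.
  exact: normc_ge0.
have rl : root (char_poly A) lam.
  by rewrite -(fmorph_root toC) /= -z1E pE rootM root_XsubC eqxx.
have dE : char_poly A = ('X - lam%:P) * (char_poly A %/ ('X - lam%:P)).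
  by rewrite mulrC divpK// dvdp_XsubCl.
exists lam, (char_poly A %/ ('X - lam%:P)), s; split=> //.
- by rewrite -normr_gt0 -xlam.
- have z0 : 'X - z1%:P != 0 by rewrite polyXsubC_eq0.
  have XE : 'X - z1%:P = map_poly toC ('X - lam%:P) by rewrite map_polyXsubC z1E.
  by apply: (mulfI z0); rewrite -pE XE -rmorphM /= -dE.
- by move=> z /sx; rewrite xlam.
Qed.

(* The powers of lam^-1 A converge to the projection q(A) / q(lam) onto the
   eigenline of the dominant eigenvalue. *)
Lemma proximal_limit : nth 0 (eigenmoduli A) 1 < nth 0 (eigenmoduli A) 0 ->
  exists (lam : R) (v : 'cV[R]_n.+1) (phi : 'rV[R]_n.+1),
    [/\ lam != 0, A *m v = lam *: v, phi *m A = lam *: phi, pair phi v = 1 &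
     forall u, vanishes (fun k => `|lam^-1 ^+ k *: (A ^+ k *m u) - pair phi u *: v|)].
Proof.
move=> /dominant_eigenvalue[lam [q [s [lam0 pE qE sl]]]].
have ql : q.[lam] != 0.
  rewrite -(fmorph_eq0 toC) -horner_map /= qE -[_ == 0]/(root _ _) root_prod_XsubC.
  by apply/negP => /sl; rewrite normc_real ltxx.
have rl : root (char_poly A) lam by rewrite pE rootM root_XsubC eqxx.
have p'l : (char_poly A)^`().[lam] = q.[lam].
  by rewrite pE derivM derivXsubC mul1r hornerD hornerM hornerXsubC subrr mul0r addr0.
have /eigenvalueP[phi' phiA phi0] := root_char_poly_eigenvalue rl.
have /eigenvalueP[v' vA v0] : eigenvalue A^T lam.
  by apply: root_char_poly_eigenvalue; rewrite char_poly_tr.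
have Av : A *m v'^T = lam *: v'^T by rewrite -[A]trmxK -trmx_mul vA linearZ.
have vT0 : v'^T != 0 by rewrite -trmx0 (inj_eq trmx_inj).
(* The derivative of the characteristic polynomial at [lam] is [q.[lam]], nonzero: [lam] is a simple
   root, so its left and right eigenvectors are not orthogonal. *)
have orth c : c != 0 -> A *m c = lam *: c -> pair phi' c != 0.
  move=> c0 Ac; apply: contra ql => /eqP pc; rewrite -p'l.
  apply/eqP; apply: (orthogonal_eigenvectors_root phi0 c0 phiA Ac).
  by apply/matrixP => i j; rewrite !ord1 [LHS]pc mxE.
have pv := orth _ vT0 Av.
pose v := (pair phi' v'^T)^-1 *: v'^T.
have pv1 : pair phi' v = 1 by rewrite /v pairZ mulVf.
have Av1 : A *m v = lam *: v by rewrite /v -scalemxAr Av scalerA mulrC -scalerA.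
exists lam, v, phi'; split=> // u.
have eigen_line c : A *m c = lam *: c -> c = pair phi' c *: v.
  move=> Ac; apply/eqP; rewrite -subr_eq0; apply/negPn/negP => c0.
  have := orth _ c0; rewrite mulmxBr Ac -scalemxAr Av1 scalerBr scalerA mulrC -scalerA.
  by rewrite pairB pairZ pv1 mulr1 subrr eqxx => /(_ erefl).
pose Pi := q.[lam]^-1 *: horner_mx A q.
have AmX : (A - lam%:M) *m horner_mx A q = 0.
  have := Cayley_Hamilton A; rewrite pE rmorphM /= rmorphB /= horner_mx_X horner_mx_C.
  by [].
have AqE : A *m horner_mx A q = lam *: horner_mx A q.
  by apply/eqP; rewrite -subr_eq0 -mul_scalar_mx -mulmxBl AmX.
have APi : A *m Pi = lam *: Pi.
  by rewrite /Pi -scalemxAr AqE scalerA mulrC -scalerA.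
have PiE w : Pi *m w = pair phi' w *: v.
  have Aq : A *m (Pi *m w) = lam *: (Pi *m w).
    by rewrite mulmxA APi scalemxAl.
  rewrite (eigen_line _ Aq); congr (_ *: _).
  have phiq : phi' *m horner_mx A q = q.[lam] *: phi'.
    exact: horner_mx_eigen.
  rewrite /pair mulmxA /Pi -scalemxAr phiq scalerA mulVf// scale1r.
  by [].
pose Ac := map_mx toC A; pose Y := map_mx toC (1%:M - Pi).
have PiM k : lam^-1 ^+ k *: (A ^+ k *m Pi) = Pi.
  elim: k => [|k IH]; first by rewrite !expr0 scale1r mul1mx.
  have -> : A ^+ k.+1 *m Pi = lam *: (A ^+ k *m Pi).
    by rewrite exprSr -[A ^+ k * A]/(A ^+ k *m A) -mulmxA APi -scalemxAr.
  by rewrite exprSr scalerA -mulrA mulVf// mulr1.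
(* On the image of [1 - Pi] only the roots of [q] remain. Indeed q - q(lam) is divisible by X - lam,
   so q^2 equals q(lam) q modulo the characteristic polynomial, whence q(A) Pi = q(A). *)
have qY : horner_mx Ac (\prod_(z <- s) ('X - z%:P)) *m Y = 0.
  rewrite -qE -map_horner_mx -map_mxM mulmxBr mulmx1.
  suff -> : horner_mx A q *m Pi = horner_mx A q by rewrite subrr map_mx0.
  have /factor_theorem[r rE] : root (q - q.[lam]%:P) lam.
    by rewrite /root hornerD hornerN hornerC subrr.
  have qq : q * q = q.[lam] *: q + r * (('X - lam%:P) * q).
    by rewrite mulrA -rE -mul_polyC; ring.
  have : horner_mx A q *m horner_mx A q = q.[lam] *: horner_mx A q.
    rewrite mulmxE -rmorphM qq rmorphD /= linearZ /= rmorphM /= -pE.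
    by rewrite Cayley_Hamilton mulr0 addr0.
  by rewrite /Pi -scalemxAr => ->; rewrite scalerA mulVf// scale1r.
have lamC0 : toC lam != 0 by rewrite fmorph_eq0.
have sl' z : z \in s -> normc z < normc (toC lam) by rewrite normc_real; exact: sl.
pose X k := lam^-1 ^+ k *: (A ^+ k *m (1%:M - Pi)).
have XE k : (toC lam)^-1 ^+ k *: (Ac ^+ k *m Y) = map_mx toC (X k).
  by rewrite /X map_mxZ map_mxM !rmorphXn fmorphV.
have [N NP] : exists N : R -> nat, forall e, 0 < e -> forall k, (N e <= k)%N -> `|X k| <= e.
  suff /choice[N NP] : forall e : R, exists N : nat, 0 < e ->
      forall k, (N <= k)%N -> `|X k| <= e by exists N.
  move=> e; have [e0|] := ltP 0 e; last by exists 0%N.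
  have /choice[N NP] : forall ij : 'I_n.+1 * 'I_n.+1, exists N : nat,
      forall k, (N <= k)%N -> `|X k ij.1 ij.2| <= e.
    move=> [i j]; have [N NP] := scaled_powers_vanish lamC0 sl' qY i j e0.
    by exists N => k /NP; rewrite XE mxE normc_real.
  exists (\max_ij N ij)%N => _ k Nk; apply/mx_norm_leP => [|i j]; first exact: ltW.
  by apply: (NP (i, j)); apply: leq_trans Nk; exact: leq_bigmax.
have uP k : lam^-1 ^+ k *: (A ^+ k *m u) - pair phi' u *: v = X k *m u.
  rewrite /X mulmxBr mulmx1 scalerBr PiM mulmxBl -scalemxAl PiE.
  by [].
move=> e e0; have u0 : 0 < n.+1%:R * (`|u| + 1) by rewrite mulr_gt0// ltr_pwDr.
exists (N (e / (n.+1%:R * (`|u| + 1)))) => k /(NP _ (divr_gt0 e0 u0)) Xk.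
rewrite uP (le_trans (mulmx_norm_le _ _))//.
move: Xk; rewrite ler_pdivlMr//; apply: le_trans.
by rewrite mulrCA mulrA ler_wpM2l ?mulr_ge0// lerDl.
Qed.

End Proximal.

(** * The boundary of a hyperbolic group *)

Section Cayley.
Context {G : groupType} (S : generating_set G).
Local Notation len := (word_length S).
Local Notation dist := (word_dist S).
Implicit Types (x y z g : G) (r t : nat -> G).

Lemma dist1 x : dist 1%g x = len x.
Proof. by rewrite /word_dist invg1 mul1g. Qed.

Lemma word_lengthV x : len (x^-1)%g = len x.
Proof.
by apply/eqP; rewrite eqn_leq word_lengthV_le -{1}(invgK x) word_lengthV_le.
Qed.

Lemma ball_finite m : exists L : seq G, forall x, (len x <= m)%N -> x \in L.
Proof.
elim: m => [|m [L LP]].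
  exists [:: 1%g] => x; rewrite leqn0 => /eqP lx.
  have [w [_ xE]] := word_lengthP S x; rewrite lx => /eqP.
  by rewrite size_eq0 xE => /eqP -> /=; rewrite mem_seq1.
exists (1%g :: [seq (s * y)%g | s <- gens S, y <- L]) => x lx.
have [[|s w] [wS xE]] := word_lengthP S x; first by rewrite xE mem_head.
move=> sw; rewrite inE {1}xE; apply/orP; right; apply/allpairsP.
exists (s, foldr *%g 1%g w); split=> //=; first by apply: wS; rewrite mem_head.
apply: LP; apply: (@leq_trans (size w)).
  by apply: word_length_le; split=> // u uw; apply: wS; rewrite inE uw orbT.
by move: sw lx => /= <-.
Qed.

(** A prefix is [good] when infinitely many of the [s n] start with it. Balls being finite, a good
    prefix always has a good extension, and [t] follows such choices. *)
Lemma konig (s : nat -> nat -> G) : (forall n m, (len (s n m) <= m)%N) ->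
  exists t : nat -> G, forall m N, exists2 n, (N <= n)%N &
    forall i, (i <= m)%N -> t i = s n i.
Proof.
move=> sl.
pose good (p : seq G) := forall N, exists2 n, (N <= n)%N &
  forall i, (i < size p)%N -> nth 1%g p i = s n i.
have ext p : exists x, good p -> good (rcons p x).
  have [gp|ngp] := pselect (good p); last by exists 1%g.
  apply: contrapT => nx.
  have /choice[N NP] : forall x, exists N : nat, forall n, (N <= n)%N ->
      ~ (forall i, (i < (size p).+1)%N -> nth 1%g (rcons p x) i = s n i).
    move=> x; apply: contrapT => nN; apply: nx; exists x => _ N.
    apply: contrapT => nn; apply: nN; exists N => n Nn h; apply: nn.
    by exists n => //; rewrite size_rcons.
  have [L LP] := ball_finite (size p).
  have [n Mn pn] := gp (\max_(x <- L) N x)%N.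
  have nL : s n (size p) \in L by exact: LP.
  apply: (NP (s n (size p)) n).
    by apply: leq_trans Mn; exact: (leq_bigmax_seq (F := N)).
  move=> i; rewrite ltnS leq_eqVlt => /orP[/eqP ->|ip].
    by rewrite nth_rcons ltnn eqxx.
  by rewrite nth_rcons ip pn.
have [f fP] := choice ext.
pose P := fix P m := if m is m'.+1 then rcons (P m') (f (P m')) else [::].
have Pgood m : good (P m).
  elim: m => [|m IH] /=; last exact: fP.
  by move=> N; exists N.
have Psize m : size (P m) = m by elim: m => //= m IH; rewrite size_rcons IH.
have Pnth m i : (i < m)%N -> nth 1%g (P m) i = nth 1%g (P i.+1) i.
  elim: m => // m IH; rewrite ltnS leq_eqVlt => /orP[/eqP -> //|im] /=.
  by rewrite nth_rcons Psize im IH.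
exists (fun i => nth 1%g (P i.+1) i) => m N.
have [n Nn nP] := Pgood m.+1 N; exists n => // i im.
by rewrite -(Pnth m.+1)// nP// Psize ltnS.
Qed.

Definition is_ray r : Prop :=
  forall i j, (i <= j)%N -> dist (r i) (r j) = (j - i)%N.

Lemma prod_cat (u w : seq G) :
  foldr *%g 1%g (u ++ w) = (foldr *%g 1%g u * foldr *%g 1%g w)%g.
Proof. by elim: u => [|s u IH] /=; rewrite ?mul1g// IH mulgA. Qed.

(** Prefixes of a shortest word. Past time [len g] the path stays at [g], so that the bound on
    [len (c i)] holds for every [i], as [konig] demands. *)
Lemma geodesic_path g : exists c : nat -> G,
  [/\ c 0%N = 1%g, c (len g) = g, forall i, (len (c i) <= i)%N &
   forall i j, (i <= j)%N -> (j <= len g)%N -> dist (c i) (c j) = (j - i)%N].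
Proof.
have [w [wS gE] wl] := word_lengthP S g.
pose c i := foldr *%g 1%g (take i w).
have sub (u : seq G) : {subset u <= w} -> (len (foldr *%g 1%g u) <= size u)%N.
  by move=> uw; apply: word_length_le; split=> // s /uw /wS.
have cd i j : (i <= j)%N -> (dist (c i) (c j) <= j - i)%N.
  move=> ij; rewrite /word_dist /c.
  have -> : take j w = take i w ++ drop i (take j w).
    by rewrite -{1}(cat_take_drop i (take j w)) take_takel.
  rewrite prod_cat mulgA mulVg mul1g.
  apply: (leq_trans (sub _ _)) => [s /mem_drop /mem_take //|].
  by rewrite size_drop size_take; case: ifP; lia.
have c0 : c 0%N = 1%g by rewrite /c take0.
have cl : c (len g) = g by rewrite /c -wl take_size -gE.
exists c; split=> //.
  by move=> i; rewrite -dist1 -c0 (leq_trans (cd 0%N i _))// subn0.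
move=> i j ij jl; apply/eqP; rewrite eqn_leq cd//=.
have := cd 0%N i (leq0n _); have := cd j (len g) jl.
have := word_dist_triangle S (c i) (c 0%N) (c (len g)).
have := word_dist_triangle S (c j) (c i) (c (len g)).
rewrite c0 cl dist1; lia.
Qed.

(** Compactness of paths from 1: [s n] is geodesic up to time [L n], which tends to infinity, so the
    limit is geodesic at all times. *)
Lemma limit_ray (s : nat -> nat -> G) (L : nat -> nat) :
  (forall n, s n 0%N = 1%g) -> (forall n m, (len (s n m) <= m)%N) ->
  (forall n i j, (i <= j)%N -> (j <= L n)%N -> dist (s n i) (s n j) = (j - i)%N) ->
  (forall m, exists N, forall n, (N <= n)%N -> (m <= L n)%N) ->
  exists t, [/\ is_ray t, t 0%N = 1%g &
    forall m N, exists2 n, (N <= n)%N & forall i, (i <= m)%N -> t i = s n i].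
Proof.
move=> s0 sl sg Linf; have [t tP] := konig sl.
exists t; split=> //; last by have [n _ /(_ 0%N) ->] := tP 0%N 0%N.
move=> i j ij; have [N NP] := Linf j; have [n Nn nP] := tP j N.
by rewrite !nP// sg// NP.
Qed.

Lemma ray_len r i : is_ray r -> r 0%N = 1%g -> len (r i) = i.
Proof. by move=> rr r0; rewrite -dist1 -r0 rr// subn0. Qed.

(* Twice the Gromov product based at 1. *)
Definition gp x y : nat := (len x + len y - dist x y)%N.

Lemma gpE x y : (gp x y + dist x y = len x + len y)%N.
Proof.
rewrite /gp subnK// -!dist1 (leq_trans (word_dist_triangle S 1%g x y))//.
by rewrite [dist x 1%g]word_distC.
Qed.

Lemma gpC x y : gp x y = gp y x.
Proof. by rewrite /gp addnC word_distC. Qed.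

Definition nat_hyperbolic (D : nat) : Prop := forall x y z,
  (minn (gp x y) (gp y z) <= gp x z + D)%N.

Lemma nat_hyperbolicP : word_hyperbolic S -> exists D, nat_hyperbolic D.
Proof.
(* Gromov products are doubled in [gp], so the constant is [2 * |delta|], rounded up. *)
move=> [delta dP]; exists (Num.truncn (2 * `|delta|)).+1 => x y z.
have h := dP 1%g x y z.
have gE u w : gromov_product S 1%g u w = (gp u w)%:R / 2.
  rewrite /gromov_product !dist1 -natrD -(gpE u w) natrD addrK.
  by [].
have D1 : 2 * `|delta| < (Num.truncn (2 * `|delta|)).+1%:R by exact: truncnS_gt.
have dd : delta <= `|delta| by exact: ler_norm.
move: h; rewrite !gE -(@ler_nat rat) natrD.
set T := (_.+1%:R) in D1 *.
case: (leqP (gp x y) (gp y z)) => gg.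
  rewrite min_l; last by rewrite ler_pM2r ?invr_gt0// ler_nat.
  by move: (gp x y)%:R (gp x z)%:R => a b; lra.
rewrite min_r; last by rewrite ler_pM2r ?invr_gt0// ler_nat ltnW.
by move: (gp y z)%:R (gp x z)%:R => a b; lra.
Qed.

Section Hyperbolic.
Context (D : nat) (hyp : nat_hyperbolic D).

(** [t] is a limit of geodesics [c n] from 1 to [r n]. For large [n] both [c n m] and [r m] have a
    doubled product with [r n] of at least [2 m - 2 D0], which bounds their distance. *)
Lemma ray_from_one r : is_ray r -> exists t, [/\ is_ray t, t 0%N = 1%g &
  exists K, forall n, (dist (r n) (t n) <= K)%N].
Proof.
move=> rr; pose D0 := len (r 0%N).
have rl n : (n - D0 <= len (r n))%N /\ (len (r n) <= n + D0)%N.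
  have := word_dist_triangle S 1%g (r 0%N) (r n); rewrite [dist (r 0%N) 1%g]word_distC !dist1.
  have := word_dist_triangle S (r 0%N) 1%g (r n); rewrite !dist1 rr// subn0 /D0.
  lia.
have /choice[c cP] := fun n => geodesic_path (r n).
have [||||t [tr t0 tP]] := @limit_ray c (fun n => len (r n)).
- by move=> n; case: (cP n).
- by move=> n; case: (cP n).
- by move=> n; case: (cP n).
- by move=> m; exists (m + D0)%N => n mn; have [+ _] := rl n; lia.
exists t; split=> //; exists (3 * D0 + D)%N => m.
have [n mn nP] := tP m (m + D0)%N; rewrite nP//.
have [c0 cl cle cd] := cP n.
have [rn1 rn2] := rl n; have [rm1 rm2] := rl m.
have h1 : gp (c n m) (r n) = (m + m)%N.
  have := gpE (c n m) (r n); have := cd m (len (r n)); rewrite cl.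
  have := cd 0%N m (leq0n _); rewrite c0 dist1; lia.
have h2 : (m + m <= gp (r n) (r m) + (D0 + D0))%N.
  have := gpE (r n) (r m); rewrite [dist (r n) _]word_distC rr; lia.
have := hyp (c n m) (r n) (r m); have := gpE (c n m) (r m).
have := cle m; rewrite [dist (r m) _]word_distC; lia.
Qed.

(** Hyperbolicity along [r n], [r m], [t m], [t n]: consecutive doubled products are at least [2 n],
    and two uses lose [2 * D]. *)
Lemma rays_close r t : is_ray r -> is_ray t -> r 0%N = 1%g -> t 0%N = 1%g ->
  (forall n, exists m, (n <= m)%N /\ (n + n <= gp (r m) (t m))%N) ->
  forall n, (dist (r n) (t n) <= 2 * D)%N.
Proof.
move=> rr tr r0 t0 h n; have [m [nm gm]] := h n.
have ln r' i : is_ray r' -> r' 0%N = 1%g -> len (r' i) = i by move=> *; exact: ray_len.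
have h1 : gp (r n) (r m) = (n + n)%N by have := gpE (r n) (r m); rewrite rr// !ln//; lia.
have h2 : gp (t m) (t n) = (n + n)%N.
  by have := gpE (t m) (t n); rewrite [dist _ (t n)]word_distC tr// !ln//; lia.
have := hyp (r n) (r m) (t m); have := hyp (r n) (t m) (t n).
have := gpE (r n) (t n); rewrite !ln//; lia.
Qed.

(* One of the Gromov products of (r n)^-1 with the ends of a1 and a2 is bounded,
   since these ends differ. *)
Lemma translate_close (a1 a2 r : nat -> G) K (n : nat) :
  is_ray r -> r 0%N = 1%g -> is_ray a1 -> a1 0%N = 1%g -> is_ray a2 -> a2 0%N = 1%g ->
  (forall j, (gp (a1 j) (a2 j) <= K)%N) ->
  exists a, (a = a1 \/ a = a2) /\ forall t, is_ray t -> t 0%N = 1%g ->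
    (exists K', forall j, (dist (t j) (r n * a j)%g <= K')%N) ->
    forall m, (m + m + K + D <= n + n)%N -> (dist (t m) (r m) <= 3 * D)%N.
Proof.
move=> rr r0 r1 a10 r2 a20 aK.
pose inf (a : nat -> G) := forall N, exists2 j, (N <= j)%N & (gp (r n)^-1%g (a j) <= K + D)%N.
have : inf a1 \/ inf a2.
  have [i1|ni1] := pselect (inf a1); [by left|right => N].
  have [N1 N1P] : exists N1, forall j, (N1 <= j)%N -> ~ (gp (r n)^-1%g (a1 j) <= K + D)%N.
    apply: contrapT => nN; apply: ni1 => N1; apply: contrapT => nj; apply: nN.
    by exists N1 => j Nj h; apply: nj; exists j.
  exists (maxn N N1); first by rewrite leq_maxl.
  have := hyp (a1 (maxn N N1)) (r n)^-1%g (a2 (maxn N N1)).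
  have /negP := N1P (maxn N N1) (leq_maxr _ _).
  rewrite (gpC (a1 _)); have := aK (maxn N N1); lia.
move=> h; have [a [aE ra a0 infa]] : exists a,
    [/\ a = a1 \/ a = a2, is_ray a, a 0%N = 1%g & inf a].
  by case: h => h; [exists a1|exists a2]; split; auto.
exists a; split=> // t tr t0 [K' tK] m mn.
have [j Nj gj] := infa (m + K' + n)%N.
have ln r' i : is_ray r' -> r' 0%N = 1%g -> len (r' i) = i by move=> *; exact: ray_len.
pose b := (r n * a j)%g.
have lb : dist (r n)^-1%g (a j) = len b by rewrite /word_dist invgK.
(* The products of [(r n)^-1] with [a j] and of [r n] with [b] add up to [n + n]: as the first is
   bounded, the geodesic to [b] follows [r] for almost [n] steps. *)
have g1 : (m + m <= gp (r n) b)%N.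
  have e1 := gpE (r n)^-1%g (a j); rewrite word_lengthV lb !ln// in e1.
  have e2 := gpE (r n) b.
  have db : dist (r n) b = j by rewrite /word_dist /b mulgA mulVg mul1g ln.
  rewrite db !ln// in e2; lia.
have g2 : (m + m <= gp (t j) b)%N.
  have := gpE (t j) b; have := tK j; rewrite -/b.
  have := word_dist_triangle S (t j) 1%g b; have := word_dist_triangle S b 1%g (t j).
  rewrite [dist b (t j)]word_distC !dist1 !ln//; lia.
have g3 : gp (t m) (t j) = (m + m)%N.
  by have := gpE (t m) (t j); rewrite tr// ?ln//; lia.
have g4 : gp (r n) (r m) = (m + m)%N.
  by have := gpE (r n) (r m); rewrite [dist (r n) _]word_distC rr ?ln//; lia.
(* The chain [t m], [t j], [b], [r n], [r m] takes three uses of hyperbolicity, hence [3 * D]. *)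
have := hyp (t m) (t j) b; have := hyp (t m) b (r n); rewrite (gpC b).
have := hyp (t m) (r n) (r m); have := gpE (t m) (r m); rewrite !ln//; lia.
Qed.

End Hyperbolic.
End Cayley.

Local Open Scope quotient_scope.

Section Boundary.
Context {G : groupType} (S : generating_set G).
Local Notation len := (word_length S).
Local Notation dist := (word_dist S).
Local Notation bd := (boundary S).
Implicit Types (x y : bd) (g : G) (r t : nat -> G).

Definition mkray t (rt : is_ray S t) : geodesic_ray S :=
  Sub (t : {ptws nat -> discrete_topology G}) (mem_set (rt : geodesic_ray S t)).

Definition bounded_dist r t : Prop := exists K, forall n, (dist (r n) (t n) <= K)%N.

Lemma bounded_distC r t : bounded_dist r t -> bounded_dist t r.
Proof. by move=> [K h]; exists K => n; rewrite word_distC. Qed.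

Lemma bounded_dist_trans t r u :
  bounded_dist r t -> bounded_dist t u -> bounded_dist r u.
Proof.
move=> [K h] [L h']; exists (K + L)%N => n.
by rewrite (leq_trans (word_dist_triangle S (t n) _ _))// leq_add.
Qed.

Lemma pi_rayP (r t : geodesic_ray S) :
  \pi_(boundary S) r = \pi_(boundary S) t <-> bounded_dist (val r) (val t).
Proof.
have h := @eqmodP _ (asymptotic_equiv S) r t.
by split=> [/h /asboolP|rt] //; apply/h/asboolP.
Qed.

Definition ends r x : Prop := is_ray S r /\ bounded_dist r (val (repr x)).

Lemma ends_pi (r : geodesic_ray S) : ends (val r) (\pi_(boundary S) r).
Proof.
split; first exact: set_valP r.
by apply/(pi_rayP r); rewrite reprK.
Qed.

Lemma endsE r x : ends r x -> exists2 rr : is_ray S r, True & x = \pi_(boundary S) (mkray rr).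
Proof.
move=> [rr rx]; exists rr => //; rewrite -[LHS]reprK; apply/esym.
exact/(pi_rayP (mkray rr)).
Qed.

Lemma ends_exists x : word_hyperbolic S -> exists2 t, ends t x & t 0%N = 1%g.
Proof.
move=> /nat_hyperbolicP[D hyp].
have [t [tr t0 tx]] := ray_from_one hyp (set_valP (repr x)).
by exists t => //; split=> //; exact: bounded_distC.
Qed.

Lemma ray_ends r : is_ray S r -> exists x, ends r x.
Proof. by move=> rr; exists (\pi_(boundary S) (mkray rr)); exact: (ends_pi (mkray rr)). Qed.

Lemma ends_inj r t x y : ends r x -> ends t y -> bounded_dist r t -> x = y.
Proof.
move=> /endsE[rr _ ->] /endsE[tt _ ->] rt; exact/(pi_rayP (mkray rr) (mkray tt)).
Qed.

Lemma ends_bounded r t x : ends r x -> ends t x -> bounded_dist r t.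
Proof.
by move=> [_ rx] [_ tx]; exact: bounded_dist_trans rx (bounded_distC tx).
Qed.

Lemma ends_act g r x : ends r x -> ends (fun n => g * r n)%g (boundary_act g x).
Proof.
move=> [rr rx]; split; first by move=> i j ij; rewrite word_distMl rr.
apply: (@bounded_dist_trans (val (translate_ray g (repr x)))).
  by case: rx => K h; exists K => n; rewrite /= word_distMl.
by have [_] := ends_pi (translate_ray g (repr x)).
Qed.

(** Otherwise rays agreeing with [t] on longer and longer prefixes would converge to it pointwise
    with ends outside [O], against continuity of the quotient map. *)
Lemma cylinder_nbhs t x (O : set bd) : ends t x -> nbhs x O ->
  exists m, forall s y, ends s y -> (forall i, (i <= m)%N -> s i = t i) -> O y.
Proof.
move=> /endsE[rt _ ->] nO; apply: contrapT => nm.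
have /choice[s sP] : forall m, exists s : geodesic_ray S,
    (forall i, (i <= m)%N -> val s i = t i) /\ ~ O (\pi_(boundary S) s).
  move=> m; apply: contrapT => ns; apply: nm; exists m => s y sy st.
  have [rs _ yE] := endsE sy.
  by apply: contrapT => nOy; apply: ns; exists (mkray rs); rewrite -yE.
have cv : s n @[n --> \oo] --> mkray rt.
  move=> A /= [_ [[B Bo <-] Bt sBA]].
  have nB : nbhs (t : {ptws nat -> discrete_topology G}) B.
    by rewrite nbhsE; exists B.
  have ct : (fun n => val (s n)) @ \oo -->
      (t : {ptws nat -> discrete_topology G}).
    rewrite cvg_sup => i; rewrite cvg_image; last first.
      by rewrite eqEsubset; split=> v // _; exists (cst v).
    move=> W /= nW; exists [set f | W (f i)].
      exists i => // n /= mn.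
      have [sti _] := sP n; rewrite /= sti//.
      have tW := @nbhs_singleton (discrete_topology G) (t i) W.
      exact: tW nW.
    rewrite eqEsubset; split=> [_ [f Wf <-] //|v Wv].
    by exists (cst v).
  have [N _ NB] := ct _ nB; exists N => // n Nn; apply: sBA; exact: NB Nn.
have [m _ /(_ m (leqnn m))] := cv _ (@pi_continuous _ _ (mkray rt) _ nO).
by have [_ +] := sP m; apply.
Qed.


Lemma limit_end (s : nat -> nat -> G) (u : nat -> bd) :
  (forall n, ends (s n) (u n)) -> (forall n, s n 0%N = 1%g) ->
  exists t x, [/\ ends t x,
    forall m N, exists2 n, (N <= n)%N & forall i, (i <= m)%N -> t i = s n i &
    forall O, nbhs x O -> forall N, exists2 n, (N <= n)%N & O (u n)].
Proof.
move=> su s0.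
have [||||t [tr t0 tP]] := @limit_ray _ S s id.
- exact: s0.
- by move=> n m; rewrite (ray_len m (proj1 (su n)))//.
- by move=> n i j ij _; have [/(_ i j ij)] := su n.
- by move=> m; exists m.
have [x tx] := ray_ends tr; exists t, x; split=> // O nO N.
have [m mP] := cylinder_nbhs tx nO.
have [n Nn nP] := tP m N; exists n => //.
by apply: mP (su n) _ => i im; rewrite nP.
Qed.

(** The form of compactness of the boundary from which [cone_closed] is derived. *)
Lemma boundary_cluster (u : nat -> bd) : word_hyperbolic S ->
  exists x, forall O, nbhs x O -> forall N, exists2 n, (N <= n)%N & O (u n).
Proof.
move=> hyp; have /choice[s sP] : forall n, exists t, ends t (u n) /\ t 0%N = 1%g.
  by move=> n; have [t] := ends_exists (u n) hyp; exists t.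
have [||t [x [_ _ xP]]] := @limit_end s u.
- by move=> n; case: (sP n).
- by move=> n; case: (sP n).
by exists x.
Qed.

Lemma boundary_nonempty : (forall m, exists g, (m <= len g)%N) ->
  exists x : bd, True.
Proof.
move=> /choice[g gP]; have /choice[c cP] := fun n => geodesic_path S (g n).
have [||||t [tr _ _]] := @limit_ray _ S c (fun n => len (g n)).
- by move=> n; case: (cP n).
- by move=> n; case: (cP n).
- by move=> n; case: (cP n).
- by move=> m; exists m => n mn; rewrite (leq_trans mn).
by have [x _] := ray_ends tr; exists x.
Qed.

(** If [r] is a ray to [x], then for every [n] the translate by [r n] of [p] or of [q] has a ray
    that follows [r] for almost [n] steps. Two points are required because a single one may be sent
    away from [x]. These translates accumulate at [x]. *)
Lemma boundary_minimal (F : set bd) (p q : bd) : word_hyperbolic S ->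
  closed F -> (forall g x, F x -> F (boundary_act g x)) ->
  F p -> F q -> p <> q -> F = setT.
Proof.
move=> hyp cF actF Fp Fq pq; have [D hypD] := nat_hyperbolicP hyp.
have [a1 a1p a10] := ends_exists p hyp; have [a2 a2q a20] := ends_exists q hyp.
(* Unbounded products would make the two rays asymptotic by [rays_close], hence [p = q]. *)
have [K KP] : exists K, forall j, (gp S (a1 j) (a2 j) <= K)%N.
  apply: contrapT => nK; apply: pq; apply: (ends_inj a1p a2q).
  exists (2 * D)%N.
  apply: (rays_close hypD) => //; [by case: a1p|by case: a2q|move=> n].
  apply: contrapT => nm; apply: nK; exists (n + n)%N => j.
  have [nj|jn] := leqP n j.
    by apply: contrapT => /negP h; apply: nm; exists j; split=> //; lia.
  rewrite /gp (ray_len j (proj1 a1p) a10) (ray_len j (proj1 a2q) a20).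
  lia.
apply/seteqP; split=> // x _; apply: contrapT => nFx.
have [r rx r0] := ends_exists x hyp.
have /choice[t tP] : forall n, exists t, [/\ t 0%N = 1%g,
    (exists2 z, F z & ends t z) &
    forall m, (m + m + K + D <= n + n)%N -> (dist (t m) (r m) <= 3 * D)%N].
  move=> n.
  have [a [aE aP]] := translate_close hypD n (proj1 rx) r0 (proj1 a1p) a10
    (proj1 a2q) a20 KP.
  have [z Fz az] : exists2 z, F z & ends a z.
    by case: aE => ->; [exists p|exists q].
  have [t tz t0] := ends_exists (boundary_act (r n) z) hyp.
  exists t; split=> //; first by exists (boundary_act (r n) z) => //; exact: actF.
  apply: aP => //; first by case: tz.
  exact: ends_bounded tz (ends_act (r n) az).
have /choice[z zP] : forall n, exists z, F z /\ ends (t n) z.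
  by move=> n; have [_ [z Fz tz] _] := tP n; exists z.
have [||s [y [sy sP yP]]] := @limit_end t z.
- by move=> n; case: (zP n).
- by move=> n; case: (tP n).
have yx : y = x.
  apply: (ends_inj sy rx); exists (3 * D)%N => m.
  have [n mn nP] := sP m (m + K + D)%N; rewrite nP//.
  by have [_ _ ->//] := tP n; lia.
have nF : nbhs y (~` F) by apply: open_nbhs_nbhs; rewrite yx; split=> //; exact: closed_openC.
by have [n _] := yP _ nF 0%N; have [Fz _] := zP n; apply.
Qed.

End Boundary.

(** * Elements of large translation length *)

Section MultiplicativeGroups.
Context {G H : groupType} (f : {multiplicative G -> H}).

Lemma multiplicative1 : f 1%g = 1%g.
Proof. by apply: (mulgI (f 1%g)); rewrite -gmulfM !mulg1. Qed.

Lemma multiplicativeV x : f x^-1%g = (f x)^-1%g.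
Proof.
by apply: (mulgI (f x)); rewrite -gmulfM !mulgV multiplicative1.
Qed.

End MultiplicativeGroups.

Section ProjectiveMatrices.
Context {R : realType} {d : nat}.
Implicit Types g h : PGL R d.

Lemma pgl_mx_unit g : pgl_mx g \in unitmx.
Proof. exact: (valP (repr g)). Qed.

Lemma pgl_mxM g h :
  exists2 c : R, c != 0 & pgl_mx (g * h)%g = c *: (pgl_mx g *m pgl_mx h).
Proof. exact: (repr_pgl (glM (repr g) (repr h))). Qed.

Lemma pgl_mxV g : exists2 c : R, c != 0 & pgl_mx g^-1%g = c *: invmx (pgl_mx g).
Proof. exact: (repr_pgl (glV (repr g))). Qed.

Lemma pgl_mxJ g h : exists2 c : R, c != 0 &
  pgl_mx (g * h * g^-1)%g = c *: (pgl_mx g *m pgl_mx h *m invmx (pgl_mx g)).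
Proof.
have [a a0 ->] := pgl_mxM (g * h)%g g^-1%g.
have [b b0 ->] := pgl_mxM g h; have [c c0 ->] := pgl_mxV g.
exists (a * (b * c)); first by rewrite !mulf_neq0.
by rewrite -scalemxAr -scalemxAl !scalerA [c * b]mulrC.
Qed.

(** The equation tr^d / det = constant with denominators cleared; this ratio is invariant under both
    conjugation and scaling, hence an invariant of conjugacy classes in PGL_d. *)
Definition conjugacy_poly (B A : 'M[R]_d) : R :=
  \tr A ^+ d * \det B - \tr B ^+ d * \det A.

Lemma conjugacy_poly_conj (X B : 'M[R]_d) (c : R) : X \in unitmx ->
  conjugacy_poly B (c *: (X *m B *m invmx X)) = 0.
Proof.
move=> Xu; rewrite /conjugacy_poly mxtraceZ detZ mxtrace_mulC mulKmx//.
rewrite !det_mulmx det_inv [\det X * _]mulrC -mulrA divff ?mulr1; last first.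
  by rewrite -unitfE -unitmxE.
by rewrite exprMn mulrCA mulrA subrr.
Qed.

Lemma conjugacy_poly_polyfun B : polyfun (conjugacy_poly B).
Proof.
apply: polyfunB; apply: polyfunM; try exact: polyfun_cst.
  by apply/polyfunX/polyfun_tr/mxpolyfun_id.
by apply/polyfun_det/mxpolyfun_id.
Qed.

End ProjectiveMatrices.

Lemma short_conjugates (G : groupType) (S : generating_set G) (L : nat) :
  exists B : seq G, forall g, (translation_length S g <= L)%N ->
    exists b x, b \in B /\ g = (x * b * x^-1)%g.
Proof.
have [B BP] := ball_finite S L; exists B => g.
rewrite /translation_length; case: ex_minnP => m /asboolP[x xm] _ mL.
exists (x^-1 * g * x)%g, x; split; last by rewrite !mulgA mulgV mul1g mulgK.
apply: BP; apply: leq_trans mL.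
by rewrite -xm -word_lengthV /word_dist !invgM !invgK !mulgA.
Qed.

(** Otherwise [f] vanishes on every lift of the image: short elements are conjugate to some [b] in
    [B], which kills a factor [conjugacy_poly], and long ones kill [form_disc]. By density [f] would
    vanish at the matrix of [generic_matrix]. *)
Lemma long_element (R : realType) (d : nat) (G : groupType)
    (S : generating_set G) (rho : {multiplicative G -> PGL R d}) (L : nat) :
  (1 < d)%N -> zariski_dense (range rho) ->
  exists g c, [/\ (L < translation_length S g)%N, c != 0 &
    form_disc (c *: pgl_mx (rho g)) != 0].
Proof.
move=> d1 zd; apply: contrapT => nlong.
have [B BP] := short_conjugates S L.
pose M b := pgl_mx (rho b).
pose f A := form_disc A * \prod_(b <- B) conjugacy_poly (M b) A.
have pf : polyfun f.
  apply: polyfunM; first exact: form_disc_polyfun.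
  by apply: polyfun_prod => b; exact: conjugacy_poly_polyfun.
have [A [Au Ad At]] :=
  @generic_matrix R d [seq \tr (M b) ^+ d / \det (M b) | b <- B] d1.
suff f0 : f A = 0.
  move: f0 => /eqP; rewrite mulf_eq0 (negbTE Ad)/= prodf_seq_eq0 => /hasP[b bB].
  rewrite /= subr_eq0 => /eqP e.
  have Mb : \det (M b) != 0 by rewrite -unitfE -unitmxE pgl_mx_unit.
  have := At _ (map_f (fun b => \tr (M b) ^+ d / \det (M b)) bB).
  by rewrite mulrAC -e mulfK// eqxx.
apply: (zariski_dense_polyfun zd pf) Au => _ c [g _ <-] c0.
have [gL|Lg] := leqP (translation_length S g) L; last first.
  rewrite /f; have [->|Pn0] := eqVneq (form_disc (c *: pgl_mx (rho g))) 0.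
    by rewrite mul0r.
  by case: nlong; exists g, c.
have [b [x [bB ->]]] := BP g gL.
apply/eqP; rewrite mulf_eq0; apply/orP; right.
rewrite prodf_seq_eq0; apply/hasP; exists b => //=.
rewrite !gmulfM multiplicativeV; have [a a0 ->] := pgl_mxJ (rho x) (rho b).
by rewrite scalerA conjugacy_poly_conj ?pgl_mx_unit.
Qed.

(** * The cone over the limit set *)

Section ProjectiveSpace.
Context {R : realType} {V : normedModType R}.
Implicit Types (x y : projective V) (v w : V).

Lemma line_vec_neq0 x : line_vec x != 0.
Proof. exact: (set_valP (repr x)). Qed.

Lemma pi_lineP (v w : @nonzero R V) :
  \pi_(projective V)%qT v = \pi_(projective V)%qT w <->
  exists2 c : R, c != 0 & val w = c *: val v.
Proof.
have h := @eqmodP _ (collinear_equiv V) v w.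
by split=> [/h /asboolP|rt] //; apply/h/asboolP.
Qed.

Lemma line_vec_pi (v : @nonzero R V) : exists2 c : R, c != 0 &
  line_vec (\pi_(projective V)%qT v) = c *: val v.
Proof. by apply/pi_lineP; rewrite reprK. Qed.

Lemma near_line_open v (e : R) :
  open [set x | exists2 c : R, c != 0 & `|c *: line_vec x - v| < e].
Proof.
pose Q := [set w : V | exists2 c : R, c != 0 & `|c *: w - v| < e].
have oQ : open Q.
  have -> : Q = \bigcup_(c in [set c : R | c != 0])
      ((fun w => c *: w) @^-1` ball v e).
    apply/seteqP; split=> w /=.
      by move=> [c c0 cw]; exists c => //=; rewrite -ball_normE /= distrC.
    by move=> [c c0]; rewrite /= -ball_normE /= distrC => cw; exists c.
  apply: bigcup_open => c _; apply: open_comp; last exact: ball_open.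
  by move=> w _; exact: scaler_continuous.
exists Q => //; apply/seteqP; split=> w /= [c c0];
  have [a a0 wE] := line_vec_pi w.
  by exists (c / a); rewrite ?mulf_neq0 ?invr_neq0// wE scalerA divfK.
by rewrite wE scalerA => h; exists (c * a); rewrite ?mulf_neq0.
Qed.

End ProjectiveSpace.

Section Cone.
Context {R : realType} {n : nat}.
Local Notation PV := (projective 'cV[R]_n.+1).
Implicit Types (M : set PV) (v w : 'cV[R]_n.+1).

Definition cone M : set 'cV[R]_n.+1 :=
  [set w | exists z c, [/\ M z, c != 0 & w = c *: line_vec z]].

Lemma cone_neq0 M w : cone M w -> w != 0.
Proof. by move=> [z [c [_ c0 ->]]]; rewrite scaler_eq0 negb_or c0 line_vec_neq0. Qed.

Lemma coneZ M w c : c != 0 -> cone M w -> cone M (c *: w).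
Proof.
move=> c0 [z [a [Mz a0 ->]]]; exists z, (c * a).
by rewrite mulf_neq0// scalerA.
Qed.

Lemma cone_line M z : M z -> cone M (line_vec z).
Proof. by move=> Mz; exists z, 1; rewrite oner_neq0 scale1r. Qed.

Lemma line_vec_act (g : PGL R n.+1) (z : PV) :
  exists2 c : R, c != 0 & line_vec (pgl_act g z) = c *: (pgl_mx g *m line_vec z).
Proof.
exact: (@line_vec_pi _ 'cV[R]_n.+1
  (Sub (pgl_mx g *m line_vec z) (pgl_act_subproof g z))).
Qed.

Lemma cone_act M (g : PGL R n.+1) w : (forall z, M z -> M (pgl_act g z)) ->
  cone M w -> cone M (pgl_mx g *m w).
Proof.
move=> gM [z [a [Mz a0 ->]]]; have [c c0 cE] := line_vec_act g z.
exists (pgl_act g z), (a / c); rewrite mulf_neq0 ?invr_neq0// cE.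
by rewrite -scalemxAr scalerA divfK//; split=> //; exact: gM.
Qed.

Lemma chart_coordZ (i : 'I_n.+1) c w : c != 0 ->
  chart_coord i (c *: w) = chart_coord i w.
Proof.
move=> c0; apply/rowP => j; rewrite !mxE.
by rewrite invfM mulrACA divff ?mul1r.
Qed.

Lemma cone_chart M k v :
  (forall i : 'I_n.+1, C2_submanifold k (affine_chart i @` (M `&` affine_chart_dom i))) ->
  cone M v -> (k <= n)%N /\ exists i U V phi psi y0 c0,
    [/\ flattened_cone (k := k) i (cone M) U V phi psi, V y0, flat_row (k:=k) y0, c0 != 0 &
        v = c0 *: param i psi y0].
Proof.
move=> h Cv; have [i vi] : exists i, v i 0 != 0.
  apply: contrapT => nv; have /negP := cone_neq0 Cv; apply.
  apply/eqP/colP => i; rewrite mxE; apply/eqP/contraT => vi.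
  by case: nv; exists i.
have [kn hi] := h i; split=> //.
pose N := affine_chart i @` (M `&` affine_chart_dom i).
have NE w : cone M w -> w i 0 != 0 -> N (chart_coord i w).
  move=> [z [c [Mz c0 ->]]] wi; exists z; last by rewrite chart_coordZ.
  by split=> //; move: wi; rewrite mxE mulf_eq0 negb_or => /andP[].
have [U [V [phi [psi [[oU Up oV [phiU psiV]] [phiK psiK phiC psiC NU]]]]]] :=
  hi _ (NE v Cv vi).
have phiN w : cone M w -> w i 0 != 0 -> U (chart_coord i w) ->
    flat_row (k:=k) (phi (chart_coord i w)).
  move=> Cw wi Uw.
  have : (phi @` (N `&` U)) (phi (chart_coord i w)).
    by exists (chart_coord i w) => //; split=> //; exact: NE.
  by rewrite NU => -[].
exists i, U, V, phi, psi, (phi (chart_coord i v)), (v i 0).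
split=> //.
- split=> //.
  + by move=> x Ux; rewrite -phiU; exists x.
  + by move=> y Vy; rewrite -psiV; exists y.
  + move=> y c Vy fy c0.
    have : (V `&` [set y | forall j : 'I_n, (k <= j)%N -> y 0 j = 0]) y by split.
    rewrite -NU => -[x [[z [Mz zi] <-] Uz] <-]; rewrite phiK//.
    exists z, (c / line_vec z i 0); rewrite mulf_neq0 ?invr_neq0//.
    split=> //; have zE := chart_coordK (i := i) (w := line_vec z) zi.
    transitivity ((c / line_vec z i 0) *: (line_vec z i 0 *: chart_inv i
      (chart_coord i (line_vec z)))); first by rewrite scalerA divfK.
    by rewrite -zE.
- by rewrite -phiU; exists (chart_coord i v).
- exact: phiN.
- by rewrite /param phiK// -chart_coordK.
Qed.

End Cone.

(** The minors of [w] and [t * w] vanish, which controls those of nearby vectors with a bound free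
    of [t], as the scalars relating lines have no a priori bound. *)
Lemma minor_bound {R : realFieldType} (e t v1 v2 w1 w2 l1 l2 : R) :
  `|w1 - v1| <= e -> `|w2 - v2| <= e ->
  `|t * w1 - l1| <= e -> `|t * w2 - l2| <= e ->
  `|v1 * l2 - v2 * l1| <= e * (`|v1| + `|v2| + `|l1| + `|l2| + 2 * e).
Proof.
move=> a1 a2 b1 b2; have e0 : 0 <= e := le_trans (normr_ge0 _) a1.
have -> : v1 * l2 - v2 * l1 = (v2 + (w2 - v2)) * (t * w1 - l1)
    - (v1 + (w1 - v1)) * (t * w2 - l2) + ((w2 - v2) * l1 - (w1 - v1) * l2) by ring.
have t1 : `|(v2 + (w2 - v2)) * (t * w1 - l1)| <= (`|v2| + e) * e.
  by rewrite normrM ler_pM// (le_trans (ler_normD _ _))// lerD2l.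
have t2 : `|(v1 + (w1 - v1)) * (t * w2 - l2)| <= (`|v1| + e) * e.
  by rewrite normrM ler_pM// (le_trans (ler_normD _ _))// lerD2l.
have t3 : `|(w2 - v2) * l1| <= e * `|l1| by rewrite normrM ler_pM.
have t4 : `|(w1 - v1) * l2| <= e * `|l2| by rewrite normrM ler_pM.
apply: le_trans (ler_normD _ _) _.
apply: le_trans (lerD (ler_normB _ _) (ler_normB _ _)) _.
apply: le_trans (lerD (lerD t1 t2) (lerD t3 t4)) _.
by move: `|v1| `|v2| `|l1| `|l2| => *; nra.
Qed.

Section BoundaryCone.
Context {R : realType} {n : nat} {G : groupType} {S : generating_set G}.
Local Notation PV := (projective 'cV[R]_n.+1).
Context (xi : boundary S -> PV) (xi_cont : continuous xi).
Local Notation C := (cone (range xi)).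
Implicit Types (v w : 'cV[R]_n.+1).

Lemma near_lift x v c e : c != 0 -> v = c *: line_vec (xi x) -> 0 < e ->
  nbhs x [set y | exists2 a : R, a != 0 & `|a *: line_vec (xi y) - v| < e].
Proof.
move=> c0 vE e0; have oO := near_line_open v e.
have nO := open_nbhs_nbhs (conj oO (_ : _ (xi x))).
suff /nO/xi_cont : [set z | exists2 a : R, a != 0 & `|a *: line_vec z - v| < e] (xi x) by [].
by exists c => //; rewrite vE subrr normr0.
Qed.

(** The lines of the approximating vectors cluster at some [xi x] by compactness of the boundary;
    the minors of [v] with [line_vec (xi x)] are then arbitrarily small, so the two are
    proportional. *)
Lemma cone_closed v : word_hyperbolic S -> v != 0 ->
  (forall e, 0 < e -> exists2 w, C w & `|w - v| <= e) -> C v.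
Proof.
move=> hyp v0 Cv.
have /choice[w wP] : forall k : nat, exists w, C w /\ `|w - v| <= k.+1%:R^-1.
  by move=> k; have [|w] := Cv k.+1%:R^-1; [|exists w].
have /choice[y yP] : forall k, exists y, exists2 c, c != 0 & w k = c *: line_vec (xi y).
  by move=> k; have [[_ [c [[y _ <-] c0 wE]]] _] := wP k; exists y, c.
have [x xP] := boundary_cluster y hyp.
pose l := line_vec (xi x).
have minor0 i j : v i 0 * l j 0 - v j 0 * l i 0 = 0.
  apply: (norm_small0 (K := 1)) => e e0; rewrite mulr1.
  pose K := `|v i 0| + `|v j 0| + `|l i 0| + `|l j 0| + 2.
  have K0 : 0 < K by rewrite /K ltr_wpDl ?addr_ge0.
  pose e1 := Num.min 1 (e / K).
  have e10 : 0 < e1 by rewrite lt_min ltr01 divr_gt0.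
  have [N Ne] : exists N : nat, N.+1%:R^-1 <= e1.
    exists (Num.truncn e1^-1); rewrite -[leRHS]invrK lef_pV2 ?posrE ?invr_gt0//.
    exact/ltW/truncnS_gt.
  have nO := near_lift (oner_neq0 R) (esym (scale1r l)) e10.
  have [k Nk [a a0 ak]] := xP _ nO N.
  have [c c0 wE] := yP k.
  have wk : `|w k - v| <= e1.
    have [_ /le_trans->//] := wP k; apply: le_trans Ne.
    by rewrite lef_pV2 ?posrE// ler_nat.
  have tk : `|(a / c) *: w k - l| <= e1 by rewrite wE scalerA divfK// ltW.
  have h1 := @minor_bound R e1 (a / c) (v i 0) (v j 0) (w k i 0) (w k j 0) (l i 0) (l j 0).
  apply: le_trans (h1 _ _ _ _) _.
  - by apply: le_trans wk; have := entry_le_norm (w k - v) i 0; rewrite !mxE.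
  - by apply: le_trans wk; have := entry_le_norm (w k - v) j 0; rewrite !mxE.
  - by apply: le_trans tk; have := entry_le_norm ((a / c) *: w k - l) i 0; rewrite !mxE.
  - by apply: le_trans tk; have := entry_le_norm ((a / c) *: w k - l) j 0; rewrite !mxE.
  apply: (@le_trans _ _ (e1 * K)).
    rewrite ler_pM2l// lerD2l -[leRHS]mulr1 ler_pM2l//.
    by rewrite ge_min lexx.
  by rewrite -ler_pdivlMr// ge_min lexx orbT.
have [i li] : exists i, l i 0 != 0.
  apply: contrapT => nl; have /negP := line_vec_neq0 (xi x); apply.
  apply/eqP/colP => i; rewrite mxE; apply/eqP/contraT => li.
  by case: nl; exists i.
have vE : v = (v i 0 / l i 0) *: l.
  apply/colP => j; rewrite mxE; have /eqP := minor0 j i; rewrite subr_eq0 => /eqP e.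
  by rewrite mulrAC -e mulfK.
exists (xi x), (v i 0 / l i 0); split=> //.
by apply: contra_neq v0 => c0; rewrite vE c0 scale0r.
Qed.

End BoundaryCone.

(** * Dense orbits and attraction to the fixed line *)

Section ZariskiOrbit.
Context {R : realType} {n : nat}.
Implicit Types (u v w : 'cV[R]_n) (l : 'rV[R]_n).

Lemma pair_deltar l i : pair l (delta_mx i 0) = l 0 i.
Proof. by rewrite /pair -colE mxE. Qed.

Lemma row_neq0 l : l != 0 -> exists i, l 0 i != 0.
Proof.
move=> l0; apply: contrapT => nl; have /negP := l0; apply.
by apply/eqP/rowP => i; rewrite mxE; apply/eqP/contraT => li; case: nl; exists i.
Qed.

Lemma col_neq0 u : u != 0 -> exists i, u i 0 != 0.
Proof.
move=> u0; apply: contrapT => nu; have /negP := u0; apply.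
by apply/eqP/colP => i; rewrite mxE; apply/eqP/contraT => ui; case: nu; exists i.
Qed.

Lemma common_nonzero l l' : l != 0 -> l' != 0 ->
  exists u, pair l u != 0 /\ pair l' u != 0.
Proof.
move=> /row_neq0[i li] /row_neq0[j l'j].
have [l'i|l'i] := eqVneq (l' 0 i) 0; last first.
  by exists (delta_mx i 0); rewrite !pair_deltar.
have [lj|lj] := eqVneq (l 0 j) 0; last first.
  by exists (delta_mx j 0); rewrite !pair_deltar.
exists (delta_mx i 0 + delta_mx j 0); rewrite !pairD !pair_deltar.
by rewrite lj l'i addr0 add0r.
Qed.

Lemma unitmx_transitive u v : u != 0 -> v != 0 ->
  exists2 A, A \in unitmx & A *m u = v.
Proof.
move=> u0 v0; have [i ui] := col_neq0 u0.
have tr0 w : w != 0 -> w^T != 0 by rewrite -(inj_eq trmx_inj) trmx0.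
(* A matrix of rank one sending [u^T] to [v^T]; [complete_unitmx] replaces it by an invertible one
   that agrees with it on [u^T]. *)
pose f := ((u i 0)^-1 *: delta_mx i 0 : 'cV[R]_n) *m v^T.
have uf : u^T *m f = v^T.
  rewrite /f mulmxA -scalemxAr -colE.
  have -> : col i u^T = ((u i 0)%:M : 'M[R]_1).
    by apply/matrixP => a b; rewrite !ord1 !mxE eqxx.
  by rewrite scale_scalar_mx mulVf// mul1mx.
have [|g gu ug] := @complete_unitmx _ _ _ u^T f.
  by rewrite uf !rank_rV !tr0.
exists g^T; first by rewrite unitmx_tr.
by apply: trmx_inj; rewrite trmx_mul trmxK -ug uf.
Qed.

(** The polynomial [f] cannot vanish on all invertible matrices, since these move [u] to any nonzero
    vector, in particular off both kernels. *)
Lemma zariski_orbit (E : set (PGL R n)) u l l' : zariski_dense E ->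
  u != 0 -> l != 0 -> l' != 0 ->
  exists2 g, E g & pair l (pgl_mx g *m u) != 0 /\ pair l' (pgl_mx g *m u) != 0.
Proof.
move=> zE u0 l0 l'0; apply: contrapT => ng.
pose f A := pair l (A *m u) * pair l' (A *m u).
have pl (k : 'rV[R]_n) : polyfun (fun A => pair k (A *m u)).
  exact: mxpolyfunM (mxpolyfun_cst k) (mxpolyfunM mxpolyfun_id (mxpolyfun_cst u)) 0 0.
have [v [lv l'v]] := common_nonzero l0 l'0.
have v0 : v != 0 by apply: contra_neq lv => ->; rewrite pair0.
have [A Au Auv] := unitmx_transitive u0 v0.
suff : f A = 0 by rewrite /f Auv => /eqP; rewrite mulf_eq0 (negbTE lv) (negbTE l'v).
apply: (zariski_dense_polyfun zE (polyfunM (pl l) (pl l'))) Au => g c Eg c0.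
rewrite -!scalemxAl !pairZ.
apply/eqP; rewrite !mulf_eq0 !(negbTE c0)/=.
by apply: contrapT => /negP; rewrite negb_or => /andP[h1 h2]; apply: ng; exists g.
Qed.

End ZariskiOrbit.

Section ConormalTransport.
Context {R : realType} {n : nat} (C : set 'cV[R]_n).
Implicit Types (v w : 'cV[R]_n) (l : 'rV[R]_n) (A : 'M[R]_n).

Lemma pairM l A w : pair (l *m A) w = pair l (A *m w).
Proof. by rewrite /pair mulmxA. Qed.

Lemma conormal_mulmx m A v l : (forall w, C w -> C (A *m w)) ->
  conormal m C (A *m v) l -> conormal m C v (l *m A).
Proof.
move=> CA h e e0.
pose K := n%:R * `|A| + 1; have K0 : 0 < K by rewrite ltr_wpDl ?mulr_ge0.
have KP w : `|A *m w - A *m v| <= K * `|w - v|.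
  rewrite -mulmxBr (le_trans (mulmx_norm_le _ _))// ler_wpM2r//.
  by rewrite /K lerDl.
have [|d d0 dP] := h (e / K ^+ m); first by rewrite divr_gt0 ?exprn_gt0.
exists (d / K) => [|w Cw wv]; first by rewrite divr_gt0.
rewrite pairM (le_trans (dP _ (CA _ Cw) _))//.
  by rewrite (le_lt_trans (KP w))// mulrC -ltr_pdivlMr.
apply: (@le_trans _ _ (e / K ^+ m * (K * `|w - v|) ^+ m)).
  rewrite ler_wpM2l ?divr_ge0 ?exprn_ge0 ?(ltW e0) ?(ltW K0)//.
  by rewrite lerXn2r ?nnegrE ?mulr_ge0// ltW.
by rewrite exprMn mulrA divfK// expf_neq0 ?gt_eqF.
Qed.

Lemma flat_at_mulmx A v : A \in unitmx -> (forall w, C w -> C (A *m w)) ->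
  (forall w, C w -> C (invmx A *m w)) -> flat_at C v -> flat_at C (A *m v).
Proof.
move=> Au CA CV fv l lc.
have := @conormal_mulmx 2 (invmx A) (A *m v) (l *m A) CV.
rewrite mulKmx// mulmxK//; apply; apply: fv.
exact: conormal_mulmx lc.
Qed.

End ConormalTransport.

Section Attraction.
Context {R : realType} {n : nat} (C : set 'cV[R]_n.+1).
Implicit Types (u v w : 'cV[R]_n.+1).
Context (CZ : forall c w, c != 0 -> C w -> C (c *: w)).
Context (closedC : forall w, w != 0 ->
  (forall e, 0 < e -> exists2 w', C w' & `|w' - w| <= e) -> C w).
Context (B : 'M[R]_n.+1) (Bu : B \in unitmx).
Context (CB : forall w, C w -> C (B *m w)).
Context (CV : forall w, C w -> C (invmx B *m w)).
Context (v : 'cV[R]_n.+1) (phi : 'rV[R]_n.+1).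
Context (Bv : B *m v = v) (phiv : pair phi v = 1).
Context (lim : forall u, vanishes (fun k => `|B ^+ k *m u - pair phi u *: v|)).

Lemma attracting_neq0 : v != 0.
Proof. by apply: contra_eq_neq phiv => ->; rewrite pair0 eq_sym oner_neq0. Qed.

Lemma mulmx_expS (A : 'M[R]_n.+1) k w : A ^+ k.+1 *m w = A *m (A ^+ k *m w).
Proof. by rewrite exprS -[A * _]/(A *m _) mulmxA. Qed.

Lemma invariant_exp (A : 'M[R]_n.+1) k w : (forall w, C w -> C (A *m w)) ->
  C w -> C (A ^+ k *m w).
Proof.
move=> CA Cw; elim: k => [|k IH]; first by rewrite expr0 mul1mx.
by rewrite mulmx_expS; exact: CA.
Qed.

Lemma fixed_exp (A : 'M[R]_n.+1) k : A *m v = v -> A ^+ k *m v = v.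
Proof.
move=> Av; elim: k => [|k IH]; first by rewrite expr0 mul1mx.
by rewrite mulmx_expS IH.
Qed.

Lemma invmx_exp_mulK k : invmx B ^+ k *m B ^+ k = 1%:M.
Proof.
elim: k => [|k IH]; first by rewrite !expr0 mul1mx.
rewrite exprSr exprS mulmxE mulrA -[invmx B ^+ k * _ * _]mulrA.
by rewrite -[invmx B * _]/(_ *m _) mulVmx// mulr1.
Qed.

Lemma attracted u e : pair phi u != 0 -> 0 < e ->
  exists k, `|(pair phi u)^-1 *: (B ^+ k *m u) - v| < e.
Proof.
move=> pu e0; pose a := `|pair phi u|.
have a0 : 0 < a by rewrite normr_gt0.
have [k /(_ k (leqnn k)) h] := lim u (mulr_gt0 (divr_gt0 e0 (ltr0Sn _ 1)) a0).
exists k.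
have -> : (pair phi u)^-1 *: (B ^+ k *m u) - v =
    (pair phi u)^-1 *: (B ^+ k *m u - pair phi u *: v).
  by rewrite scalerBr scalerA mulVf// scale1r.
rewrite normrZ normfV -/a mulrC ltr_pdivrMr//; apply: le_lt_trans h _.
by rewrite ltr_pM2r// ltr_pdivrMr// ltr_pMr// ltr1n.
Qed.

Lemma attracting_mem u : C u -> pair phi u != 0 -> C v.
Proof.
move=> Cu pu; apply: closedC attracting_neq0 _ => e e0.
have [k ke] := attracted pu e0; exists ((pair phi u)^-1 *: (B ^+ k *m u)).
  by apply: CZ; rewrite ?invr_neq0//; exact: invariant_exp.
exact: ltW.
Qed.

(* Conormals at v are permuted by B, and B contracts the cone to v. *)
Lemma conormal_vanishes l u :
  (exists2 d, 0 < d & forall l, conormal 1 C v l ->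
    forall w, C w -> `|w - v| < d -> pair l w = 0) ->
  conormal 1 C v l -> C u -> pair phi u != 0 -> pair l u = 0.
Proof.
move=> [d d0 dP] lc Cu pu; have [k ke] := attracted pu d0.
have lc' : conormal 1 C v (l *m invmx B ^+ k).
  apply: conormal_mulmx; first by move=> w; exact: invariant_exp.
  by rewrite fixed_exp// -{1}Bv mulKmx.
have Cw : C ((pair phi u)^-1 *: (B ^+ k *m u)).
  by apply: CZ; rewrite ?invr_neq0//; exact: invariant_exp.
have /eqP := dP _ lc' _ Cw ke.
rewrite pairZ mulf_eq0 invr_eq0 (negbTE pu) pairM mulmxA invmx_exp_mulK mul1mx.
by move/eqP.
Qed.

(** Off the kernel of [phi], a power of [B] brings the line of the vector into the ball and its
    inverse brings it back. Nonzero vectors of the kernel follow by closedness, approached in the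
    direction [v]. *)
Lemma open_cone_full u :
  (exists2 d, 0 < d & forall w, `|w - v| < d -> C w) -> u != 0 -> C u.
Proof.
move=> [d d0 dP].
have Cphi w : pair phi w != 0 -> C w.
  move=> pw; have [k ke] := attracted pw d0.
  have := CZ pw (dP _ ke); rewrite scalerA divff// scale1r.
  by move/(invariant_exp k CV); rewrite mulmxA invmx_exp_mulK mul1mx.
move=> u0; have [pu|/Cphi//] := eqVneq (pair phi u) 0.
apply: closedC u0 _ => e e0.
have v0 : 0 < `|v| by rewrite normr_gt0 attracting_neq0.
exists (u + (e / `|v|) *: v).
  by apply: Cphi; rewrite pairD pairZ pu phiv add0r mulr1 gt_eqF ?divr_gt0.
by rewrite addrC addKr normrZ gtr0_norm ?divr_gt0// divfK ?gt_eqF.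
Qed.

End Attraction.

Section ProximalElements.
Context {R : realType} {n : nat}.

Lemma eigenmoduli_ge0 (A : 'M[R]_n.+1) i : 0 <= (eigenmoduli A)`_i.
Proof.
have [iA|iA] := ltnP i (size (eigenmoduli A)); last by rewrite nth_default.
have := mem_nth 0 iA; rewrite mem_sort => /mapP[z _ ->].
exact: normc_ge0.
Qed.

Lemma ln_ratio_gt0 (x y : R) : 0 <= y -> 0 < ln (x / y) -> y < x.
Proof.
move=> y0 lxy; have xy : 1 < x / y.
  by rewrite ltNge; apply: contraL lxy => /ln_le0; rewrite -leNgt.
have y1 : 0 < y.
  (* For [y = 0] the quotient [x / y] is 0 by convention, contradicting [1 < x / y]. *)
  rewrite lt_neqAle y0 andbT; apply: contraTneq xy => <-.
  by rewrite invr0 mulr0 ltr10.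
by rewrite ltr_pdivlMr// mul1r in xy.
Qed.

Lemma proximal_normal (g : PGL R n.+1) : lambda 2 g < lambda 1 g ->
  exists (b : R) (v : 'cV[R]_n.+1) (phi : 'rV[R]_n.+1), b != 0 /\
    [/\ (b *: pgl_mx g) *m v = v, phi *m (b *: pgl_mx g) = phi, pair phi v = 1 &
     forall u, vanishes (fun k => `|(b *: pgl_mx g) ^+ k *m u - pair phi u *: v|)].
Proof.
move=> /proximal_limit[lam [v [phi [lam0 Av phiA phiv lim]]]].
have [a a0 aE] : exists2 a, a != 0 & pgl_lift g = a *: pgl_mx g.
  exists (`|\det (pgl_mx g)| `^ (- n.+1%:R^-1)) => //.
  rewrite gt_eqF// powR_gt0// normr_gt0 -unitfE -unitmxE.
  exact: (valP (repr g)).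
exists (lam^-1 * a), v, phi; rewrite mulf_neq0 ?invr_neq0//; split=> //.
rewrite -scalerA -aE; split=> //.
- by rewrite -scalemxAl Av scalerA mulVf// scale1r.
- by rewrite -scalemxAr phiA scalerA mulVf// scale1r.
- move=> u e e0; have [N NP] := lim u e e0; exists N => k /NP.
  by move=> h; rewrite exprZn -scalemxAl; exact: h.
Qed.

End ProximalElements.

Lemma translation_length_le (G : groupType) (S : generating_set G) g :
  (translation_length S g <= word_length S g)%N.
Proof.
rewrite /translation_length; case: ex_minnP => m _; apply.
apply/asboolP; exists 1%g.
by rewrite mulg1 word_distC dist1.
Qed.

Section TransverseMap.
Context {R : realType} {n : nat}.

(** The kernel of a nonzero form has dimension [n], at least 2; the witnesses are Koszul-type
    relations between a nonzero coordinate and two others. *)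
Lemma kernel_two_lines (th : 'rV[R]_n.+1) : (1 < n)%N -> th != 0 -> exists a b : 'cV[R]_n.+1,
  [/\ a != 0, b != 0, pair th a = 0, pair th b = 0 & forall c, a <> c *: b].
Proof.
move=> n1 /row_neq0[i thi].
have [j [k [ji ki jk]]] : exists j k : 'I_n.+1, [/\ j != i, k != i & j != k].
  exists (lift i (Ordinal (ltnW n1))), (lift i (Ordinal n1)).
  by rewrite -![_ == i]eq_sym !neq_lift (inj_eq lift_inj).
have pth (p q : 'I_n.+1) : pair th (th 0 p *: delta_mx q 0 - th 0 q *: delta_mx p 0) = 0.
  by rewrite pairB !pairZ !pair_deltar mulrC subrr.
exists (th 0 i *: delta_mx j 0 - th 0 j *: delta_mx i 0),
  (th 0 i *: delta_mx k 0 - th 0 k *: delta_mx i 0).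
have e1 : (th 0 i *: delta_mx j 0 - th 0 j *: delta_mx i 0 : 'cV[R]_n.+1) j 0 = th 0 i.
  by rewrite !mxE !eqxx (negbTE ji) mulr1 mulr0 subr0.
have e2 : (th 0 i *: delta_mx k 0 - th 0 k *: delta_mx i 0 : 'cV[R]_n.+1) k 0 = th 0 i.
  by rewrite !mxE !eqxx (negbTE ki) mulr1 mulr0 subr0.
split=> //.
- by apply: contra_neq thi => e; rewrite -e1 e mxE.
- by apply: contra_neq thi => e; rewrite -e2 e mxE.
- move=> c e; move: thi; rewrite -e1 e !mxE (negbTE ji) (negbTE jk).
  by rewrite !mulr0 subr0 mulr0 eqxx.
Qed.

End TransverseMap.

Section LimitCone.
Context {R : realType} {n : nat} {G : groupType} {S : generating_set G}.
Context (hyp : word_hyperbolic S) (rho : {multiplicative G -> PGL R n.+1}).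
Context (xi : boundary S -> projective 'cV[R]_n.+1) (xi_cont : continuous xi).
Context (xi_equiv : forall g x, xi (boundary_act g x) = pgl_act (rho g) (xi x)).
Context (dense : zariski_dense (range rho)).
Local Notation C := (cone (range xi)).
Implicit Types (g : G) (v w u : 'cV[R]_n.+1) (l : 'rV[R]_n.+1).

Lemma limit_cone_act g w : C w -> C (pgl_mx (rho g) *m w).
Proof.
by apply: cone_act => _ [x _ <-]; exists (boundary_act g x).
Qed.

Lemma limit_cone_scaled_act g b w :
  b != 0 -> C w -> C ((b *: pgl_mx (rho g)) *m w).
Proof.
by move=> b0 Cw; rewrite -scalemxAl; apply: coneZ => //; exact: limit_cone_act.
Qed.

Lemma limit_cone_scaled_inv g b w :
  b != 0 -> C w -> C (invmx (b *: pgl_mx (rho g)) *m w).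
Proof.
move=> b0 Cw; have [a a0 aE] := pgl_mxV (rho g).
have bu : b *: pgl_mx (rho g) \in unitmx by rewrite unitmxZ ?unitfE ?pgl_mx_unit.
have -> : invmx (b *: pgl_mx (rho g)) = (b^-1 * a^-1) *: pgl_mx (rho g^-1%g).
  by rewrite multiplicativeV aE scalerA divfK// invmxZ.
by apply: limit_cone_scaled_act; rewrite ?mulf_neq0 ?invr_neq0.
Qed.

Lemma limit_cone_spans (x0 : boundary S) l l' : l != 0 -> l' != 0 ->
  exists2 u, C u & pair l u != 0 /\ pair l' u != 0.
Proof.
move=> l0 l'0.
have [_ [g _ <-] h] := zariski_orbit dense (line_vec_neq0 (xi x0)) l0 l'0.
exists (pgl_mx (rho g) *m line_vec (xi x0)) => //.
by apply/limit_cone_act/cone_line; exists x0.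
Qed.

Lemma flat_at_scaled_act g b v : b != 0 ->
  flat_at C v -> flat_at C ((b *: pgl_mx (rho g)) *m v).
Proof.
move=> b0; apply: flat_at_mulmx.
- by rewrite unitmxZ ?unitfE ?pgl_mx_unit.
- by move=> w; exact: limit_cone_scaled_act.
- by move=> w; exact: limit_cone_scaled_inv.
Qed.

Lemma flat_atZ b v : b != 0 -> flat_at C v -> flat_at C (b *: v).
Proof.
move=> b0; rewrite -mul_scalar_mx; apply: flat_at_mulmx => [|w|w].
- by rewrite -scalemx1 unitmxZ ?unitfE ?unitmx1.
- by rewrite mul_scalar_mx; exact: coneZ.
- by rewrite invmx_scalar mul_scalar_mx; apply: coneZ; rewrite invr_neq0.
Qed.

Lemma line_vec_boundary_act g x : exists2 c : R, c != 0 &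
  line_vec (xi (boundary_act g x)) = (c *: pgl_mx (rho g)) *m line_vec (xi x).
Proof.
rewrite xi_equiv; have [c c0 cE] := line_vec_act (rho g) (xi x).
by exists c => //; rewrite cE scalemxAl.
Qed.

(** If the group fixed [x], it would fix the line of [xi x]; density moves this line out of the
    kernel of a form [l] that vanishes on it. *)
Lemma limit_cone_moved (x : boundary S) : (0 < n)%N -> exists g, x <> boundary_act g x.
Proof.
move=> n0; apply: contrapT => ng; pose u := line_vec (xi x).
have [i ui] := col_neq0 (line_vec_neq0 (xi x)).
pose j := lift i (Ordinal n0).
pose l : 'rV[R]_n.+1 := u i 0 *: delta_mx 0 j - u j 0 *: delta_mx 0 i.
have ji : j != i by rewrite eq_sym neq_lift.
have l0 : l != 0.
  apply: contra_neq ui => l0; have := congr1 (fun m : 'rV[R]_n.+1 => m 0 j) l0.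
  by rewrite !mxE !eqxx (negbTE ji) mulr1 mulr0 subr0.
have pd (w : 'cV[R]_n.+1) k : pair (delta_mx 0 k) w = w k 0.
  by rewrite /pair -rowE mxE.
have lu : pair l u = 0.
  by rewrite /l -scaleN1r !pairDl !pairZl !pd mulN1r mulrC subrr.
have [_ [g _ <-] [h _]] := zariski_orbit dense (line_vec_neq0 (xi x)) l0 l0.
have gx : x = boundary_act g x by apply: contrapT => gx; apply: ng; exists g.
have [c c0] := line_vec_boundary_act g x; rewrite -gx -scalemxAl => uE.
by move: lu; rewrite /u uE pairZ => /eqP; rewrite mulf_eq0 (negbTE c0) (negbTE h).
Qed.

Context (k : nat) (smooth : forall i : 'I_n.+1,
  C2_submanifold k (affine_chart i @` (range xi `&` affine_chart_dom i))).

Lemma flat_everywhere v : (0 < n)%N -> C v -> flat_at C v ->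
  forall w, C w -> flat_at C w.
Proof.
move=> n0 [_ [c [[p _ <-] c0 ->]]] fv.
pose F : set (boundary S) := [set x | flat_at C (line_vec (xi x))].
have Fp : F p.
  by rewrite /F /= -[line_vec _](scalerK c0); apply: flat_atZ; rewrite ?invr_neq0.
have actF g x : F x -> F (boundary_act g x).
  rewrite /F /=; have [b b0 ->] := line_vec_boundary_act g x.
  exact: flat_at_scaled_act.
have closedF : closed F.
  move=> x Fx; rewrite /F /=.
  have Cx : C (line_vec (xi x)) by apply: cone_line; exists x.
  have [_ [i [U [V [f [psi [y0 [c1 [fc Vy Fy c10 vE]]]]]]]]] := cone_chart smooth Cx.
  rewrite vE; apply: (flat_at_closed fc Vy Fy c10) => d d0.
  have [y [Fy' [a a0 ay]]] :=
    Fx _ (near_lift xi_cont (oner_neq0 R) (esym (scale1r (line_vec (xi x)))) d0).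
  exists (a *: line_vec (xi y)); rewrite -vE; split=> //.
    by apply: coneZ => //; apply: cone_line; exists y.
  exact: flat_atZ.
(* [boundary_minimal] asks for two points of [F]: the second one is a translate of [p]. *)
have [g pg] := limit_cone_moved p n0.
have FT := boundary_minimal hyp closedF actF Fp (actF g p Fp) pg.
move=> _ [_ [b [[x _ <-] b0 ->]]]; apply: flat_atZ => //.
by have : F x by rewrite FT.
Qed.

End LimitCone.

Theorem corollary1p48 (R : realType) (d : nat) (d_gt2 : (2 < d)%N)
    (Gamma : groupType) (S : generating_set Gamma)
    (hyp : word_hyperbolic S)
    (rho : {multiplicative Gamma -> PGL R d})
    (xi : boundary S -> projective 'cV[R]_d)
    (eta : boundary S -> projective 'rV[R]_d)
    (anosov : projective_anosov rho xi eta)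
    (dense : zariski_dense (range rho)) :
  ~ projective_C2_submanifold (range xi).
Proof.
case: d d_gt2 rho xi eta anosov dense => [//|n] n2 rho xi eta.
move=> [[xi_cont _] equiv _ trans [K [c [K0 c0 gap]]]] zd [k smooth].
have n1 : (1 < n)%N by [].
have n0 : (0 < n)%N := ltnW n1.
have xi_equiv g x : xi (boundary_act g x) = pgl_act (rho g) (xi x) by case: (equiv g x).
pose C := cone (range xi).
have [x0 _] : exists x : boundary S, True.
  apply: boundary_nonempty => m; have [g [_ [mg _ _]]] := long_element S m (ltnW n2) zd.
  by exists g; apply: leq_trans (ltnW mg) (translation_length_le _ _).
(* Beyond the translation length [c / K], the lower bound on the logarithm of the spectral gap is
   positive, so [rho g] is proximal. *)
have [g [a [gL a0 fd]]] := long_element S (Num.truncn (c / K)) (ltnW n2) zd.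
have g_prox : lambda 2 (rho g) < lambda 1 (rho g).
  apply: ln_ratio_gt0; first exact: eigenmoduli_ge0.
  apply: lt_le_trans (gap g); rewrite subr_gt0 mulrC -ltr_pdivrMr//.
  by apply: lt_le_trans (truncnS_gt _) _; rewrite ler_nat.
have [b [v [phi [b0 [Bv phiB phiv lim]]]]] := proximal_normal g_prox.
set B := b *: _ in Bv phiB lim.
have Bu : B \in unitmx by rewrite unitmxZ ?unitfE ?pgl_mx_unit.
have CB w : C w -> C (B *m w) by exact: limit_cone_scaled_act.
have CV w : C w -> C (invmx B *m w) by exact: limit_cone_scaled_inv.
have CZ e w : e != 0 -> C w -> C (e *: w) by exact: coneZ.
have Ccl := fun w => @cone_closed R n Gamma S xi xi_cont w hyp.
have phi0 : phi != 0.
  by apply: contra_eq_neq phiv => ->; rewrite /pair mul0mx mxE eq_sym oner_neq0.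
have Cv : C v.
  have [u Cu [pu _]] := limit_cone_spans xi_equiv zd x0 phi0 phi0.
  exact: (attracting_mem CZ Ccl CB phiv lim Cu pu).
have [kn [i [U [V [f [psi [y0 [c1 [fc Vy Fy c10 vE]]]]]]]]] := cone_chart smooth Cv.
have [kn'|nk] := ltnP k n.
  have flv : flat_at C v.
    (* [form_disc] is known to be nonzero for the lift by [a], whereas [B] is the lift that fixes
       [v]; [mu] is the eigenvalue of the former at [v]. *)
    pose mu := a / b.
    have mu0 : mu != 0 by rewrite mulf_neq0 ?invr_neq0.
    have AE : a *: pgl_mx (rho g) = mu *: B by rewrite /B scalerA divfK.
    apply: (@eigenvector_flat _ _ C v (a *: pgl_mx (rho g)) mu phi) => //.
    - by rewrite AE -scalemxAl Bv.
    - by move=> w Cw; rewrite AE -scalemxAl scalerA mulVf// scale1r; exact: CB.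
    - by rewrite AE -scalemxAr phiB.
    - by rewrite vE => l; exact: (conormal_quadratic fc Vy Fy c10).
  have allflat := flat_everywhere hyp xi_cont xi_equiv zd smooth n0 Cv flv.
  have [l l0 lc] := exists_conormal fc kn' Vy Fy c10.
  have van := flat_locally_linear fc Vy Fy c10 allflat.
  rewrite -vE in lc van.
  have [u Cu [lu pu]] := limit_cone_spans xi_equiv zd x0 l0 phi0.
  move/negP: lu; apply; apply/eqP.
  exact: (conormal_vanishes CZ Bu CB CV Bv lim van lc Cu pu).
have kE : k = n by apply/eqP; rewrite eqn_leq kn nk.
have Cfull u : u != 0 -> C u.
  apply: (open_cone_full CZ Ccl Bu CV phiv lim).
  by rewrite vE; exact: (cone_open fc kE Vy c10).
pose th := line_vec (eta x0).
have th0 : th != 0 := line_vec_neq0 _.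
(* By transversality [xi x0] is the only limit line that can lie in the kernel of [eta x0], while a
   full cone puts every line of that kernel in the limit set. *)
have ker x : pair th (line_vec (xi x)) = 0 -> x = x0.
  move=> thx; apply: contrapT => /trans tx.
  have [j thj] := row_neq0 th0.
  have [s [u [thu uE]]] := tx (delta_mx j 0).
  move/negP: thj; apply; rewrite -pair_deltar uE pairD pairZ thx mulr0 add0r.
  by rewrite /pair thu mxE.
have [u [w [u0 w0 thu thw nuw]]] := kernel_two_lines n1 th0.
have kline z : z != 0 -> pair th z = 0 -> exists2 e, e != 0 & z = e *: line_vec (xi x0).
  move=> /Cfull[_ [e [[x _ <-] e0 ->]]]; rewrite pairZ => /eqP.
  by rewrite mulf_eq0 (negbTE e0) => /eqP /ker ->; exists e.
have [e e0 uE] := kline u u0 thu; have [e' e'0 wE] := kline w w0 thw.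
by apply: (nuw (e / e')); rewrite uE wE scalerA divfK.
Qed.
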